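(* Let $X\subseteq Z$ be an explicit general arrangement variety of complexity $c(X)=c$. Then the canonical class of $X$ is given in terms of the generator degrees $w_{ij}=\deg(T_{ij})$ and $w_k=\deg(S_k)$ as $$\mathcal{K}_X\ =\ -\sum_{i=0}^r\sum_{j=1}^{n_i}w_{ij}\ -\ \sum_{k=1}^m w_k\ +\ (r-c)\sum_{j=1}^{n_0}l_{0j}w_{0j}\ \in\ K=\mathrm{Cl}(X).$$
   Context: $\mathbb{K}$ is an algebraically closed field of characteristic zero; varieties are integral separated schemes of finite type over $\mathbb{K}$. $\mathbb{T}^n=(\mathbb{K}^* )^n$. Toric conventions. For a fan $\Sigma$ in $\mathbb{Z}^N$ with generator matrix $P$ (columns: the primitive generators of the rays), where the columns generate the rational vector space, Cox's quotient presentation $p\colon\hat Z\to Z_\Sigma$ is as follows: $\hat Z\subseteq\bar Z=\mathbb{K}^{M}$ ($M$ the number of rays) is the open toric subvariety defined by the fan of faces $\tau$ of the orthant $\mathbb{Q}^M_{\ge0}$ with $P(\tau)\subseteq\sigma$ for some $\sigma\in\Sigma$, and $p$ is the toric morphism defined by $P$, a good quotient by $H=\mathrm{Spec}\,\mathbb{K}[\mathbb{Z}^M/\mathrm{im}(P^* )]$, $P^*$ the transpose. Explicit general arrangement varieties. Fix integers $r\ge c>0$, $n_0,\dots,n_r>0$, $m\ge0$, and put $n=n_0+\dots+n_r$. Let $A$ be a $(c+1)\times(r+1)$ matrix over $\mathbb{K}$ such that any $c+1$ of its columns $a_0,\dots,a_r$ are linearly independent. Let $l_i=(l_{i1},\dots,l_{in_i})$,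 $0\le i\le r$, be tuples of positive integers. Let $P_0$ be the integral $r\times(n+m)$ matrix with columns indexed by $ij$ ($0\le i\le r$, $1\le j\le n_i$) and $k$ ($1\le k\le m$): the column $0j$ is $-l_{0j}(e_1+\dots+e_r)$, the column $ij$ with $i\ge1$ is $l_{ij}e_i$, the columns $k$ are zero. In $\mathbb{K}[T_{ij},S_k]$ put $T_i^{l_i}=T_{i1}^{l_{i1}}\cdots T_{in_i}^{l_{in_i}}$ and for $t=1,\dots,r-c$ let $g_t$ be the $(c+2)\times(c+2)$ determinant $g_t=\det\begin{bmatrix}a_0&\cdots&a_c&a_{c+t}\\ T_0^{l_0}&\cdots&T_c^{l_c}&T_{c+t}^{l_{c+t}}\end{bmatrix}$. Fix $1\le s\le n+m-r$ and an integral $s\times(n+m)$ matrix $d$ such that the columns $v_{ij},v_k$ of the stack matrix $P=\begin{bmatrix}P_0\\ d\end{bmatrix}$ are pairwise different, primitive and generate $\mathbb{Q}^{r+s}$. Let $K=\mathbb{Z}^{n+m}/\mathrm{im}(P^* )$ with projection $Q\colon\mathbb{Z}^{n+m}\to K$, and $R(A,P)=\mathbb{K}[T_{ij},S_k]/\langle g_1,\dots,g_{r-c}\rangle$ with the $K$-grading $\deg(T_{ij})=w_{ij}=Q(e_{ij})$, $\deg(S_k)=w_k=Q(e_k)$, where $e_{ij},e_k$ are the canonical basis vectors of $\mathbb{Z}^{n+m}$. Let $\Sigma$ be any fan in $\mathbb{Z}^{r+s}$ whose rays are precisely those through the columns of $P$, $Z=Z_\Sigma$, $\bar X=V(g_1,\dots,g_{r-c})\subseteq\mathbb{K}^{n+m}$,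 $\hat X=\bar X\cap\hat Z$, $H=\mathrm{Spec}\,\mathbb{K}[K]$. Then $X=X(A,P,\Sigma)=\hat X/\!/H\subseteq Z$, with the effective complexity-$c$ action of $\mathbb{T}=\{1\}\times\mathbb{T}^s\subseteq\mathbb{T}^r\times\mathbb{T}^s$ (the acting torus of $Z$), is called an explicit general arrangement variety. It is normal with $\dim(X)=s+c$, only constant invertible global functions, $\mathrm{Cl}(X)=K$ and Cox ring $\mathcal{R}(X)=R(A,P)$; the class of the prime divisor on $X$ cut out by $T_{ij}$ (resp. $S_k$) is $w_{ij}$ (resp. $w_k$). *)

(* Defs.v *)
From HB Require Import structures.
From mathcomp Require Import all_boot all_order all_algebra.
From mathcomp Require Import mpoly.
From mathcomp Require Import boolp classical_sets cardinality.

Set Implicit Arguments.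
Unset Strict Implicit.
Unset Printing Implicit Defensive.

Import GRing.Theory Num.Theory.

Local Open Scope quotient_scope.
Local Open Scope classical_set_scope.
Local Open Scope ring_scope.

(** * Integral separated schemes inside their function field

An integral separated scheme [X] with affine charts [Spec A] is encoded, as in
EGA I.8, by its function field [F] and the set [ch] of the subrings [A] of [F].
A point of [X] is identified with its local ring, a subset of [F]. *)

Section Scheme.
Variable F : fieldType.
Implicit Types (A p O : set F).

Definition prime_ideal A p : Prop :=
  [/\ p `<=` A, p 0 /\ ~ p 1,
      forall x y, p x -> p y -> p (x + y),
      forall x y, A x -> p y -> p (x * y) &
      forall x y, A x -> A y -> p (x * y) -> p x \/ p y].

Definition height_one A p : Prop :=
  [/\ prime_ideal A p, exists2 x, p x & x != 0 &
      forall q, prime_ideal A q -> q `<=` p ->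
        (exists2 x, q x & x != 0) -> q = p].

Definition localization A p : set F :=
  [set x | exists a b, [/\ A a, A b, ~ p b & x = a / b]].

(* [O] is the local ring at the generic point of the prime divisor. *)
Definition prime_divisor (ch : set (set F)) O : Prop :=
  exists A p, [/\ ch A, height_one A p & O = localization A p].

Definition unit_of O (x : F) : Prop := [/\ x != 0, O x & O x^-1].

(* [t] generates the maximal ideal of the local ring [O]. *)
Definition uniformizer O (t : F) : Prop :=
  [/\ t != 0, O t &
      forall x, O x -> (~ unit_of O x <-> exists2 y, O y & x = t * y)].

(* [ord_at O f k]: the order of the rational function [f] along [O] is [k].
   The varieties considered are normal, so [O] is a discrete valuation ring. *)
Definition ord_at O (f : F) (k : int) : Prop :=
  exists t u, [/\ uniformizer O t, unit_of O u & f = u * t ^ k].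

Definition weil_divisor (ch : set (set F)) (D : set F -> int) : Prop :=
  finite_set [set O | D O != 0] /\ (forall O, D O != 0 -> prime_divisor ch O).

Definition lin_equiv (ch : set (set F)) (D E : set F -> int) : Prop :=
  exists2 f : F, f != 0 &
    forall O, prime_divisor ch O -> ord_at O f (D O - E O).

(** ** Rational differential forms

[k] is the set of constants.  Rational [q]-forms are the elements of
$\Lambda^q \Omega_{F/k}$, seen as alternating [F]-multilinear maps on
[q]-tuples of [k]-derivations of [F]; this is the same since $\Omega_{F/k}$ is
finite dimensional.  A form is only considered on tuples of derivations. *)

Variable k : set F.

Definition derivation (D : F -> F) : Prop :=
  [/\ forall x y, D (x + y) = D x + D y,
      forall x y, D (x * y) = D x * y + x * D y &
      forall x, k x -> D x = 0].

Definition update q (D : 'I_q -> F -> F) (i : 'I_q) (E : F -> F) :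
  'I_q -> F -> F := fun j => if j == i then E else D j.

Definition rational_form q (w : ('I_q -> F -> F) -> F) : Prop :=
  (forall (D : 'I_q -> F -> F) i E E' (a : F), (forall j, derivation (D j)) ->
     derivation E -> derivation E' ->
     w (update D i (fun x => a * E x + E' x)) =
       a * w (update D i E) + w (update D i E')) /\
  (forall (D : 'I_q -> F -> F) i j, (forall h, derivation (D h)) ->
     i != j -> D i = D j -> w D = 0).

Definition form_neq0 q (w : ('I_q -> F -> F) -> F) : Prop :=
  exists2 D : 'I_q -> F -> F, (forall j, derivation (D j)) & w D != 0.

(* The form [w] is [a] times the form [w']. *)
Definition form_eq_scale q (w : ('I_q -> F -> F) -> F) (a : F) w' : Prop :=
  forall D : 'I_q -> F -> F, (forall j, derivation (D j)) -> w D = a * w' D.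

(* $df_1 \wedge \dots \wedge df_q$ *)
Definition wedge_d q (f : 'I_q -> F) (D : 'I_q -> F -> F) : F :=
  \det (\matrix_(i, j) D i (f j)).

(* $df_1 \wedge \dots \wedge df_q$ generates the stalk
   $\Lambda^q \Omega_{O/k}$ of the sheaf of [q]-forms. *)
Definition frame q O (f : 'I_q -> F) : Prop :=
  [/\ forall i, O (f i), form_neq0 (wedge_d f) &
      forall g : 'I_q -> F, (forall i, O (g i)) ->
        exists2 a, O a & form_eq_scale (wedge_d g) a (wedge_d f)].

Definition form_ord_at q O (w : ('I_q -> F -> F) -> F) (e : int) : Prop :=
  exists f a, [/\ frame O f, form_eq_scale w a (wedge_d f) & ord_at O a e].

(* [D] is the divisor of some nonzero rational [q]-form, for [q = dim X]. *)
Definition canonical_divisor (ch : set (set F)) (q : nat) (D : set F -> int) :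
    Prop :=
  weil_divisor ch D /\
  exists w : ('I_q -> F -> F) -> F,
    [/\ rational_form w, form_neq0 w &
        forall O, prime_divisor ch O -> form_ord_at O w (D O)].

End Scheme.

Section Fan.
Variable N : nat.
Implicit Types (C D : set 'cV[rat]_N) (Sigma : set (set 'cV[rat]_N)).

Definition cone_gen k (v : 'I_k -> 'cV[rat]_N) : set 'cV[rat]_N :=
  [set x | exists2 a : 'I_k -> rat, forall i, 0 <= a i & x = \sum_i a i *: v i].

Definition pointed_cone C : Prop :=
  (exists k (v : 'I_k -> 'cV[rat]_N), C = cone_gen v) /\
  (forall x, C x -> C (- x) -> x = 0).

Definition face D C : Prop :=
  exists u : 'rV[rat]_N, (forall x, C x -> 0 <= (u *m x) 0 0) /\
    D = [set x | C x /\ (u *m x) 0 0 = 0].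

Definition fan Sigma : Prop :=
  [/\ finite_set Sigma,
      forall C, Sigma C -> pointed_cone C,
      forall C D, Sigma C -> face D C -> Sigma D &
      forall C D, Sigma C -> Sigma D -> face (C `&` D) C /\ face (C `&` D) D].

Definition ray (v : 'cV[rat]_N) : set 'cV[rat]_N :=
  [set x | exists2 a : rat, 0 <= a & x = a *: v].

Variables (M : nat) (P : 'M[int]_(N, M)).

Definition ratcol (j : 'I_M) : 'cV[rat]_N := map_mx intr (col j P).

Definition has_rays Sigma : Prop :=
  forall v, v != 0 -> (Sigma (ray v) <-> exists j, ray v = ray (ratcol j)).

Definition primitive (v : 'cV[int]_N) : Prop := \big[gcdz/0]_i v i 0 = 1.

(* The columns of [P] are pairwise different, primitive and generate $Q^N$. *)
Definition generator_matrix : Prop :=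
  [/\ injective (fun j => col j P), forall j, primitive (col j P) &
      row_full (map_mx (intr : int -> rat) P)^T].

End Fan.

(** * The grading group, [Z^M] modulo the image of the transpose of [P] *)

Section GradingGroup.
Variables (N M : nat) (P : 'M[int]_(N, M)).

Definition im_dual : {pred 'rV[int]_M} :=
  fun a => `[< exists u : 'rV[int]_N, a = u *m P >].

Lemma im_dual_closed : zmod_closed im_dual.
Proof.
split=> [|a b /asboolP[u ->] /asboolP[v ->]]; apply/asboolP.
  by exists 0; rewrite mul0mx.
by exists (u - v); rewrite mulmxBl.
Qed.

HB.instance Definition _ :=
  GRing.isZmodClosed.Build 'rV[int]_M im_dual im_dual_closed.

Definition grading_group : zmodType := Quotient.quot im_dual.

Definition projQ (a : 'rV[int]_M) : grading_group :=
  \pi_(Quotient.quot im_dual) a.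

Definition mdegQ (e : 'X_{1..M}) : grading_group :=
  projQ (\row_i (e i)%:Z).

Definition homogeneous (kk : nzRingType) (p : {mpoly kk[M]})
    (w : grading_group) : Prop :=
  forall e, e \in msupp p -> mdegQ e = w.

End GradingGroup.

(** * The quotient $X = (\bar X \cap \hat Z) /\!/ H$

[R] is the coordinate ring of $\bar X$, the quotient of the polynomial ring by
[pr], and [F] is the function field of [X], embedded by [io] into the field of
fractions of [R] as the field of quotients of homogeneous elements of the same
[K]-degree. *)

Section CoxQuotient.
Variables (N M : nat) (P : 'M[int]_(N, M)).
Variables (kk : fieldType) (R : idomainType).
Variable (pr : {rmorphism {mpoly kk[M]} -> R}).
Variables (F : fieldType) (io : {rmorphism F -> {fraction R}}).

Local Notation cls p := (@FracField.tofrac R (pr p)).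

Definition is_function_field : Prop :=
  forall x : {fraction R}, (exists f, io f = x) <->
    exists p q (w : grading_group P),
      [/\ homogeneous p w, homogeneous q w, pr q != 0 &
          x = cls p / cls q].

Definition constants : set F := [set f | exists a : kk, io f = cls a%:MP].

(* [m] is a monomial in the variables of the rays not in the cone [C]; these
   variables are invertible over the toric chart of [C]. *)
Definition off_cone (C : set 'cV[rat]_N) (m : 'X_{1..M}) : Prop :=
  forall j, C (ratcol P j) -> m j = 0%N.

(* The ring of functions on the chart $X \cap Z_C$, i.e. the [H]-invariants:
   the degree zero part of the localization of [R]. *)
Definition chart_ring (C : set 'cV[rat]_N) : set F :=
  [set f | exists p m, [/\ homogeneous p (mdegQ P m), off_cone C m &
                           io f = cls p / cls 'X_[m]]].

Definition charts (Sigma : set (set 'cV[rat]_N)) : set (set F) :=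
  [set A | exists2 C, Sigma C & A = chart_ring C].

(* Functions on the chart of [C] vanishing along the [j]-th variable, i.e.
   lying in the radical of the ideal this variable generates upstairs. *)
Definition vanishing_ideal (C : set 'cV[rat]_N) (j : 'I_M) : set F :=
  [set f | chart_ring C f /\ exists e p m,
             off_cone C m /\ io f ^+ e = cls ('X_j * p) / cls 'X_[m]].

(* The prime divisor on [X] cut out by the [j]-th variable; its generic point
   lies in the chart of the [j]-th ray. *)
Definition coord_divisor (j : 'I_M) : set F :=
  let C := ray (ratcol P j) in localization (chart_ring C) (vanishing_ideal C j).

Definition coord_comb (a : 'rV[int]_M) (O : set F) : int :=
  \sum_(j < M) (if `[< O = coord_divisor j >] then a 0 j else 0).

(* [D] has class [w] under the identification of [K] with [Cl(X)] taking
   the degree of the [j]-th variable to the class of its prime divisor. *)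
Definition has_class (Sigma : set (set 'cV[rat]_N)) (D : set F -> int)
    (w : grading_group P) : Prop :=
  exists a : 'rV[int]_M,
    projQ P a = w /\ lin_equiv (charts Sigma) D (coord_comb a).

(* For [q = dim X], [w] is the class of the canonical divisors of [X]. *)
Definition canonical_class (Sigma : set (set 'cV[rat]_N)) (q : nat)
    (w : grading_group P) : Prop :=
  (exists D, canonical_divisor constants (charts Sigma) q D) /\
  (forall D, canonical_divisor constants (charts Sigma) q D ->
     has_class Sigma D w).

End CoxQuotient.

(** * Arrangement data

Indices $0 \le i \le r$, $1 \le j \le n_i$, $1 \le k \le m$ of the variables
$T_{ij}$ and $S_k$ are numbered from 0 for [j] and [k], and [var_idx] numbers
the variables. *)

Section Arrangement.
Variables (r c m s : nat) (n : 'I_r.+1 -> nat).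

Definition vars : finType := ({i : 'I_r.+1 & 'I_(n i)} + 'I_m)%type.

Definition var_idx (x : vars) : 'I_#|vars| := enum_rank x.
Definition Tidx (i : 'I_r.+1) (j : 'I_(n i)) : 'I_#|vars| :=
  var_idx (inl (Tagged (fun i => 'I_(n i)) j)).
Definition Sidx (k : 'I_m) : 'I_#|vars| := var_idx (inr k).

Variable l : forall i : 'I_r.+1, 'I_(n i) -> nat.

Definition P0 : 'M[int]_(r, #|vars|) :=
  \matrix_(a, h) match enum_val h with
    | inl (existT i j) =>
        if i == ord0 then - (l j)%:Z
        else if i == lift ord0 a then (l j)%:Z else 0
    | inr _ => 0
    end.

Definition stackP (d : 'M[int]_(s, #|vars|)) : 'M[int]_(r + s, #|vars|) :=
  col_mx P0 d.

Variables (kk : fieldType) (A : 'M[kk]_(c.+1, r.+1)).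

Definition general_position : Prop :=
  forall f : 'I_c.+1 -> 'I_r.+1, injective f -> row_free (colsub f A)^T.

(* $T_i^{l_i}$ *)
Definition Tmon (i : 'I_r.+1) : {mpoly kk[#|vars|]} :=
  \prod_(j < n i) 'X_(Tidx j) ^+ l j.

(* [t] is shifted by one: the index is $t + 1 = 1, \dots, r - c$. *)
Definition relation (t : 'I_(r - c)) : {mpoly kk[#|vars|]} :=
  let h (b : 'I_c.+1) : 'I_r.+1 := inord b in
  let e : 'I_r.+1 := inord (c + t.+1) in
  \det (block_mx (map_mx (@mpolyC #|vars| kk) (colsub h A))
                 (map_mx (@mpolyC #|vars| kk) (col e A))
                 (\row_b Tmon (h b))
                 (Tmon e)%:M).

Definition relation_ideal (p : {mpoly kk[#|vars|]}) : Prop :=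
  exists a : 'I_(r - c) -> {mpoly kk[#|vars|]}, p = \sum_t a t * relation t.

(* [pr] presents [R] as $R(A,P)$, which is an integral domain. *)
Definition presents_RAP (R : idomainType)
    (pr : {rmorphism {mpoly kk[#|vars|]} -> R}) : Prop :=
  (forall x, exists p, pr p = x) /\ (forall p, pr p = 0 <-> relation_ideal p).

End Arrangement.

Definition deg_var N M (P : 'M[int]_(N, M)) (j : 'I_M) : grading_group P :=
  projQ P (delta_mx 0 j).

(* Main.v *)
(* The function field of [X] contains the Laurent monomials $\chi^u$, $u \in
   Z^{r+s}$, of degree zero; their only relations are the linear ones between the
   $y_i = T_i^{l_i} / T_0^{l_0}$, and the chart of a cone is spanned by the
   $\chi^u$ with [u] nonnegative on its rays.  The remaining coordinates
   $z_1, \dots, z_s$ of the torus and $y_1, \dots, y_c$ are rational coordinates of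
   [X].  Let $\omega$ be the form $d \log z_1 \wedge \dots \wedge d \log z_s \wedge
   d \log y_1 \wedge \dots \wedge d \log y_c$.

   Near the divisor of a variable of the [i]-th block with $i > c$, the function
   $y_c$ may be replaced by $y_i$: both are affine functions of each other over
   $y_1, \dots, y_{c-1}$.  After a unimodular change of the exponents, the
   divisor is a coordinate hyperplane, and $\omega$ turns out to have order
   $-1 + l_{ij}$ along $V(T_{ij})$ if $i > c$, and $-1$ along the other divisors of
   variables.  At any other prime divisor all monomials are units, and $\omega$ has
   order zero.  Since all $T_i^{l_i}$ have the same degree, the blocks with $i > c$
   contribute $(r - c) \sum_j l_{0j} w_{0j}$ to the class of the divisor of
   $\omega$. *)

From HB Require Import structures.
Require Import Defs.
From mathcomp Require Import all_boot all_order all_algebra.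
From mathcomp Require Import mpoly perm ring zify.
From mathcomp Require Import boolp classical_sets cardinality.

Set Implicit Arguments.
Unset Strict Implicit.
Unset Printing Implicit Defensive.

Import Order.TTheory GRing.Theory Num.Theory.

Local Open Scope ring_scope.

(** Scheme theory is replaced by two kinds of coordinate systems of [F], both made of Laurent
    monomials. In either, the local ring of a prime divisor is the localization of a polynomial ring
    at a prime, where the differentials of the variables form a frame by the chain rule. For the
    divisor of a variable the prime is generated by one coordinate; for the others only height one
    is known, which in characteristic zero suffices for a uniformizer. The order $-1+l_{ij}$ has two
    sources: $-1$ is the pole of $d\log$ of the local equation, and $l_{ij}$ is the order of
    $y_i/y_c$, since $d\log y_c$ is a constant times $(y_i/y_c)\,d\log y_i$ modulo
    $dy_1,\dots,dy_{c-1}$. The obstacle: monomials are linearly dependent once $r>c$, so a function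
    has no well-defined exponents. Independence of the torus coordinates comes from points of $\bar
    X$ with prescribed values. That a function regular on a chart and vanishing along a ray has
    exponents showing both comes from a normal form in the Cox ring, by which each variable is a
    nonzero divisor modulo any other. *)

(** * Polynomials and their partial derivatives *)

Lemma mpoly_ring_ind (R : comNzRingType) n (Q : {mpoly R[n]} -> Prop) :
  (forall c, Q c%:MP) -> (forall i, Q 'X_i) ->
  (forall p q, Q p -> Q q -> Q (p + q)) ->
  (forall p q, Q p -> Q q -> Q (p * q)) -> forall p, Q p.
Proof.
move=> QC QX QD QM; elim/mpolyind=> [|c m p _ _ Qp].
  by rewrite -mpolyC0; apply: QC.
apply: QD => //; rewrite -mul_mpolyC; apply: (QM) => //.
rewrite mpolyXE_id; apply: (big_ind Q); [by rewrite -mpolyC1; apply: QC | exact: QM | ].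
move=> i _; elim: (m i : nat) => [|k IH]; first by rewrite expr0 -mpolyC1.
by rewrite exprS; apply: QM.
Qed.

Lemma mpoly_rmorph_ext (R : comNzRingType) n (S : nzRingType)
    (f g : {rmorphism {mpoly R[n]} -> S}) :
  (forall c, f c%:MP = g c%:MP) -> (forall i, f 'X_i = g 'X_i) -> f =1 g.
Proof.
move=> fgC fgX; elim/mpoly_ring_ind => // p q Ep Eq.
  by rewrite !rmorphD Ep Eq.
by rewrite !rmorphM Ep Eq.
Qed.

Lemma mcoeff_char0_eq0 (R : idomainType) (x : R) (k : nat) :
  [pchar R] =i pred0 -> x *+ k.+1 = 0 -> x = 0.
Proof.
move=> R0 /eqP; rewrite -mulr_natr mulf_eq0 => /orP[/eqP//|].
by rewrite (pcharf0P R).1 ?(eqP _).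
Qed.

Lemma mderiv_eq0_const (R : idomainType) n (p : {mpoly R[n]}) :
  [pchar R] =i pred0 -> (forall k, mderiv k p = 0) -> p = (p@_0%MM)%:MP.
Proof.
move=> R0 p0; apply/mpolyP => m; rewrite mcoeffC.
case: eqVneq => [->|m0]; first by rewrite mulr1.
rewrite mulr0; have /existsP[k mk] : [exists k, m k != 0%N].
  apply: contraNT m0; rewrite negb_exists => /forallP h.
  by apply/eqP/mnmP => i; rewrite mnm0E; apply/eqP; have := h i; rewrite negbK.
have := congr1 (fun q => q@_(m - U_(k))) (p0 k).
rewrite mcoeff0 mcoeff_deriv submK ?lep1mP // => /mcoeff_char0_eq0; exact.
Qed.

Lemma mderiv_var (R : nzRingType) n (i j : 'I_n) :
  mderiv i 'X_j = (i == j)%:R :> {mpoly R[n]}.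
Proof.
rewrite mderivX mnm1E eq_sym; case: eqP => [->|_]; last by rewrite scale0r.
by rewrite scale1r -[X in (X - _)%MM]add0m addmK mpolyX0.
Qed.

Lemma msize_mderiv (R : nzRingType) n (p : {mpoly R[n]}) k :
  mderiv k p != 0 -> (msize (mderiv k p) < msize p)%N.
Proof.
move=> dp0; have := mlead_supp dp0; rewrite -(mlead_deg dp0).
set m := mlead _; rewrite mcoeff_msupp mcoeff_deriv => hm.
have : (m + U_(k))%MM \in msupp p.
  by rewrite mcoeff_msupp; apply: contra hm => /eqP->; rewrite mul0rn.
by move/msize_mdeg_lt; rewrite mdegD mdeg1 addn1.
Qed.

(** * Derivations and differential forms *)

Section Derivations.
Variables (F : fieldType) (k : set F).
Implicit Types D : F -> F.

Section One.
Variable D : F -> F.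
Hypothesis DD : derivation k D.

Let DA : forall x y, D (x + y) = D x + D y. Proof. by case: DD. Qed.
Let DM : forall x y, D (x * y) = D x * y + x * D y. Proof. by case: DD. Qed.

Lemma derivation0 : D 0 = 0.
Proof. by apply: (addrI (D 0)); rewrite -DA !addr0. Qed.

Lemma derivation1 : D 1 = 0.
Proof. by apply: (addrI (D 1)); rewrite addr0 -{3}[1]mulr1 DM mulr1 mul1r. Qed.

Lemma derivation_sum I (s : seq I) (P : pred I) (f : I -> F) :
  D (\sum_(i <- s | P i) f i) = \sum_(i <- s | P i) D (f i).
Proof. exact: (big_morph D DA derivation0). Qed.

Lemma derivationV x : x != 0 -> D x^-1 = - D x / x ^+ 2.
Proof.
move=> x0; apply: (mulfI x0).
have := derivation1; rewrite -[in D 1](mulfV x0) DM => /eqP.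
rewrite addrC addr_eq0 => /eqP ->; rewrite mulNr; field.
by rewrite x0.
Qed.

Lemma derivation_div a b : b != 0 -> D (a / b) = (D a * b - a * D b) / b ^+ 2.
Proof. by move=> b0; rewrite DM derivationV //; field. Qed.

Lemma dlogM x y : x != 0 -> y != 0 -> D (x * y) / (x * y) = D x / x + D y / y.
Proof. by move=> x0 y0; rewrite DM; field; rewrite x0 y0. Qed.

End One.

Variables (kk : fieldType) (kap : {rmorphism kk -> F}).
Hypothesis kE : forall x, k x <-> exists a, x = kap a.

Lemma derivation_mmap q (x : 'I_q -> F) D p : derivation k D ->
  D (mmap kap x p) = \sum_i mmap kap x (mderiv i p) * D (x i).
Proof.
move=> DD; have [DA DM D0] := DD.
elim/mpoly_ring_ind: p => [c|i|p p' Ep Ep'|p p' Ep Ep'].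
- rewrite mmapC D0; last by apply/kE; exists c.
  by rewrite big1 // => i _; rewrite mderivC mmap0 mul0r.
- rewrite mmapX mmap1U (bigD1 i) //= big1 => [|j ji].
    by rewrite mderiv_var eqxx rmorph1 mul1r addr0.
  by rewrite mderiv_var (negPf ji) mmap0 mul0r.
- rewrite rmorphD DA Ep Ep' -big_split; apply: eq_bigr => i _ /=.
  by rewrite mderivD rmorphD mulrDl.
- rewrite rmorphM DM Ep Ep' mulr_suml mulr_sumr -big_split.
  apply: eq_bigr => i _ /=; rewrite mderivM rmorphD !rmorphM /=; ring.
Qed.

Section Coordinates.
Variables (q : nat) (x : 'I_q -> F).
Local Notation Th := (mmap kap x).

(** Together the two clauses say that [F] is the field of rational functions in the [x i] over the
    constants. *)
Definition coordinates : Prop :=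
  (forall p, Th p = 0 -> p = 0) /\
  (forall f, exists a b, Th b != 0 /\ f = Th a / Th b).

Hypothesis xC : coordinates.

Lemma coordinates_inj p p' : Th p = Th p' -> p = p'.
Proof.
move=> E; apply/eqP; rewrite -subr_eq0; apply/eqP; apply: xC.1.
by rewrite rmorphB /= E subrr.
Qed.

Lemma coordinates_neq0 p : (Th p != 0) = (p != 0).
Proof.
case: (eqVneq p 0) => [->|]; first by rewrite mmap0 eqxx.
by move=> p0; apply/negP => /eqP/xC.1/eqP; rewrite (negPf p0).
Qed.

(** The quotient rule defines the derivation on a chosen fraction for each function. Any other
    fraction gives the same value, by differentiating the identity of cross-multiplied polynomials,
    which holds in the polynomial ring because [Th] is injective. *)
Lemma partial_derivations : exists d : 'I_q -> F -> F,
  (forall i, derivation k (d i)) /\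
  (forall i p, d i (Th p) = Th (mderiv i p)).
Proof.
have [num numP] := choice xC.2; have [den denP] := choice numP.
pose d i f := (Th (mderiv i (num f)) * Th (den f) -
  Th (num f) * Th (mderiv i (den f))) / Th (den f) ^+ 2.
have dE i a b : Th b != 0 -> d i (Th a / Th b) =
    (Th (mderiv i a) * Th b - Th a * Th (mderiv i b)) / Th b ^+ 2.
  move=> b0; rewrite /d; set f := Th a / Th b.
  have [n0 fE] := denP f; set a' := num f; set b' := den f.
  have E : a * b' = a' * b.
    apply: coordinates_inj; rewrite !rmorphM /=.
    by move: fE; rewrite /f => /eqP; rewrite eqr_div // => /eqP.
  have E1 := congr1 (mmap kap x) E; rewrite !rmorphM /= in E1.
  have E2 := congr1 (fun p => mmap kap x (mderiv i p)) E.
  rewrite /= !mderivM !rmorphD !rmorphM /= in E2.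
  rewrite -/b' in n0.
  apply/eqP; rewrite eqr_div ?expf_neq0 //; apply/eqP.
  set A := Th a in E1 E2 *; set B := Th b in b0 E1 E2 *.
  set A' := Th a' in E1 E2 *; set B' := Th b' in n0 E1 E2 *.
  set dA := Th (mderiv i a) in E2 *; set dB' := Th (mderiv i b') in E2 *.
  set dA' := Th (mderiv i a') in E2 *; set dB := Th (mderiv i b) in E2 *.
  have EA : A' = A * B' / B by rewrite E1 mulfK.
  rewrite EA in E2 *.
  have EdA' : dA' = (dA * B' + A * dB' - A * B' / B * dB) / B.
    by rewrite E2 addrK mulfK.
  by rewrite EdA'; field; rewrite b0.
have d1 i p : d i (Th p) = Th (mderiv i p).
  have := dE i p 1; rewrite rmorph1 invr1 mulr1 => -> //; last exact: oner_neq0.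
  by rewrite -mpolyC1 mderivC mmap0 mulr0 subr0 expr1n invr1 !mulr1.
exists d; split=> // i; split.
- move=> f g; have [a [b [b0 ->]]] := xC.2 f; have [a' [b' [b'0 ->]]] := xC.2 g.
  rewrite addf_div // -!rmorphM -rmorphD /= !dE ?rmorphM ?mulf_neq0 //=.
  by rewrite mderivD !mderivM !rmorphD !rmorphM /=; field; rewrite b0 b'0.
- move=> f g; have [a [b [b0 ->]]] := xC.2 f; have [a' [b' [b'0 ->]]] := xC.2 g.
  rewrite mulf_div -!rmorphM /= !dE ?rmorphM ?mulf_neq0 //=.
  by rewrite !mderivM !rmorphD !rmorphM /=; field; rewrite b0 b'0.
- by move=> _ /kE[c ->]; rewrite -(mmapC x kap c) d1 mderivC mmap0.
Qed.

Variable d : 'I_q -> F -> F.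
Hypothesis dD : forall i, derivation k (d i).
Hypothesis dE : forall i p, d i (Th p) = Th (mderiv i p).

Lemma partial_var i j : d i (x j) = (i == j)%:R.
Proof.
have -> : x j = Th 'X_j by rewrite mmapX mmap1U.
by rewrite dE mderiv_var rmorph_nat.
Qed.

Lemma derivation_chain D f : derivation k D ->
  D f = \sum_i D (x i) * d i f.
Proof.
move=> DD; have [a [b [b0 ->]]] := xC.2 f.
have dfE i : d i (Th a / Th b) =
    (Th (mderiv i a) * Th b - Th a * Th (mderiv i b)) / Th b ^+ 2.
  by rewrite (derivation_div (dD i)) // !dE.
rewrite (derivation_div DD) // !(derivation_mmap _ _ DD).
rewrite mulr_suml mulr_sumr -sumrB mulr_suml; apply: eq_bigr => i _ /=.
by rewrite dfE [RHS]mulrA; congr (_ * _); ring.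
Qed.

Definition jacobian (g : 'I_q -> F) : F := \det (\matrix_(i, j) d i (g j)).

Lemma wedge_jacobian (g : 'I_q -> F) (D : 'I_q -> F -> F) : (forall j, derivation k (D j)) ->
  wedge_d g D = jacobian g * wedge_d x D.
Proof.
move=> DD; rewrite /wedge_d /jacobian mulrC -det_mulmx; congr (\det _).
apply/matrixP=> i j; rewrite !mxE (derivation_chain (g j) (DD i)).
by apply: eq_bigr => l _; rewrite !mxE.
Qed.

Lemma jacobian_id : jacobian x = 1.
Proof.
rewrite /jacobian -[RHS](det1 F q); congr (\det _).
by apply/matrixP=> i j; rewrite !mxE partial_var.
Qed.

Lemma wedge_coordinates_neq0 : form_neq0 k (wedge_d x).
Proof. by exists d => //; rewrite /wedge_d -/(jacobian x) jacobian_id oner_neq0. Qed.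

End Coordinates.

(** Applying the [D i] to the relation [p] gives a homogeneous linear system for its partial
    derivatives, with invertible matrix. So these are relations too, of smaller size, and hence zero
    by induction. *)
Lemma jacobian_criterion q (x : 'I_q -> F) p : [pchar kk] =i pred0 ->
  form_neq0 k (wedge_d x) -> mmap kap x p = 0 -> p = 0.
Proof.
move=> kk0 [D DD wD]; have [n] := ubnP (msize p).
elim: n p => // n IH p /ltnSE-lepn p0.
suff dp i : mderiv i p = 0.
  have pC := mderiv_eq0_const kk0 dp; move: p0; rewrite pC mmapC => /eqP.
  by rewrite fmorph_eq0 => /eqP ->; rewrite mpolyC0.
pose M := \matrix_(i, j) D i (x j); have Mu : M \in unitmx by rewrite unitmxE unitfE.
pose v : 'cV_q := \col_i mmap kap x (mderiv i p).
have /(congr1 (mulmx (invmx M))) : M *m v = 0.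
  apply/matrixP=> a b; rewrite !mxE.
  have := derivation_mmap x p (DD a); rewrite p0 (derivation0 (DD a)).
  move=> E; apply: etrans (esym E); apply: eq_bigr => l _.
  by rewrite !mxE mulrC.
rewrite mulKmx // mulmx0 => /matrixP/(_ i 0); rewrite !mxE => e.
apply/eqP; apply: contraT => dn; have []:= negP dn; apply/eqP; apply: IH e.
exact: leq_trans (msize_mderiv dn) lepn.
Qed.

End Derivations.

(** * Prime ideals of polynomial rings and one distinguished variable *)

Section OneVariable.
Variables (kk : fieldType) (q : nat) (k : 'I_q).
Local Notation MP := {mpoly kk[q]}.
Implicit Types (p : MP) (P : {poly MP}).

Lemma univ_subproof : exists u : {rmorphism MP -> {poly MP}},
  (forall c, u c%:MP = c%:MP%:P) /\
  (forall l, u 'X_l = if l == k then 'X else ('X_l)%:P).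
Proof.
exists (mmap (polyC \o @mpolyC q kk) (fun l => if l == k then 'X else ('X_l)%:P)).
by split=> [c|l]; [exact: mmapC | rewrite /= mmapX mmap1U].
Qed.

(* The coefficients of [univ p] stay in [MP], but do not involve ['X_k]. *)
Definition univ : {rmorphism MP -> {poly MP}} := projT1 (cid univ_subproof).

Lemma univC c : univ c%:MP = c%:MP%:P.
Proof. exact: (projT2 (cid univ_subproof)).1. Qed.

Lemma univX l : univ 'X_l = if l == k then 'X else ('X_l)%:P.
Proof. exact: (projT2 (cid univ_subproof)).2. Qed.

Lemma kill_subproof : exists u : {rmorphism MP -> MP},
  (forall c, u c%:MP = c%:MP) /\
  (forall l, u 'X_l = if l == k then 0 else 'X_l).
Proof.
exists (mmap (@mpolyC q kk) (fun l => if l == k then 0 else 'X_l)).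
by split=> [c|l]; [exact: mmapC | rewrite /= mmapX mmap1U].
Qed.

(** Substituting 0 for ['X_k] serves as two tests: [kill p = p] says that [p] does not involve
    ['X_k], and [kill p = 0] that ['X_k] divides [p]. *)
Definition kill : {rmorphism MP -> MP} := projT1 (cid kill_subproof).

Lemma killC c : kill c%:MP = c%:MP.
Proof. exact: (projT2 (cid kill_subproof)).1. Qed.

Lemma killX l : kill 'X_l = if l == k then 0 else 'X_l.
Proof. exact: (projT2 (cid kill_subproof)).2. Qed.

Lemma univ_horner p : (univ p).['X_k] = p.
Proof.
apply: (mpoly_rmorph_ext (f := horner_eval 'X_k \o univ) (g := idfun)).
  by move=> c; rewrite /= univC /horner_eval hornerC.
move=> l; rewrite /= univX /horner_eval; case: eqP => [->|_].
  by rewrite hornerX.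
by rewrite hornerC.
Qed.

Lemma univ_inj p : univ p = 0 -> p = 0.
Proof. by move=> p0; rewrite -(univ_horner p) p0 horner0. Qed.

Lemma kill_univ p : map_poly kill (univ p) = univ p.
Proof.
apply: (mpoly_rmorph_ext (f := map_poly kill \o univ) (g := univ)).
  by move=> c; rewrite /= univC map_polyC /= killC.
move=> l; rewrite /= univX; case: (eqVneq l k) => [_|lk].
  by rewrite map_polyX.
by rewrite map_polyC /= killX (negPf lk).
Qed.

Lemma kill_coef p i : kill (univ p)`_i = (univ p)`_i.
Proof. by rewrite -[in RHS]kill_univ coef_map. Qed.

Lemma univ_kill p : univ (kill p) = (kill p)%:P.
Proof.
apply: (mpoly_rmorph_ext (f := univ \o kill) (g := polyC \o kill)).
  by move=> c; rewrite /= killC univC.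
move=> l; rewrite /= killX; case: (eqVneq l k) => [_|lk].
  by rewrite rmorph0.
by rewrite univX (negPf lk).
Qed.

Lemma univ_eval P : map_poly kill P = P -> univ P.['X_k] = P.
Proof.
move=> PK; rewrite horner_coef rmorph_sum /= -[RHS]coefK.
rewrite poly_def; apply: eq_bigr => i _.
have PiK : kill P`_i = P`_i by rewrite -(coef_map kill) PK.
by rewrite rmorphM rmorphXn /= univX eqxx -[in univ _]PiK univ_kill PiK mul_polyC.
Qed.

Lemma kill_const p : (size (univ p) <= 1)%N -> kill p = p.
Proof.
move=> /size1_polyC up; have pE := univ_horner p.
by rewrite -pE up hornerC kill_coef.
Qed.

Lemma deriv_univ p : ((univ p)^`()).['X_k] = mderiv k p.
Proof.
elim/mpoly_ring_ind: p => [c|l|p p' Ep Ep'|p p' Ep Ep'].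
- by rewrite univC derivC horner0 mderivC.
- rewrite univX mderiv_var eq_sym; case: eqP => _.
    by rewrite derivX hornerE.
  by rewrite derivC horner0.
- by rewrite rmorphD derivD hornerD Ep Ep' mderivD.
- by rewrite rmorphM derivM hornerD !hornerM Ep Ep' mderivM !univ_horner.
Qed.

(** Division in [{poly MP}] may produce coefficients that involve ['X_k]. Applying [kill] to the
    coefficients removes it, fixes [univ p] and [univ pi], and does not raise the degree of the
    remainder. *)
Lemma pseudo_division p pi : pi != 0 -> exists e a r,
  lead_coef (univ pi) ^+ e * p = a * pi + r /\
  (size (univ r) < size (univ pi))%N.
Proof.
move=> pi0; have upi0 : univ pi != 0 by apply: contraNneq pi0 => /univ_inj->.
have := Pdiv.Idomain.divp_eq (univ p) (univ pi).
move: (Pdiv.Idomain.ltn_modp (univ p) (univ pi)); rewrite upi0.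
move: (_ %/ _)%R (_ %% _)%R (Pdiv.Idomain.scalp _ _) => a r e ltr.
move/(congr1 (map_poly kill)).
rewrite rmorphD rmorphM /= map_polyZ /= !kill_univ rmorphXn /= kill_coef.
set r' := map_poly kill r; set a' := map_poly kill a => E.
have r'K : map_poly kill r' = r'.
  apply/polyP => i; rewrite /r' !coef_map /=.
  apply: (mpoly_rmorph_ext (f := kill \o kill) (g := kill)) => [c|l] /=.
    by rewrite !killC.
  by rewrite !killX; case: ifP => [_|lk]; rewrite ?rmorph0 // killX lk.
exists e, a'.['X_k], r'.['X_k]; split.
  have /(congr1 (fun P => P.['X_k])) := E.
  by rewrite hornerD hornerM hornerZ !univ_horner.
rewrite univ_eval //; apply: leq_ltn_trans ltr; exact: size_poly.
Qed.

Definition mprime (I : MP -> Prop) : Prop :=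
  [/\ I 0 /\ ~ I 1, forall a b, I a -> I b -> I (a + b),
      forall a b, I b -> I (a * b) & forall a b, I (a * b) -> I a \/ I b].

Lemma mprime_kill : mprime (fun p => kill p = 0).
Proof.
split=> [|a b a0 b0|a b b0|a b].
- by split; [exact: rmorph0 | rewrite rmorph1; apply/eqP/oner_neq0].
- by rewrite rmorphD /= a0 b0 addr0.
- by rewrite rmorphM /= b0 mulr0.
- by rewrite rmorphM /= => /eqP; rewrite mulf_eq0 => /orP[]/eqP; [left|right].
Qed.

Lemma kill_eq0 p : kill p = 0 -> exists p', p = 'X_k * p'.
Proof.
move=> p0; have u0 : (univ p)`_0 = 0.
  have := horner_map kill (univ p) 'X_k.
  by rewrite univ_horner p0 kill_univ killX eqxx horner_coef0.
have /factor_theorem[Q uQ] : root (univ p) 0 by rewrite /root horner_coef0 u0.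
exists Q.['X_k]; rewrite -{1}(univ_horner p) uQ subr0.
by rewrite hornerM hornerX mulrC.
Qed.

Section Decomposition.
Variable I : MP -> Prop.
Hypothesis I_prime : mprime I.
Hypothesis I_free : forall p, kill p = p -> I p -> p = 0.

Definition min_size (pi : MP) : Prop :=
  [/\ pi != 0, I pi &
      forall p, I p -> p != 0 -> (size (univ pi) <= size (univ p))%N].

Lemma mprime_exp a n : I (a ^+ n) -> I a.
Proof.
have [[_ I1] _ _ IM] := I_prime.
elim: n => [|n IH]; first by rewrite expr0 => /I1.
by rewrite exprS => /IM[].
Qed.

(** Over the fractions of polynomials without ['X_k], the ideal [I] is generated by [pi]:
    pseudo-division of an element of [I] leaves no remainder, by minimality. The quotient has
    smaller degree, and the powers of the leading coefficient of [pi] met on the way lie outside [I]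
    by [I_free], so they can be absorbed in [b]. *)
Lemma min_size_decomp pi f : min_size pi -> f != 0 -> exists n a b,
  [/\ ~ I a, ~ I b & b * f = pi ^+ n * a].
Proof.
move=> [pi0 Ipi pimin]; have [[I0 I1] ID IM IP] := I_prime.
have sz1 : (1 < size (univ pi))%N.
  by rewrite ltnNge; apply/negP => /kill_const/I_free-/(_ Ipi)/eqP; apply/negP.
set c := lead_coef (univ pi).
have cK : kill c = c by exact: kill_coef.
have c0 : c != 0.
  by rewrite lead_coef_eq0; apply: contraNneq pi0 => /univ_inj->.
have cI : ~ I c by move=> /(I_free cK)/eqP; rewrite (negPf c0).
have [n] := ubnP (size (univ f)); elim: n f => // n IH f /ltnSE-ltf f0.
have [If|nIf] := pselect (I f); last first.
  by exists 0, f, 1; split=> //; rewrite mul1r expr0 mul1r.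
have [e [a [r [E ltr]]]] := pseudo_division f pi0.
have r0 : r = 0.
  apply/eqP; apply: contraTT ltr => r0; rewrite -leqNgt; apply: pimin r0.
  have -> : r = c ^+ e * f + (- a) * pi by rewrite E; ring.
  by apply: ID; apply: IM.
rewrite r0 addr0 in E.
have ce0 : c ^+ e != 0 by rewrite expf_neq0.
have a0 : a != 0.
  by apply: contraNneq (mulf_neq0 ce0 f0) => a0; rewrite E a0 mul0r.
have uce : univ (c ^+ e) = (c ^+ e)%:P.
  by rewrite -{1}cK -rmorphXn univ_kill rmorphXn /= cK.
have szE : size (univ f) = size (univ (a * pi)).
  by rewrite -E rmorphM /= uce mul_polyC size_scale.
have [|//|m [a' [b [Ia' Ib Eb]]]] := IH a.
  apply: leq_trans ltf; rewrite szE rmorphM /= size_mul.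
  - case: (size (univ pi)) sz1 => [|[|s]] // _.
    by rewrite addnS /= addnS ltnS leq_addr.
  - by apply: contraNneq a0 => /univ_inj->.
  - by apply: contraNneq pi0 => /univ_inj->.
exists m.+1, a', (b * c ^+ e); split=> //.
  by move=> /IP[//|/mprime_exp].
by rewrite -mulrA E mulrA Eb exprSr; ring.
Qed.

Lemma min_size_exists : (exists2 p, I p & p != 0) -> exists pi, min_size pi.
Proof.
move=> [p Ip p0].
pose S n := `[< exists2 p, I p & p != 0 /\ size (univ p) = n >].
have exS : exists n, S n by exists (size (univ p)); apply/asboolP; exists p.
case: (ex_minnP exS) => n /asboolP[pi Ipi [pi0 szpi]] nmin.
exists pi; split=> // p' Ip' p'0; rewrite szpi; apply: nmin.
by apply/asboolP; exists p'.
Qed.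

End Decomposition.

Lemma min_size_var : min_size (fun p => kill p = 0) 'X_k.
Proof.
split.
- apply/eqP => /(congr1 (mcoeff U_(k))); rewrite mcoeffX eqxx mcoeff0.
  by apply/eqP/oner_neq0.
- by rewrite killX eqxx.
- move=> p p0 pn0; rewrite univX eqxx size_polyX ltnNge.
  by apply: contraNN pn0 => /kill_const <-; rewrite p0.
Qed.

End OneVariable.

Arguments univ {kk q} k.
Arguments kill {kk q} k.

(** * Primes of height one in a polynomial ring *)

Section HeightOne.
Variables (kk : fieldType) (q : nat).
Hypothesis kk0 : [pchar kk] =i pred0.
Local Notation MP := {mpoly kk[q]}.
Variable I : MP -> Prop.
Hypothesis I_prime : mprime I.
Hypothesis I_neq0 : exists2 p, I p & p != 0.
Hypothesis I_min : forall J, mprime J -> (forall p, J p -> I p) ->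
  (exists2 p, J p & p != 0) -> forall p, I p -> J p.

Lemma mprime_sum (J : MP -> Prop) T (s : seq T) (P : pred T) f : mprime J ->
  (forall i, P i -> J (f i)) -> J (\sum_(i <- s | P i) f i).
Proof. by case=> [[J0 _] JD _ _] Jf; apply: big_ind. Qed.

Let coef_ideal l p := forall i, I (univ l p)`_i.

(** As in Gauss's lemma: if the lowest coefficients of [a] and [b] outside [I] have degrees [i] and
    [j], then modulo [I] the coefficient of degree [i + j] of [a * b] is their product. *)
Lemma mprime_coef_ideal l : mprime (coef_ideal l).
Proof.
have [[I0 I1] ID IM IP] := I_prime.
split=> [|a b Ia Ib i|a b Ib i|a b Iab].
- split=> [i|/(_ 0%N)]; first by rewrite rmorph0 coef0.
  by rewrite rmorph1 coef1.
- by rewrite rmorphD coefD; apply: ID.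
- by rewrite rmorphM coefM; apply: mprime_sum => // j _; apply: IM.
- have [//|nIa] := pselect (coef_ideal l a); first by left.
  have [//|nIb] := pselect (coef_ideal l b); first by right.
  have lowest c : ~ coef_ideal l c -> exists i, ~ I (univ l c)`_i /\
      forall j, (j < i)%N -> I (univ l c)`_j.
    move=> /existsNP[i0 ci0]; pose S n := ~~ `[< I (univ l c)`_n >].
    have exS : exists n, S n by exists i0; apply/asboolPn.
    case: (ex_minnP exS) => i /asboolPn ci imin; exists i; split=> // j ji.
    by apply/asboolP; apply: contraTT ji => /imin; rewrite -leqNgt.
  have [i [ai al]] := lowest _ nIa; have [j [bj bl]] := lowest _ nIb.
  have := Iab (i + j)%N; rewrite rmorphM coefM.
  have lt_i : (i < (i + j).+1)%N by rewrite ltnS leq_addr.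
  rewrite (bigD1 (Ordinal lt_i)) //= addKn.
  set s := \sum_(_ < _ | _) _ => Is.
  have : I ((univ l a)`_i * (univ l b)`_j).
    rewrite -[X in I X](addrK s); apply: ID => //.
    rewrite -mulN1r; apply: (IM); apply: mprime_sum => // [[h hij]] /= hi.
    have [ltih|ltih|eqih] := ltngtP h i.
    + by rewrite mulrC; apply/IM/al.
    + by apply/IM/bl; lia.
    + by case/eqP: hi; apply: val_inj.
  by case/IP.
Qed.

(* Otherwise, by minimality, every coefficient in ['X_l] of an element of [I] is
   in [I], for all [l]; so [I] is stable under the partial derivatives and
   contains a nonzero constant. *)
Lemma height_one_var : exists l : 'I_q,
  forall p, kill l p = p -> I p -> p = 0.
Proof.
have [[I0 I1] ID IM IP] := I_prime.
apply: contrapT => /forallNP nfree.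
have Icoef l p : I p -> coef_ideal l p.
  apply: I_min; first exact: mprime_coef_ideal.
    move=> f Jf; rewrite -(univ_horner l f) horner_coef.
    by apply: mprime_sum => // i _; rewrite mulrC; apply: IM.
  have /existsNP[f /not_implyP[fK /not_implyP[If /eqP f0]]] := nfree l.
  exists f => // i; rewrite -fK univ_kill coefC; case: eqP => // _.
  by rewrite fK.
have Ider l p : I p -> I (mderiv l p).
  move=> /(Icoef l) Jp; rewrite -deriv_univ horner_coef.
  apply: mprime_sum => // i _; rewrite mulrC coef_deriv; apply: (IM).
  by rewrite -mulr_natl; apply: IM.
have [p Ip p0] := I_neq0.
have [n] := ubnP (msize p); elim: n p Ip p0 => // n IH p Ip p0 /ltnSE-ltp.
have [/existsNP[l /eqP dl]|/contrapT dp] := pselect (~ forall l, mderiv l p = 0).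
  apply: IH (Ider l _ Ip) (dl) _; exact: leq_trans (msize_mderiv dl) ltp.
have pC := mderiv_eq0_const kk0 dp; set c := p@_0%MM in pC.
have c0 : c != 0 by apply: contraNneq p0 => c0; rewrite pC c0 mpolyC0.
by case: I1; rewrite -mpolyC1 -(mulVf c0) mpolyCM -pC; apply: IM.
Qed.

End HeightOne.

(** * Orders of functions and of forms *)

Section Orders.
Variables (F : fieldType) (k : set F) (O : set F).

Definition is_subring (A : set F) : Prop :=
  [/\ A 1, forall x y, A x -> A y -> A (x - y) &
      forall x y, A x -> A y -> A (x * y)].

Section Subring.
Variable A : set F.
Hypothesis AR : is_subring A.

Lemma subring0 : A 0.
Proof. by case: AR => A1 AB _; rewrite -(subrr 1); apply: AB. Qed.

Lemma subringN x : A x -> A (- x).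
Proof. by case: AR => _ AB _ Ax; rewrite -sub0r; apply: AB => //; apply: subring0. Qed.

Lemma subringD x y : A x -> A y -> A (x + y).
Proof.
by case: AR => _ AB _ Ax Ay; rewrite -[y]opprK; apply: AB => //; apply: subringN.
Qed.

Lemma subringX x n : A x -> A (x ^+ n).
Proof.
case: AR => A1 _ AM Ax; elim: n => [|n IH]; first by rewrite expr0.
by rewrite exprS; apply: AM.
Qed.

Lemma subring_det n (M : 'M[F]_n) : (forall i j, A (M i j)) -> A (\det M).
Proof.
have [A1 _ AM] := AR.
move=> AMij; apply: (big_ind A) => [||s _]; [exact: subring0 | exact: subringD |].
apply: (AM); first by apply: subringX; apply: subringN.
by apply: (big_ind A) => // *; apply: AM.
Qed.

End Subring.

Hypothesis OR : is_subring O.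

Let O1 : O 1. Proof. by case: OR. Qed.
Let OM x y : O x -> O y -> O (x * y). Proof. by case: OR => _ _; apply. Qed.

Lemma unit_ofM x y : unit_of O x -> unit_of O y -> unit_of O (x * y).
Proof.
by move=> [x0 Ox Oxi] [y0 Oy Oyi]; split; rewrite ?mulf_neq0 ?invfM //; apply: OM.
Qed.

Lemma unit_ofV x : unit_of O x -> unit_of O x^-1.
Proof. by move=> [x0 Ox Oxi]; split; rewrite ?invr_eq0 ?invrK. Qed.

Lemma unit_of1 : unit_of O 1.
Proof. by split; rewrite ?oner_neq0 ?invr1. Qed.

Lemma unit_ofX x n : unit_of O x -> unit_of O (x ^+ n).
Proof.
move=> ux; elim: n => [|n IH]; first exact: unit_of1.
by rewrite exprS; apply: unit_ofM.
Qed.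

Lemma unit_ofXz x (n : int) : unit_of O x -> unit_of O (x ^ n).
Proof. by move=> ux; case: n => n; [| apply: unit_ofV]; apply: unit_ofX. Qed.

Lemma uniformizer_unit t t' : uniformizer O t -> uniformizer O t' ->
  exists2 v, unit_of O v & t = v * t'.
Proof.
move=> [t0 Ot tP] [t'0 Ot' t'P].
have nonunit s : s != 0 -> uniformizer O s -> ~ unit_of O s.
  by move=> s0 [_ Os sP]; apply/sP => //; exists 1; rewrite ?mulr1.
have [y Oy yE] := (t'P t Ot).1 (nonunit t t0 (And3 t0 Ot tP)).
have [y' Oy' yE'] := (tP t' Ot').1 (nonunit t' t'0 (And3 t'0 Ot' t'P)).
have y1 : y * y' = 1.
  by apply: (mulfI t'0); rewrite mulrA -yE -yE' mulr1.
have y0 : y != 0 by apply: contra_eq_neq y1 => ->; rewrite mul0r eq_sym oner_neq0.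
exists y; last by rewrite mulrC.
by split=> //; rewrite -[y^-1]mulr1 -y1 mulKf.
Qed.

Lemma ord_at_div f g e e' : ord_at O f e -> ord_at O g e' ->
  ord_at O (f / g) (e - e').
Proof.
move=> [t [u [tU uU ->]]] [t' [u' [t'U u'U ->]]].
have [v vU ->] := uniformizer_unit t'U tU.
have [t0 _ _] := tU; have [v0 _ _] := vU; have [u'0 _ _] := u'U.
exists t, (u * u'^-1 * v ^ (- e')); split=> //.
  by apply: unit_ofM; [apply: unit_ofM => //; apply: unit_ofV | apply: unit_ofXz].
rewrite expfzMl expfzDr // !invfM !invr_expz; ring.
Qed.

Lemma ord_at_unitM v f e : unit_of O v -> ord_at O f e -> ord_at O (v * f) e.
Proof.
move=> vU [t [u [tU uU ->]]]; exists t, (v * u); split=> //; last by rewrite mulrA.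
exact: unit_ofM.
Qed.

Lemma ord_at_neq0 f e : ord_at O f e -> f != 0.
Proof.
by move=> [t [u [[t0 _ _] [u0 _ _] ->]]]; rewrite mulf_neq0 // expfz_neq0.
Qed.

Lemma frame_unit q (f g : 'I_q -> F) : frame k O f -> frame k O g ->
  exists2 v, unit_of O v & form_eq_scale k (wedge_d f) v (wedge_d g).
Proof.
move=> [Of [D DD fD] fP] [Og g0 gP].
have [v Ov vE] := gP f Of; have [v' Ov' vE'] := fP g Og.
have v1 : v * v' = 1.
  by apply: (mulIf fD); rewrite mul1r -mulrA -vE' // -vE.
have v0 : v != 0 by apply: contra_eq_neq v1 => ->; rewrite mul0r eq_sym oner_neq0.
by exists v => //; split=> //; rewrite -[v^-1]mulr1 -v1 mulKf.
Qed.

(** Proportionality needs no count of dimensions: at a single local ring where both forms have an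
    order, each is a multiple of a frame, and two frames differ by a unit. *)
Lemma form_ord_proportional q (w w0 : ('I_q -> F -> F) -> F) e e0 :
  form_neq0 k w0 -> form_ord_at k O w e -> form_ord_at k O w0 e0 ->
  exists h, form_eq_scale k w h w0.
Proof.
move=> [D DD wD] [f [a [fF wE _]]] [g [b [gF w0E _]]].
have [v _ vE] := frame_unit fF gF.
have b0 : b != 0 by apply: contraNneq wD => b0; rewrite w0E // b0 mul0r.
exists (a * v / b) => D' DD'; rewrite wE // w0E // vE //; field.
by rewrite b0.
Qed.

Lemma form_ord_ratio q (w w0 : ('I_q -> F -> F) -> F) e e0 h :
  form_neq0 k w -> form_eq_scale k w h w0 ->
  form_ord_at k O w e -> form_ord_at k O w0 e0 -> ord_at O h (e - e0).
Proof.
move=> [D DD wD] hE [f [a [fF wE ae]]] [g [b [gF w0E be]]].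
have [v vU vE] := frame_unit fF gF.
have b0 := ord_at_neq0 be.
have g0 : wedge_d g D != 0.
  by apply: contraNneq wD => g0; rewrite wE // vE // g0 !mulr0.
have -> : h = (v * a) / b.
  apply: (mulIf b0); rewrite divfK //; apply: (mulIf g0).
  by rewrite -mulrA -w0E // -hE // wE // vE // mulrA [a * v]mulrC.
by apply: ord_at_div => //; apply: ord_at_unitM.
Qed.

End Orders.

(** * Local rings of an affine space at primes of height one *)

Section LocalRing.
Variables (F : fieldType) (k : set F) (kk : fieldType).
Variable kap : {rmorphism kk -> F}.
Hypothesis kE : forall x, k x <-> exists a, x = kap a.
Variables (q : nat) (x : 'I_q -> F).
Hypothesis xC : coordinates kap x.
Variable I : {mpoly kk[q]} -> Prop.
Hypothesis I_prime : mprime I.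
Local Notation Th := (mmap kap x).

Definition local_ring : set F :=
  [set f | exists a b, ~ I b /\ f = Th a / Th b].

Definition local_max : set F :=
  [set f | exists a b, [/\ I a, ~ I b & f = Th a / Th b]].

Let I0 : I 0. Proof. by case: I_prime => [[]]. Qed.
Let I1 : ~ I 1. Proof. by case: I_prime => [[]]. Qed.
Let ID a b : I a -> I b -> I (a + b). Proof. by case: I_prime => _ H _ _; apply: H. Qed.
Let IM a b : I b -> I (a * b). Proof. by case: I_prime => _ _ H _; apply: H. Qed.
Let IMr a b : I a -> I (a * b). Proof. by rewrite mulrC; apply: IM. Qed.
Let IP a b : I (a * b) -> I a \/ I b. Proof. by case: I_prime => _ _ _ H; apply: H. Qed.
Let nIM a b : ~ I a -> ~ I b -> ~ I (a * b). Proof. by move=> na nb /IP[]. Qed.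

Lemma mprime_neq0 b : ~ I b -> Th b != 0.
Proof. by move=> nb; apply/eqP => /(xC.1) b0; apply: nb; rewrite b0. Qed.

Lemma local_ring_mmap a : local_ring (Th a).
Proof. by exists a, 1; split=> //; rewrite rmorph1 divr1. Qed.

Lemma local_ring_subring : is_subring local_ring.
Proof.
split; first by rewrite -(rmorph1 Th); apply: local_ring_mmap.
  move=> _ _ [a [b [nb ->]]] [a' [b' [nb' ->]]].
  exists (a * b' - a' * b), (b * b'); split; first exact: nIM.
  rewrite !rmorphM rmorphB !rmorphM /=; field.
  by rewrite !mprime_neq0.
move=> _ _ [a [b [nb ->]]] [a' [b' [nb' ->]]].
exists (a * a'), (b * b'); split; first exact: nIM.
by rewrite !rmorphM /= mulf_div.
Qed.

Lemma local_max_mmap a : local_max (Th a) <-> I a.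
Proof.
split=> [[a' [b [Ia' nb E]]]|Ia]; last first.
  by exists a, 1; split=> //; rewrite rmorph1 divr1.
have : I (a * b).
  rewrite (_ : a * b = a') //; apply: (coordinates_inj xC).
  by rewrite rmorphM /= E divfK // mprime_neq0.
by case/IP.
Qed.

Lemma local_maxD f g : local_max f -> local_max g -> local_max (f + g).
Proof.
move=> [a [b [Ia nb ->]]] [a' [b' [Ia' nb' ->]]].
exists (a * b' + a' * b), (b * b'); split; [|exact: nIM|].
  by apply: ID; apply: IMr.
rewrite !rmorphM rmorphD !rmorphM /=; field.
by rewrite !mprime_neq0.
Qed.

Lemma local_maxM f g : local_ring f -> local_max g -> local_max (f * g).
Proof.
move=> [a [b [nb ->]]] [a' [b' [Ia' nb' ->]]].
exists (a * a'), (b * b'); split; [exact: IM|exact: nIM|].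
by rewrite !rmorphM /= mulf_div.
Qed.

Lemma local_max_prime f g : local_ring f -> local_ring g ->
  local_max (f * g) -> local_max f \/ local_max g.
Proof.
move=> [a [b [nb ->]]] [a' [b' [nb' ->]]] m.
have : local_max (Th (a * a')).
  have -> : Th (a * a') = Th (b * b') * (Th a / Th b * (Th a' / Th b')).
    by rewrite !rmorphM /=; field; rewrite !mprime_neq0.
  by apply: local_maxM => //; apply: local_ring_mmap.
by move=> /local_max_mmap/IP[Ia|Ia]; [left; exists a, b | right; exists a', b'].
Qed.

Lemma local_max1 : ~ local_max 1.
Proof. by rewrite -(rmorph1 Th) => /local_max_mmap. Qed.

Lemma local_unitP f : unit_of local_ring f <-> local_ring f /\ ~ local_max f.
Proof.
split=> [[f0 Of Ofi]|[[a [b [nb fE]]] nm]].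
  split=> // mf; apply: local_max1; rewrite -(mulVf f0); exact: local_maxM.
have na : ~ I a by move=> Ia; apply: nm; exists a, b.
split; first by rewrite fE mulf_neq0 ?invr_eq0 ?mprime_neq0.
  by exists a, b.
by exists b, a; split=> //; rewrite fE invf_div.
Qed.

Section Uniformizer.
Variable l : 'I_q.
Hypothesis I_free : forall p, kill l p = p -> I p -> p = 0.
Variable pi : {mpoly kk[q]}.
Hypothesis pi_min : min_size l I pi.

Let pi0 : Th pi != 0.
Proof. by rewrite (coordinates_neq0 xC); case: pi_min. Qed.

(** Up to factors outside [I], a nonzero numerator in [I] is a power of [pi]; the exponent is
    positive, since otherwise the numerator would lie outside [I]. *)
Lemma local_maxP f : local_max f <-> exists2 y, local_ring y & f = Th pi * y.
Proof.
have [p0 Ipi _] := pi_min.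
split=> [[a [b [Ia nb ->]]]|[y Oy ->]]; last first.
  by rewrite mulrC; apply: local_maxM => //; apply/local_max_mmap.
have [->|a0] := eqVneq a 0.
  exists 0; first exact: subring0 local_ring_subring.
  by rewrite rmorph0 mul0r mulr0.
have [[|n] [a' [b' [na' nb' E]]]] := min_size_decomp I_prime I_free pi_min a0.
  case: na'; rewrite -[a']mul1r -(expr0 pi) -E; exact: IM.
exists (Th (pi ^+ n * a') / Th (b' * b)).
  by exists (pi ^+ n * a'), (b' * b); split=> //; apply: nIM.
have := congr1 Th E; rewrite !rmorphM rmorphXn exprS /= => E'.
have -> : Th a = Th pi * Th pi ^+ n * Th a' / Th b'.
  by rewrite -E' mulrAC mulfV ?mul1r // mprime_neq0.
by rewrite rmorphXn /=; field; rewrite !mprime_neq0.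
Qed.

(* Once the nonzero polynomials free of ['X_l] are inverted, [I] is generated by
   its nonzero elements of least degree in ['X_l]. *)
Lemma local_uniformizer : uniformizer local_ring (Th pi).
Proof.
split=> //; first exact: local_ring_mmap.
move=> f Of; rewrite -local_maxP; split=> [nu|mf /local_unitP[]//].
by apply: contrapT => nm; apply: nu; apply/local_unitP.
Qed.

End Uniformizer.

(** By the chain rule the coefficient of [wedge_d g] is the Jacobian determinant of [g]. Its entries
    stay in the local ring because the quotient rule only squares the denominators, and [I] is
    prime. *)
Lemma local_frame : frame k local_ring x.
Proof.
have [d [dD dE]] := partial_derivations kE xC.
split; first by move=> i; rewrite -[x i](mmap1U x) -(mmapX x kap); apply: local_ring_mmap.
  exact: (wedge_coordinates_neq0 dD dE).
move=> g Og; exists (jacobian d g); last first.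
  by move=> D DD; apply: (wedge_jacobian kE xC dD dE).
apply: (subring_det local_ring_subring) => i j; rewrite !mxE.
have [a [b [nb ->]]] := Og j.
rewrite (derivation_div (dD i)) ?mprime_neq0 // !dE -!rmorphM -rmorphB -rmorphXn.
eexists; eexists; split; last by [].
by rewrite expr2; apply: nIM.
Qed.

End LocalRing.

(** * Laurent monomials *)

Section Pairing.
Variable N : nat.
Implicit Types (u : 'rV[int]_N) (v : 'cV[int]_N).

Definition pairing u v : int := (u *m v) 0 0.

Lemma pairingD u u' v : pairing (u + u') v = pairing u v + pairing u' v.
Proof. by rewrite /pairing mulmxDl mxE. Qed.

Lemma pairingN u v : pairing (- u) v = - pairing u v.
Proof. by rewrite /pairing mulNmx mxE. Qed.

Lemma pairingZ a u v : pairing (a *: u) v = a * pairing u v.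
Proof. by rewrite /pairing -scalemxAl mxE. Qed.

Lemma pairing0 v : pairing 0 v = 0.
Proof. by rewrite /pairing mul0mx mxE. Qed.

Lemma pairing_sum I (s : seq I) (P : pred I) (f : I -> 'rV[int]_N) v :
  pairing (\sum_(i <- s | P i) f i) v = \sum_(i <- s | P i) pairing (f i) v.
Proof. exact: (big_morph (pairing^~ v) (fun a b => pairingD a b v) (pairing0 v)). Qed.

Lemma pairing_col M (P : 'M[int]_(N, M)) u j : pairing u (col j P) = (u *m P) 0 j.
Proof. by rewrite /pairing !mxE; apply: eq_bigr => i _; rewrite mxE. Qed.

Lemma pairing_delta h v : pairing (delta_mx 0 h) v = v h 0.
Proof. by rewrite /pairing -rowE mxE. Qed.

End Pairing.

Lemma pairing_row N q (W : 'M[int]_(q, N)) (n : 'rV[int]_q) (v : 'cV[int]_N) :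
  pairing (n *m W) v = pairing n (W *m v).
Proof. by rewrite /pairing mulmxA. Qed.

Section Monomials.
Variables (F : fieldType) (kk : fieldType) (kap : {rmorphism kk -> F}).
Variables (N : nat) (chi : 'rV[int]_N -> F).
Hypothesis chi_neq0 : forall u, chi u != 0.
Hypothesis chiD : forall u v, chi (u + v) = chi u * chi v.
Implicit Types (S : set 'rV[int]_N) (u w : 'rV[int]_N) (f g : F).

Lemma chi0 : chi 0 = 1.
Proof. by apply: (mulfI (chi_neq0 0)); rewrite -chiD addr0 mulr1. Qed.

Lemma chiN u : chi (- u) = (chi u)^-1.
Proof. by apply: (mulfI (chi_neq0 u)); rewrite -chiD subrr chi0 mulfV. Qed.

Lemma chiB u w : chi (u - w) = chi u / chi w.
Proof. by rewrite chiD chiN. Qed.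

Lemma chi_sum I (s : seq I) (P : pred I) (f : I -> 'rV[int]_N) :
  chi (\sum_(i <- s | P i) f i) = \prod_(i <- s | P i) chi (f i).
Proof. exact: (big_morph chi chiD chi0). Qed.

Lemma chiMn u n : chi (u *+ n) = chi u ^+ n.
Proof.
elim: n => [|n IH]; first by rewrite mulr0n chi0 expr0.
by rewrite mulrS chiD IH exprS.
Qed.

Lemma chiZ (a : int) u : chi (a *: u) = chi u ^ a.
Proof.
case: a => n; first by rewrite -[X in X *: _]natz scaler_nat chiMn.
by rewrite NegzE scaleNr -[X in X *: _]natz scaler_nat chiN chiMn exprnN.
Qed.

(** The span over the constants of the [chi u] with [u] in [S]. As the [chi u] may be linearly
    dependent, an element can have several expressions, and [laurent S1 f] and [laurent S2 f]
    together do not yield exponents in both sets. *)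
Inductive laurent S : F -> Prop :=
| laurent0 : laurent S 0
| laurent_cons c u f : S u -> laurent S f -> laurent S (kap c * chi u + f).

Lemma laurent_term S c u : S u -> laurent S (kap c * chi u).
Proof. by move=> Su; rewrite -[X in laurent _ X]addr0; apply: laurent_cons => //; apply: laurent0. Qed.

Lemma laurent_chi S u : S u -> laurent S (chi u).
Proof. by move=> Su; rewrite -[chi u]mul1r -(rmorph1 kap); apply: laurent_term. Qed.

Lemma laurentD S f g : laurent S f -> laurent S g -> laurent S (f + g).
Proof.
move=> Sf Sg; elim: Sf => [|c u h Su _ IH]; first by rewrite add0r.
by rewrite -addrA; apply: laurent_cons.
Qed.

Lemma laurentM S1 S2 S f g : (forall u w, S1 u -> S2 w -> S (u + w)) ->
  laurent S1 f -> laurent S2 g -> laurent S (f * g).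
Proof.
move=> SD Sf Sg; elim: Sf => [|c u h Su _ IH]; first by rewrite mul0r; apply: laurent0.
rewrite mulrDl; apply: laurentD => // {IH h}.
elim: Sg => [|c' w h Sw _ IH]; first by rewrite mulr0; apply: laurent0.
rewrite mulrDr; apply: laurentD => //.
rewrite mulrACA -rmorphM -chiD; apply: laurent_term; exact: SD.
Qed.

Lemma laurentS S1 S2 f : (forall u, S1 u -> S2 u) -> laurent S1 f -> laurent S2 f.
Proof.
move=> SS; elim=> [|c u h Su _ IH]; first exact: laurent0.
by apply: laurent_cons => //; apply: SS.
Qed.

Lemma laurentN S f : laurent S f -> laurent S (- f).
Proof.
elim=> [|c u h Su _ IH]; first by rewrite oppr0; apply: laurent0.
by rewrite opprD -mulNr -rmorphN; apply: laurent_cons.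
Qed.

Lemma laurent_subring S : S 0 -> (forall u w, S u -> S w -> S (u + w)) ->
  is_subring (laurent S).
Proof.
move=> S0 SD; split=> [|f g Sf Sg|f g]; last exact: laurentM.
  by rewrite -chi0; apply: laurent_chi.
by apply: laurentD => //; apply: laurentN.
Qed.

(** ** Monomial coordinates *)

Section Coordinates.
Variables (q : nat) (W : 'M[int]_(q, N)).
Local Notation x := (fun i => chi (row i W)).
Local Notation Th := (mmap kap x).

Lemma mmap_monomial (m : 'X_{1..q}) :
  Th 'X_[m] = chi ((\row_i (m i)%:Z) *m W).
Proof.
rewrite mmapX /mmap1 mulmx_sum_row chi_sum; apply: eq_bigr => i _.
by rewrite mxE chiZ.
Qed.

Variable I : {mpoly kk[q]} -> Prop.
Hypothesis I_prime : mprime I.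
Variables (v : 'cV[int]_N) (tau : 'rV[int]_N).
(** Along a ray [v], the exponent [tau] gives a monomial of order one. The alternative [v = 0] lets
    the same lemmas serve the torus. *)
Hypothesis tauP : v = 0 \/ pairing tau v = 1.

(* [chi a] is a unit of the local ring at [I], as is seen after multiplication
   by a monomial orthogonal to [v]. *)
Definition monomial_unit a : Prop := pairing a v = 0 /\
  exists w b c, [/\ pairing w v = 0, chi w = Th b, chi (w + a) = Th c, ~ I b &
    ~ I c].

Let nIM a b : ~ I a -> ~ I b -> ~ I (a * b).
Proof. by case: I_prime => _ _ _ H na nb /H[]. Qed.

Let nI1 : ~ I 1. Proof. by case: I_prime => [[]]. Qed.

Lemma monomial_unit0 : monomial_unit 0.
Proof.
split; first exact: pairing0.
by exists 0, 1, 1; rewrite pairing0 addr0 chi0 rmorph1.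
Qed.

Lemma monomial_unitD a a' :
  monomial_unit a -> monomial_unit a' -> monomial_unit (a + a').
Proof.
move=> [va [w [b [c [vw wb wc nb nc]]]]] [va' [w' [b' [c' [vw' wb' wc' nb' nc']]]]].
split; first by rewrite pairingD va va' addr0.
exists (w + w'), (b * b'), (c * c'); split; try exact: nIM.
- by rewrite pairingD vw vw' addr0.
- by rewrite chiD rmorphM /= wb wb'.
- by rewrite addrACA chiD rmorphM /= wc wc'.
Qed.

Lemma monomial_unitN a : monomial_unit a -> monomial_unit (- a).
Proof.
move=> [va [w [b [c [vw wb wc nb nc]]]]].
split; first by rewrite pairingN va oppr0.
exists (w + a), c, b; split=> //; first by rewrite pairingD vw va addr0.
by rewrite addrK.
Qed.

Lemma monomial_unitZ (n : int) a : monomial_unit a -> monomial_unit (n *: a).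
Proof.
move=> ua.
have um m : monomial_unit (a *+ m).
  elim: m => [|m IH]; first by rewrite mulr0n; apply: monomial_unit0.
  by rewrite mulrS; apply: monomial_unitD.
case: n => m; first by rewrite -natz scaler_nat.
by rewrite NegzE scaleNr -[X in X *: _]natz scaler_nat; apply: monomial_unitN.
Qed.

Lemma monomial_unit_sum J (s : seq J) (P : pred J) (f : J -> 'rV[int]_N) :
  (forall i, P i -> monomial_unit (f i)) ->
  monomial_unit (\sum_(i <- s | P i) f i).
Proof.
move=> uf; apply: (big_ind monomial_unit) => //; first exact: monomial_unit0.
exact: monomial_unitD.
Qed.

Lemma monomial_unit_row i : pairing (row i W) v = 0 -> ~ I 'X_i ->
  monomial_unit (row i W).
Proof.
move=> vi nXi; split=> //; exists 0, 1, 'X_i; split=> //.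
- exact: pairing0.
- by rewrite chi0 rmorph1.
- by rewrite add0r mmapX mmap1U.
Qed.

Lemma pairing_tau a : pairing (a - pairing a v *: tau) v = 0.
Proof.
rewrite pairingD pairingN pairingZ; case: tauP => [->|->]; last by rewrite mulr1 subrr.
by rewrite /pairing !mulmx0 !mxE mulr0 subr0.
Qed.

(** In the combination of the [delta_mx 0 h - v h 0 *: tau] with coefficients [a 0 h], the [tau]
    parts add up to [pairing a v], which is zero. So these projections generate everything
    orthogonal to [v]. *)
Lemma monomial_unit_basis :
  (forall h, monomial_unit (delta_mx 0 h - v h 0 *: tau)) ->
  forall a, pairing a v = 0 -> monomial_unit a.
Proof.
move=> uh a va.
have -> : a = \sum_h a 0 h *: (delta_mx 0 h - v h 0 *: tau).
  under eq_bigr => h _ do rewrite scalerBr scalerA.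
  rewrite sumrB -row_sum_delta -scaler_suml.
  have -> : \sum_h a 0 h * v h 0 = 0 by rewrite -[RHS]va /pairing mxE.
  by rewrite scale0r subr0.
by apply: monomial_unit_sum => h _; apply: monomial_unitZ.
Qed.

Hypothesis perp_unit : forall a, pairing a v = 0 -> monomial_unit a.
Hypothesis tau_poly : exists t, chi tau = Th t.

Definition clearable f : Prop := exists w b c,
  [/\ pairing w v = 0, chi w = Th b, ~ I b & chi w * f = Th c].

(** Each [chi u] splits into [chi (u - pairing u v *: tau)], covered by [perp_unit], and a power of
    [chi tau] with nonnegative exponent. The terms are cleared one after the other. *)
Lemma clearable_laurent f : laurent (fun u => 0 <= pairing u v) f -> clearable f.
Proof.
elim=> [|c u h vu _ [w [b [c' [vw wb nb E]]]]].
  by exists 0, 1, 0; rewrite pairing0 chi0 mulr0 rmorph1 rmorph0.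
have [_ [w' [b' [a' [vw' wb' wa' nb' _]]]]] := perp_unit (pairing_tau u).
have [t tE] := tau_poly.
exists (w + w'), (b * b'), (c%:MP * a' * t ^+ `|pairing u v|%N * b + c' * b').
split; last 1 first.
- rewrite rmorphD !rmorphM rmorphXn /= mmapC -wb -wb' -wa' -tE -E.
  have -> : chi u = chi (u - pairing u v *: tau) * chi tau ^+ `|pairing u v|%N.
    by rewrite -chiMn -chiD -scaler_nat natz gez0_abs // subrK.
  rewrite !chiD; move: (chi tau ^+ _) (chi w) (chi w') (chi u) (chi (- _)).
  by move=> *; ring.
- by rewrite pairingD vw vw' addr0.
- by rewrite chiD rmorphM /= wb wb'.
- exact: nIM.
Qed.

Lemma laurent_shift f : laurent setT f -> exists n : nat,
  laurent (fun u => 0 <= pairing u v) (chi (tau *+ n) * f).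
Proof.
elim=> [|c u h _ _ [n Sn]]; first by exists 0%N; rewrite mulr0; apply: laurent0.
exists (n + `|pairing u v|)%N; rewrite mulrDr; apply: laurentD.
  rewrite mulrCA -chiD; apply: laurent_term.
  rewrite pairingD -scaler_nat pairingZ natz.
  case: tauP => [->|->]; first by rewrite /pairing !mulmx0 !mxE mulr0 addr0.
  by rewrite mulr1; lia.
rewrite addnC mulrnDr chiD -mulrA.
apply: (laurentM _ (laurent_chi (S := fun u => 0 <= pairing u v) _) Sn).
  by move=> a b va vb; rewrite pairingD addr_ge0.
rewrite -scaler_nat pairingZ natz.
case: tauP => [->|->]; first by rewrite /pairing !mulmx0 !mxE mulr0.
by rewrite mulr1.
Qed.

Lemma monomial_generate :
  (forall f, exists a b, [/\ laurent setT a, laurent setT b, b != 0 & f = a / b]) ->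
  forall f, exists a b, Th b != 0 /\ f = Th a / Th b.
Proof.
move=> gen f; have [a [b [Sa Sb b0 ->]]] := gen f.
have [n /clearable_laurent[w [d [a' [_ wd _ Ea]]]]] := laurent_shift Sa.
have [n' /clearable_laurent[w' [d' [b' [_ wd' _ Eb]]]]] := laurent_shift Sb.
have [t tE] := tau_poly.
rewrite chiMn in Ea; rewrite chiMn in Eb.
exists (a' * d' * t ^+ n'), (b' * d * t ^+ n).
rewrite !rmorphM !rmorphXn /= -tE -wd -wd' -Ea -Eb; split.
  by rewrite !mulf_neq0 ?expf_neq0.
by field; rewrite b0 ?expf_neq0 ?chi_neq0.
Qed.

End Coordinates.

End Monomials.

(** * Primitive vectors and unimodular changes of exponents *)

Lemma kill_mcoeff (kk : fieldType) q (k : 'I_q) (p : {mpoly kk[q]}) (m : 'X_{1..q}) :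
  m k = 0%N -> p@_m != 0 -> kill k p <> 0.
Proof.
move=> mk pm /kill_eq0[p' pE]; move: pm; rewrite pE mulrC -mcoeff_msupp.
rewrite (perm_mem (msuppMX _ _)) => /mapP[m' _ mE].
by move: mk; rewrite mE mnmDE mnm1E eqxx.
Qed.

(** The only invariant factor of the column [v] divides all its entries and is therefore a unit. The
    index [k0] has to be the first one because the Smith normal form has its pivot there. *)
Lemma unimodular_completion q (k0 : 'I_q) (v : 'cV[int]_q) :
  k0 = 0%N :> nat ->
  (forall d : int, (forall i, (d %| v i ord0)%Z) -> (d %| 1)%Z) ->
  exists2 U, U \in unitmx & U *m v = delta_mx k0 0.
Proof.
move=> k00 vprim.
have [L Lu [R Ru [d _ vE]]] := int_Smith_normal_form v.
set D := \matrix_(_, _) _ in vE.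
have DR : D *m R = (d`_0 * R 0 0) *: delta_mx k0 0.
  apply/matrixP=> i j; rewrite !mxE big_ord1 !mxE !ord1 eqxx andbT.
  have -> : (i == 0%N :> nat) = (i == k0) by rewrite -k00.
  by case: eqP => [->|_]; rewrite ?k00 ?mulr1n ?mulr1 // mulr0n mulr0 mul0r.
have d0 : d`_0 \is a GRing.unit.
  suff /dvdzP[e E] : (d`_0 %| 1)%Z.
    have : e * d`_0 \is a GRing.unit by rewrite -E unitr1.
    by rewrite unitrM => /andP[].
  apply: vprim => i; rewrite vE -mulmxA DR -scalemxAr mxE -mulrA.
  exact: dvdz_mulr.
have R0 : R 0 0 \is a GRing.unit.
  by move: Ru; rewrite unitmxE (mx11_scalar R) det_scalar1 mxE.
have s0 : d`_0 * R 0 0 \is a GRing.unit by rewrite unitrM d0.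
exists ((d`_0 * R 0 0)^-1 *: invmx L).
  by rewrite unitmxZ ?unitmx_inv // unitrV.
by rewrite vE -scalemxAl -mulmxA mulKmx // DR scalerA mulVr // scale1r.
Qed.

(** * General position *)

Section GeneralPosition.
Variables (kk : fieldType) (r c : nat) (A : 'M[kk]_(c.+1, r.+1)).
Hypothesis c_gt0 : (0 < c)%N.
Hypothesis c_le_r : (c <= r)%N.
Hypothesis A_gen : general_position A.
Implicit Type b : 'I_c.+1 -> 'I_r.+1.

Lemma colsub_unit b : injective b -> colsub b A \in unitmx.
Proof. by move=> /A_gen; rewrite row_free_unit unitmx_tr. Qed.

(** Column [i] holds the coordinates of column [i] of [A] in the basis formed by the columns
    [b k]. *)
Definition alpha b : 'M[kk]_(c.+1, r.+1) := invmx (colsub b A) *m A.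

Lemma alphaP b i t : injective b -> A t i = \sum_k A t (b k) * alpha b k i.
Proof.
move=> bI; have : A = colsub b A *m alpha b by rewrite mulKVmx // colsub_unit.
move=> /matrixP/(_ t i) ->; rewrite mxE; apply: eq_bigr => k _.
by rewrite mxE.
Qed.

Lemma alpha_basis b k l : injective b -> alpha b k (b l) = (k == l)%:R.
Proof.
move=> bI; have : invmx (colsub b A) *m colsub b A = 1%:M.
  by rewrite mulVmx // colsub_unit.
move=> /matrixP/(_ k l); rewrite !mxE => <-; apply: eq_bigr => t _.
by rewrite [in RHS]mxE.
Qed.

Lemma basis_containing (i h : 'I_r.+1) :
  exists b : 'I_c.+1 -> 'I_r.+1,
    injective b /\ exists k l, b k = i /\ b l = h.
Proof.
have lt_cr (k : 'I_c.+1) : (k < r.+1)%N by exact: leq_trans (ltn_ord k) _.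
pose one : 'I_c.+1 := inord 1; have oneE : one = 1%N :> nat by rewrite inordK.
pose w (k : 'I_c.+1) : 'I_r.+1 := Ordinal (lt_cr k).
have wI : injective w by move=> k l /(congr1 val)/= /val_inj.
have w0 : w ord0 = ord0 by apply: val_inj.
have [<-|ih] := eqVneq i h.
  exists (fun k => tperm ord0 i (w k)); split; first by move=> k l /perm_inj/wI.
  by exists ord0, ord0; rewrite w0 tpermL.
(* The inner transposition fixes 0 and sends 1 to the preimage of [h]; the outer one then sends 0 to
   [i] and that preimage to [h]. The position 1 exists because [c] is positive. *)
exists (fun k => tperm ord0 i (tperm (w one) (tperm ord0 i h) (w k))).
split; first by move=> k l /perm_inj/perm_inj/wI.
have w1 : w one != ord0 by apply/eqP => /(congr1 val) /=; rewrite oneE.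
have h0 : tperm ord0 i h != ord0.
  by apply: contra_neq ih => /(canRL (tpermK _ _)); rewrite tpermL.
exists ord0, one; rewrite w0 tpermL tpermK; split=> //.
by rewrite [tperm (w one) _ _]tpermD // tpermL.
Qed.

(** Otherwise column [i] of [A] would be a multiple of column [i0], whereas both belong to a common
    basis by [basis_containing]. *)
Lemma alpha_neq0 b (i i0 : 'I_r.+1) : injective b -> i != i0 ->
  exists2 k, alpha b k i != 0 & b k != i0.
Proof.
move=> bI ii0; apply: contrapT => H.
pose a := \sum_(k | b k == i0) alpha b k i.
have Ai t : A t i = A t i0 * a.
  rewrite (alphaP i t bI) mulr_sumr (bigID (fun k => b k == i0)) /=.
  rewrite [X in _ + X]big1 ?addr0 => [|k bk].
    by apply: eq_bigr => k /eqP ->.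
  case: (eqVneq (alpha b k i) 0) => [->|ak]; first by rewrite mulr0.
  by case: H; exists k.
have [b' [b'I [k [l [bk bl]]]]] := basis_containing i i0.
pose z : 'cV[kk]_c.+1 := delta_mx k 0 - a *: delta_mx l 0.
have /(congr1 (mulmx (invmx (colsub b' A)))) : colsub b' A *m z = 0.
  rewrite mulmxBr -scalemxAr -!colE; apply/matrixP=> t u.
  by rewrite !mxE bk bl Ai mulrC subrr.
rewrite mulKmx ?colsub_unit // mulmx0 => /matrixP/(_ k 0).
have kl : k != l by apply: contra_neq ii0 => kl; rewrite -bk -bl kl.
by rewrite !mxE !eqxx (negPf kl) mulr0 subr0 => /eqP; rewrite oner_eq0.
Qed.

End GeneralPosition.

Lemma dvdz_biggcd (I : finType) (f : I -> int) (d : int) :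
  (forall i, (d %| f i)%Z) -> (d %| \big[gcdz/0]_i f i)%Z.
Proof.
move=> df; apply: (big_ind (fun x => (d %| x)%Z)) => //.
by move=> x y dx dy; rewrite dvdz_gcd dx dy.
Qed.

Lemma mprime0 (kk : fieldType) q : @mprime kk q (fun p => p = 0).
Proof.
split=> [|a b -> ->|a b ->|a b /eqP].
- by split=> //; apply/eqP/oner_neq0.
- by rewrite addr0.
- by rewrite mulr0.
- by rewrite mulf_eq0 => /orP[]/eqP; [left|right].
Qed.

(** * Coordinates near the divisors of the variables *)

Section RayCoordinates.
Variables (F : fieldType) (k : set F) (kk : fieldType).
Variable kap : {rmorphism kk -> F}.
Hypothesis kE : forall x, k x <-> exists a, x = kap a.
Hypothesis kk0 : [pchar kk] =i pred0.
Variables (r c s M : nat) (A : 'M[kk]_(c.+1, r.+1)) (P : 'M[int]_(r + s, M)).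
Hypotheses (c_gt0 : (0 < c)%N) (c_le_r : (c <= r)%N).
Hypothesis A_gen : general_position A.
Variable chi : 'rV[int]_(r + s) -> F.
Hypothesis chi_neq0 : forall u, chi u != 0.
Hypothesis chiD : forall u v, chi (u + v) = chi u * chi v.

(* [chi (eps i)] is $T_i^{l_i} / T_0^{l_0}$. *)
Definition eps (i : 'I_r.+1) : 'rV[int]_(r + s) :=
  row_mx (\row_a (i == lift ord0 a)%:R) 0.

Hypothesis chi_rel : forall b : 'I_c.+1 -> 'I_r.+1, injective b -> forall i,
  chi (eps i) = \sum_l kap (alpha A b l i) * chi (eps (b l)).
Hypothesis chi_gen : forall f, exists a b,
  [/\ laurent kap chi setT a, laurent kap chi setT b, b != 0 & f = a / b].

(** The indices $0,\dots,c-1$ followed by [be]: the torus uses [be = c], a divisor in a block beyond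
    [c] uses that block. *)
Definition std_basis (be : 'I_r.+1) (l : 'I_c.+1) : 'I_r.+1 :=
  if (l < c)%N then inord l else be.

(** The exponents of $z_1,\dots,z_s$ and then of $y_1,\dots,y_{c-1},y_{be}$; [lift ord0] skips
    $y_0=1$. *)
Definition std_frame be : 'M[int]_(s + c, r + s) :=
  \matrix_i match split i with
    | inl b => delta_mx 0 (rshift r b)
    | inr a => eps (std_basis be (lift ord0 a))
    end.

Let top : 'I_r.+1 := inord c.

Hypothesis std_free : forall p,
  mmap kap (fun i => chi (row i (std_frame top))) p = 0 -> p = 0.

(** In the application [wt i j] is the exponent of the [j]-th variable in $T_i^{l_i}$, and [blk j]
    is the block of this variable, [None] for the $S_k$. *)
Variables (wt : 'I_r.+1 -> 'I_M -> nat) (blk : 'I_M -> option 'I_r.+1).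
Hypothesis wt_blk : forall i j, blk j != Some i -> wt i j = 0%N.
Hypothesis eps_pairing : forall i j,
  pairing (eps i) (col j P) = (wt i j)%:Z - (wt ord0 j)%:Z.
Hypothesis P_prim : forall j, primitive (col j P).

Lemma topE : top = c :> nat.
Proof. by rewrite inordK // ltnS. Qed.

Lemma std_basis_val be (l : 'I_c.+1) : (l < c)%N -> std_basis be l = l :> nat.
Proof. by move=> lc; rewrite /std_basis lc inordK //; lia. Qed.

Lemma std_basis_last be : std_basis be ord_max = be.
Proof. by rewrite /std_basis ltnn. Qed.

Lemma std_basis_inj (be : 'I_r.+1) : (c <= be)%N -> injective (std_basis be).
Proof.
move=> cbe; have le (l : 'I_c.+1) : (l < c)%N \/ l = ord_max.
  case: (ltnP l c) => lc; [by left|right]; apply: val_inj => /=.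
  by have := ltn_ord l; lia.
move=> l l' E; apply: val_inj; have := congr1 (@nat_of_ord _) E.
case: (le l) => [lc|->]; case: (le l') => [l'c|->];
  rewrite ?std_basis_last ?std_basis_val //; lia.
Qed.

Lemma std_basis0 be : std_basis be ord0 = ord0.
Proof. by apply: ord_inj; rewrite std_basis_val. Qed.

Lemma eps0 : eps ord0 = 0.
Proof.
rewrite /eps -[RHS]row_mx0; congr (row_mx _ _).
by apply/matrixP=> i a; rewrite !mxE.
Qed.

Lemma eps_lift a : eps (lift ord0 a) = delta_mx 0 (lshift s a).
Proof.
apply/matrixP=> i h; rewrite !mxE ord1 eqxx; case: splitP => b hb.
  by rewrite mxE (inj_eq lift_inj) eq_sym -(inj_eq val_inj) -[in RHS](inj_eq val_inj) /= hb.
rewrite mxE; case: eqP => // E; move: hb; rewrite E /=.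
by move=> hb; have := ltn_ord a; rewrite hb /= ltnNge leq_addr.
Qed.

Lemma eps_inj : injective eps.
Proof.
have epsE i a : eps i 0 (lshift s a) = (i == lift ord0 a)%:R.
  by rewrite /eps row_mxEl mxE.
move=> i i' E; case: (unliftP ord0 i) => [a ia|i0].
  have := epsE i' a; rewrite -E epsE ia eqxx.
  by case: eqP => // _ /eqP; rewrite oner_eq0.
case: (unliftP ord0 i') => [a i'a|->//].
have := epsE i a; rewrite E epsE i'a eqxx.
by case: eqP => // _ /eqP; rewrite oner_eq0.
Qed.

Lemma std_frame_l be b : row (lshift c b) (std_frame be) = delta_mx 0 (rshift r b).
Proof. by rewrite rowK (unsplitK (inl b)). Qed.

Lemma std_frame_r be a :
  row (rshift s a) (std_frame be) = eps (std_basis be (lift ord0 a)).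
Proof. by rewrite rowK (unsplitK (inr a)). Qed.

Lemma eps_frame be l : exists n, eps (std_basis be l) = n *m std_frame be.
Proof.
case: (unliftP ord0 l) => [a ->|->]; last first.
  by exists 0; rewrite std_basis0 eps0 mul0mx.
by exists (delta_mx 0 (rshift s a)); rewrite -rowE std_frame_r.
Qed.

Lemma chi0' : chi 0 = 1. Proof. exact: chi0. Qed.

(* [0] stands for the absence of a ray: the torus. *)
Lemma std_monomial_unit a :
  monomial_unit kap chi (std_frame top) (fun p => p = 0) 0 a.
Proof.
have I_prime := @mprime0 kk (s + c).
have p0 u : pairing u (0 : 'cV[int]_(r + s)) = 0 by rewrite /pairing mulmx0 mxE.
have tauP : (0 : 'cV[int]_(r + s)) = 0 \/ pairing 0 (0 : 'cV[int]_(r + s)) = 1 by left.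
apply: (monomial_unit_basis chi_neq0 chiD I_prime (tau := 0)) => // h.
rewrite scaler0 subr0; split=> //; exists 0, 1.
case: (split_ordP h) => [a1 ->|b ->].
  rewrite -eps_lift; set i := lift _ _.
  have bI : injective (std_basis top) by apply: std_basis_inj; rewrite topE.
  pose lin l : {mpoly kk[s + c]} := if unlift ord0 l is Some a then 'X_(rshift s a) else 1.
  have linE l : mmap kap (fun i => chi (row i (std_frame top))) (lin l) =
      chi (eps (std_basis top l)).
    rewrite /lin; case: unliftP => [a' ->|->].
      by rewrite mmapX mmap1U std_frame_r.
    by rewrite rmorph1 std_basis0 eps0 chi0'.
  have E : chi (eps i) = mmap kap (fun i => chi (row i (std_frame top)))
      (\sum_l (alpha A (std_basis top) l i)%:MP * lin l).
    rewrite (chi_rel bI) rmorph_sum; apply: eq_bigr => l _.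
    by rewrite rmorphM /= mmapC linE.
  exists (\sum_l (alpha A (std_basis top) l i)%:MP * lin l).
  split=> //; first by rewrite chi0' rmorph1.
  - by rewrite add0r E.
  - by apply/eqP/oner_neq0.
  - by move=> e; move: (chi_neq0 (eps i)); rewrite E e rmorph0 eqxx.
exists 'X_(lshift c b); split=> //; first by rewrite chi0' rmorph1.
- by rewrite add0r mmapX mmap1U std_frame_l.
- by apply/eqP/oner_neq0.
- move=> e; move: (chi_neq0 (row (lshift c b) (std_frame top))).
  by rewrite -(mmap1U (fun i => chi (row i (std_frame top)))) -(mmapX _ kap) e rmorph0 eqxx.
Qed.

Lemma std_coordinates : coordinates kap (fun i => chi (row i (std_frame top))).
Proof.
split=> //; have tauP : (0 : 'cV[int]_(r + s)) = 0 \/ pairing 0 (0 : 'cV[int]_(r + s)) = 1 by left.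
apply: (monomial_generate chi_neq0 chiD (I := fun p => p = 0) _ tauP) => //.
- exact: mprime0.
- by move=> a _; apply: std_monomial_unit.
- by exists 1; rewrite chi0' rmorph1.
Qed.

(* $d \log z_1 \wedge \dots \wedge d \log z_s \wedge d \log y_1 \wedge \dots
   \wedge d \log y_c$ for $y_i = T_i^{l_i} / T_0^{l_0}$ and the remaining
   coordinates $z_b$ of the torus. *)
Definition log_form (D : 'I_(s + c) -> F -> F) : F :=
  chi (- \sum_i row i (std_frame top)) *
  wedge_d (fun i => chi (row i (std_frame top))) D.

Definition log_pole (j : 'I_M) : int := -1 + (\sum_(i < r.+1 | (c < i)%N) wt i j)%:Z.

Section Dlog.
Variable D : F -> F.
Hypothesis DD : derivation k D.

Definition dlog u := D (chi u) / chi u.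

Lemma dlogD u w : dlog (u + w) = dlog u + dlog w.
Proof. by rewrite /dlog chiD (dlogM DD). Qed.

Lemma dlog0 : dlog 0 = 0.
Proof. by apply: (addrI (dlog 0)); rewrite -dlogD !addr0. Qed.

Lemma dlogZ (a : int) u : dlog (a *: u) = a%:~R * dlog u.
Proof.
have Mn n : dlog (u *+ n) = n%:R * dlog u.
  elim: n => [|n IH]; first by rewrite mulr0n dlog0 mul0r.
  by rewrite mulrS dlogD IH [n.+1]lock -lock mulrS mulrDl mul1r.
case: a => n; first by rewrite -[X in X *: _]natz scaler_nat Mn.
rewrite NegzE scaleNr -[X in X *: _]natz scaler_nat mulrNz mulNr -Mn.
by apply: (addrI (dlog (u *+ n.+1))); rewrite -dlogD !subrr dlog0.
Qed.

Lemma dlog_row q (W : 'M[int]_(q, r + s)) n :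
  dlog (n *m W) = \sum_i (n 0 i)%:~R * dlog (row i W).
Proof.
rewrite mulmx_sum_row (big_morph dlog dlogD dlog0).
by apply: eq_bigr => i _; rewrite dlogZ.
Qed.

End Dlog.

Lemma wedge_dlog q (W : 'M[int]_(q, r + s)) (D : 'I_q -> F -> F) :
  wedge_d (fun i => chi (row i W)) D =
  chi (\sum_i row i W) * \det (\matrix_(i, j) dlog (D i) (row j W)).
Proof.
rewrite (chi_sum chi_neq0 chiD) mulrC.
have -> : \prod_i chi (row i W) = \det (diag_mx (\row_i chi (row i W))).
  by rewrite det_diag; apply: eq_bigr => i _; rewrite mxE.
rewrite -det_mulmx; congr (\det _); apply/matrixP=> i j.
by rewrite mul_mx_diag !mxE /dlog divfK.
Qed.

Lemma wedge_unimodular q (U : 'M[int]_q) (W : 'M[int]_(q, r + s))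
    (D : 'I_q -> F -> F) : (forall i, derivation k (D i)) ->
  \det (\matrix_(i, j) dlog (D i) (row j (U *m W))) =
  (\det U)%:~R * \det (\matrix_(i, j) dlog (D i) (row j W)).
Proof.
move=> DD; rewrite -det_map_mx mulrC -[X in _ * X]det_tr -det_mulmx; congr (\det _).
apply/matrixP=> i j; rewrite mxE row_mul dlog_row // mxE.
by apply: eq_bigr => l _; rewrite !mxE mulrC.
Qed.

Lemma last_lt : ((s + c).-1 < s + c)%N.
Proof. by rewrite prednK // addn_gt0 c_gt0 orbT. Qed.

Let last := Ordinal last_lt.

Lemma last_or (i : 'I_(s + c)) : i != last -> (i < last)%N.
Proof.
by rewrite -(inj_eq val_inj) /= => ilast; have := ltn_ord i; lia.
Qed.

Lemma std_frame_last be : row last (std_frame be) = eps be.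
Proof.
have cP : (c.-1 < c)%N by rewrite prednK.
have -> : last = rshift s (Ordinal cP) by apply: val_inj => /=; lia.
rewrite std_frame_r; congr eps; rewrite -[RHS]std_basis_last; congr std_basis.
by apply: val_inj; rewrite /= /bump /= add1n prednK.
Qed.

Lemma std_frame_lt be i : i != last ->
  row i (std_frame be) = row i (std_frame top).
Proof.
move=> /last_or; case: (split_ordP i) => a ->; first by rewrite !std_frame_l.
move=> /= lt; rewrite !std_frame_r /std_basis.
by have -> : (lift ord0 a < c)%N by rewrite /= /bump /=; lia.
Qed.

(** If the last coordinate of column [be] vanished, so would the last row of the matrix that
    expresses the columns $0,\dots,c-1,be$ in the columns $0,\dots,c$; but this matrix relates two
    bases. *)
Lemma alpha_top (be : 'I_r.+1) : (c <= be)%N -> alpha A (std_basis top) ord_max be != 0.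
Proof.
move=> cbe; have bI := std_basis_inj cbe.
have tI : injective (std_basis top) by apply: std_basis_inj; rewrite topE.
have Bu := colsub_unit A_gen bI.
have E : colsub (std_basis be) A =
    colsub (std_basis top) A *m colsub (std_basis be) (alpha A (std_basis top)).
  apply/matrixP=> t l; rewrite !mxE (alphaP A_gen _ t tI); apply: eq_bigr => h _.
  by rewrite !mxE.
apply: contraTneq Bu => a0; rewrite E unitmxE det_mulmx unitfE mulf_eq0 negbK.
apply/orP; right; apply/eqP; rewrite (expand_det_row _ ord_max) big1 // => l _.
rewrite mxE; have [lc|lc] := ltnP l c; last first.
  have -> : l = ord_max by apply: val_inj => /=; have := ltn_ord l; lia.
  by rewrite std_basis_last a0 mul0r.
have -> : std_basis be l = std_basis top l by rewrite /std_basis lc.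
rewrite (alpha_basis A_gen _ _ tI) -(inj_eq val_inj) /=.
by case: eqP => [e|_]; [move: lc; rewrite -e ltnn | rewrite mul0r].
Qed.

Lemma wedge_std be (D : 'I_(s + c) -> F -> F) : (forall i, derivation k (D i)) ->
  wedge_d (fun i => chi (row i (std_frame be))) D =
  kap (alpha A (std_basis top) ord_max be) *
  wedge_d (fun i => chi (row i (std_frame top))) D.
Proof.
move=> DD; have tI : injective (std_basis top) by apply: std_basis_inj; rewrite topE.
pose a l := kap (alpha A (std_basis top) l be).
(* Apart from its last column, [T] is the identity. That column lists the coefficients of $y_{be}$
   in $y_1,\dots,y_c$; the coefficient of $y_0=1$ disappears under derivations. *)
pose T : 'M[F]_(s + c) := \matrix_(i, j) if j == last then
    (if split i is inr h then a (lift ord0 h) else 0) else (i == j)%:R.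
have dT : \det T = a ord_max.
  rewrite -det_tr det_trig => [|]; last first.
    apply/is_trig_mxP => i j ij; rewrite !mxE.
    case: (eqVneq i last) => [il|_]; last by rewrite eq_sym -(inj_eq val_inj) (ltn_eqF ij).
    by move: ij; rewrite il; have := ltn_ord j => /=; lia.
  rewrite (bigD1 last) //= big1 ?mulr1 => [|i il]; last first.
    by rewrite !mxE (negPf il) eqxx.
  rewrite !mxE eqxx; have cP : (c.-1 < c)%N by rewrite prednK.
  have -> : last = rshift s (Ordinal cP) by apply: val_inj => /=; lia.
  rewrite (unsplitK (inr _)); congr a.
  by apply: val_inj; rewrite /= /bump /= add1n prednK.
rewrite -/(a ord_max) -dT mulrC -det_mulmx; congr (\det _).
apply/matrixP=> i j; rewrite !mxE; have [->|jl] := eqVneq j last; last first.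
  rewrite (bigD1 j) //= big1 ?addr0 => [|h hj]; rewrite !mxE (negPf jl).
    by rewrite eqxx mulr1 std_frame_lt.
  by rewrite (negPf hj) mulr0.
rewrite std_frame_last (chi_rel tI) (derivation_sum (DD i)) big_ord_recl.
have DZ b f : D i (kap b * f) = kap b * D i f.
  have [_ DM D0] := DD i; rewrite DM D0 ?mul0r ?add0r //.
  by apply/kE; exists b.
rewrite DZ std_basis0 eps0 chi0' (derivation1 (DD i)) mulr0 add0r.
rewrite big_split_ord /= [X in X + _]big1 ?add0r => [|h _].
  apply: eq_bigr => h _; rewrite DZ -/(a (lift ord0 h)).
  by rewrite !mxE eqxx (unsplitK (inr h)) std_frame_r mulrC.
by rewrite !mxE eqxx (unsplitK (inl h)) mulr0.
Qed.

Lemma log_form_neq0 : form_neq0 k log_form.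
Proof.
have [d [dD dE]] := partial_derivations kE std_coordinates.
have [D DD wD] := wedge_coordinates_neq0 dD dE.
by exists D; rewrite // mulf_neq0.
Qed.

Section Ray.
Variable j : 'I_M.
Local Notation v := (col j P).
(** With this choice the block of [j], if there is one, always belongs to [std_basis be]: blocks
    before [c] are in it anyway. *)
Let be : 'I_r.+1 := if blk j is Some i then (if (c <= i)%N then i else top) else top.

Let c_le_be : (c <= be)%N.
Proof.
rewrite /be; case: (blk j) => [i|]; last by rewrite topE.
by case: ifP => // _; rewrite topE.
Qed.

Let beI : injective (std_basis be). Proof. exact: std_basis_inj. Qed.

Lemma blk_std i : blk j = Some i -> exists l, i = std_basis be l.
Proof.
move=> ji; have [ci|ic] := leqP c i.
  by exists ord_max; rewrite std_basis_last /be ji ci.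
have lt_ic : (i < c.+1)%N by exact: ltnW.
by exists (Ordinal lt_ic); apply: ord_inj; rewrite std_basis_val.
Qed.

(** The left side is the order along [j] of $y_{be}/y_c$, the factor that appears when $d\log y_c$
    is replaced by $d\log y_{be}$. At most one summand on the right is nonzero. *)
Lemma wt_pole : (wt be j)%:Z - (wt top j)%:Z =
  (\sum_(i < r.+1 | (c < i)%N) wt i j)%:Z.
Proof.
case E: (blk j) => [i|]; last first.
  have wt0 h : wt h j = 0%N by apply: wt_blk; rewrite E.
  by rewrite !wt0 big1.
have wt0 h : h != i -> wt h j = 0%N.
  by move=> hi; apply: wt_blk; rewrite E; apply: contra_neq hi => -[].
have [ci|ic] := ltnP c i.
  rewrite (bigD1 i) //= big1 ?addn0 => [|h /andP[_ /wt0//]].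
  rewrite /be E ltnW // (wt0 top) ?subr0 // -(inj_eq val_inj) /= topE.
  by rewrite neq_ltn ci.
rewrite big1 => [|h ch]; last by apply: wt0; apply: contraTneq ch => ->; rewrite -leqNgt.
suff -> : be = top by rewrite subrr.
rewrite /be E; case: ifP => // ci; apply: ord_inj; rewrite topE.
by apply/eqP; rewrite eqn_leq ic.
Qed.

(** No divisibility is lost by omitting the other [eps i]: they pair with [v] to a difference of
    weights, only the weight of the block of [j] can be nonzero, and this block is in the basis.
    Hence [d] divides all entries of the primitive vector [v]. *)
Lemma frame_primitive (d : int) :
  (forall i, (d %| (std_frame be *m v) i ord0)%Z) -> (d %| 1)%Z.
Proof.
move=> dE; have dF i : (d %| pairing (row i (std_frame be)) v)%Z.
  by rewrite /pairing -row_mul mxE; apply: dE.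
have deps l : (d %| pairing (eps (std_basis be l)) v)%Z.
  case: (unliftP ord0 l) => [a ->|->]; first by rewrite -std_frame_r.
  by rewrite std_basis0 eps0 pairing0 dvdz0.
suff dv h : (d %| v h ord0)%Z.
  by have := dvdz_biggcd dv; rewrite (P_prim j : \big[gcdz/0]_i v i 0 = 1).
case: (split_ordP h) => a ->; last first.
  by rewrite -[v _ _]pairing_delta -(std_frame_l be).
rewrite -[v _ _]pairing_delta -eps_lift eps_pairing.
(* If [j] lies in block 0, a second basis index, available as [c] is positive, pairs to minus its
   weight; otherwise the weight is zero. *)
have d0 : (d %| (wt ord0 j)%:Z)%Z.
  have cP : (0 < c)%N by [].
  have := deps (lift ord0 (Ordinal cP)); rewrite eps_pairing.
  have [E|nE] := eqVneq (blk j) (Some ord0); last by rewrite (wt_blk nE) dvdz0.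
  rewrite [wt (std_basis _ _) j]wt_blk ?sub0r ?rpredN // E.
  apply/eqP => -[] e; have /beI/eqP := etrans (std_basis0 be) e.
  by rewrite eq_liftF.
rewrite rpredB //.
have [E|nE] := eqVneq (blk j) (Some (lift ord0 a)); last by rewrite (wt_blk nE) dvdz0.
have [l ->] := blk_std E.
by have := deps l; rewrite eps_pairing rpredBr.
Qed.

(** A unimodular [U] turns the values of the frame on [v] into a unit vector, so that one coordinate
    has order one and all others order zero along [v]. The work lies in the [eps i] outside the
    basis: such a [chi (eps i)] is a sum of monomials, and must be shown to be a unit times a power
    of the distinguished coordinate. *)
Lemma ray_coordinates : exists W k0,
  [/\ coordinates kap (fun i => chi (row i W)),
      forall i, pairing (row i W) v = (i == k0)%:R,
      forall a, pairing a v = 0 ->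
        monomial_unit kap chi W (fun p => kill k0 p = 0) v a &
      exists a e, [/\ a != 0, pairing e v = log_pole j &
        forall D : 'I_(s + c) -> F -> F, (forall i, derivation k (D i)) ->
          log_form D = kap a * chi e * wedge_d (fun i => chi (row i W)) D]].
Proof.
have lt0 : (0 < s + c)%N by rewrite addn_gt0 c_gt0 orbT.
pose k0 := Ordinal lt0.
have [U Uu Uv] := @unimodular_completion _ k0 _ (erefl _) frame_primitive.
pose W := U *m std_frame be; have Wv : W *m v = delta_mx k0 0 by rewrite -mulmxA.
have I_prime := @mprime_kill kk (s + c) k0.
set I := (fun p : {mpoly kk[s + c]} => kill k0 p = 0) in I_prime.
have pW n : pairing (n *m W) v = n 0 k0.
  by rewrite pairing_row Wv /pairing -colE mxE.
have prow i : pairing (row i W) v = (i == k0)%:R.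
  by rewrite rowE pW mxE eqxx eq_sym.
have nX (m : 'X_{1..(s + c)}) (p : {mpoly kk[s + c]}) : m k0 = 0%N -> p@_m != 0 -> ~ I p.
  by move=> m0 pm; apply: kill_mcoeff m0 pm.
have uW (n : 'rV[int]_(s + c)) : n 0 k0 = 0 -> monomial_unit kap chi W I v (n *m W).
  move=> n0; rewrite mulmx_sum_row; apply: monomial_unit_sum => // i _.
  have [->|ik] := eqVneq i k0.
    by rewrite n0 scale0r; apply: monomial_unit0.
  apply: monomial_unitZ => //; apply: monomial_unit_row => //.
    by rewrite prow (negPf ik).
  by apply: (nX U_(i)%MM); rewrite ?mnm1E ?(negPf ik) // mcoeffX eqxx oner_neq0.
pose tau := row k0 W.
have tauE : tau = delta_mx 0 k0 *m W by rewrite -rowE.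
have tauP : v = 0 \/ pairing tau v = 1 by right; rewrite prow eqxx.
have frameW n : n *m std_frame be = (n *m invmx U) *m W.
  by rewrite /W -!mulmxA mulKmx.
have ufrm i : monomial_unit kap chi W I v
    (row i (std_frame be) - pairing (row i (std_frame be)) v *: tau).
  rewrite {1}rowE frameW tauE scalemxAl -mulmxBl; apply: uW.
  rewrite -pW mulmxBl -frameW -rowE -scalemxAl -tauE.
  exact: pairing_tau.
have ueps i : monomial_unit kap chi W I v (eps i - pairing (eps i) v *: tau).
  set ka := pairing (eps i) v.
  (* No term in the expression of [chi (eps i)] has smaller order than [ka]: the weight of [i] at
     [j] is zero unless [i] is the block of [j], and then [i] is in the basis and there is just one
     term. *)
  have wtle l : alpha A (std_basis be) l i != 0 ->
      ka <= pairing (eps (std_basis be l)) v.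
    move=> al; rewrite /ka !eps_pairing lerD2r lez_nat.
    have [E|nE] := eqVneq (blk j) (Some i); last by rewrite (wt_blk nE).
    have [l' il'] := blk_std E; move: al; rewrite il' (alpha_basis A_gen) //.
    by case: (eqVneq l l') => [->|]; rewrite // eqxx.
  (* Some term has exactly the order [ka]. If [j] lies in a block [i0] other than [i], general
     position gives a term off [i0]; for a variable outside all blocks any [i0] different from [i]
     will do. *)
  have [l0 al0 kal0] : exists2 l, alpha A (std_basis be) l i != 0 &
      ka = pairing (eps (std_basis be l)) v.
    have [E|nE] := eqVneq (blk j) (Some i).
      have [l' il'] := blk_std E; exists l'; last by rewrite -il'.
      by rewrite il' (alpha_basis A_gen) // eqxx oner_neq0.
    have [i0 ii0 ji0] : exists2 i0, i != i0 & forall h, h != i0 -> wt h j = 0%N.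
      case E: (blk j) nE => [i0|] nE.
        exists i0; first by apply: contra_neq nE => ->.
        by move=> h hi0; apply: wt_blk; rewrite E; apply: contra_neq hi0 => -[].
      have wt0 h : wt h j = 0%N by apply: wt_blk; rewrite E.
      exists (if i == ord0 then top else ord0) => //.
      case: (eqVneq i ord0) => [->|//]; apply/eqP => /(congr1 (@nat_of_ord _)).
      by rewrite topE /=; lia.
    have [l al bl] := alpha_neq0 c_gt0 c_le_r A_gen beI ii0.
    by exists l => //; rewrite /ka !eps_pairing (ji0 _ ii0) (ji0 _ bl).
  have /choice[n nE] : forall l, exists n : 'rV[int]_(s + c),
      eps (std_basis be l) - ka *: tau = n *m W.
    move=> l; have [n nE] := eps_frame be l.
    exists (n *m invmx U - ka *: delta_mx 0 k0).
    by rewrite nE frameW mulmxBl -scalemxAl -tauE.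
  have nk0 l : n l 0 k0 = pairing (eps (std_basis be l)) v - ka.
    by rewrite -pW -nE pairingD pairingN pairingZ prow eqxx mulr1.
  (* [B] bounds all exponents involved, so the monomial [w] clears the negative ones. At [k0]
     nothing is to be cleared, by [wtle]. *)
  pose B := (\sum_l \sum_h `|n l 0%R h|)%N.
  have leB l h : (`|n l 0%R h| <= B)%N.
    by rewrite /B (bigD1 l) //= (bigD1 h) //= -addnA leq_addr.
  pose w := (\row_h (if h == k0 then 0 else B%:Z)) *m W.
  pose m l := [multinom `|(n l 0 h + (if h == k0 then 0 else B%:Z))%R|%N | h < s + c].
  have mE l : alpha A (std_basis be) l i != 0 ->
      chi (w + (eps (std_basis be l) - ka *: tau)) =
      mmap kap (fun i => chi (row i W)) 'X_[m l].
    move=> al; rewrite (mmap_monomial kap chi_neq0 chiD) nE -mulmxDl; congr (chi (_ *m W)).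
    apply/rowP => h; rewrite !mxE mnmE addrC gez0_abs //.
    case: (eqVneq h k0) => [->|_]; last by have := leB l h; lia.
    by rewrite addr0 nk0 subr_ge0 wtle.
  pose p := \sum_l (alpha A (std_basis be) l i)%:MP * 'X_[m l] : {mpoly kk[s + c]}.
  split; first by rewrite pairingD pairingN pairingZ prow eqxx mulr1 subrr.
  exists w, 'X_[[multinom (if h == k0 then 0%N else B) | h < s + c]], p; split.
  - by rewrite pW mxE eqxx.
  - rewrite (mmap_monomial kap chi_neq0 chiD); congr (chi (_ *m W)).
    by apply/rowP => h; rewrite !mxE mnmE; case: ifP.
  - rewrite rmorph_sum addrA [w + _]addrC -addrA chiD (chi_rel beI) mulr_suml.
    apply: eq_bigr => l _; rewrite rmorphM /= mmapC -mulrA.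
    have [->|al] := eqVneq (alpha A (std_basis be) l i) 0.
      by rewrite (rmorph0 kap) mul0r raddf0 mul0r.
    by rewrite -mE // -chiD; congr (_ * chi _); rewrite addrCA.
  - apply: (nX [multinom (if h == k0 then 0%N else B) | h < s + c]).
      by rewrite mnmE eqxx.
    by rewrite mcoeffX eqxx oner_neq0.
  (* The monomial [m l0] is free of ['X_k0], and no other term cancels it: equal exponents would
     give equal values of [eps]. *)
  - apply: (nX (m l0)); first by rewrite mnmE eqxx addr0 nk0 -kal0 subrr.
    rewrite /p raddf_sum /= (bigD1 l0) //= big1 ?addr0 => [|l ll0].
      by rewrite mcoeffCM mcoeffX eqxx mulr1.
    rewrite mcoeffCM mcoeffX; case: eqP => [ml|_]; last by rewrite mulr0.
    have [->|al] := eqVneq (alpha A (std_basis be) l i) 0; first by rewrite mul0r.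
    case/eqP: ll0; apply: beI; apply: eps_inj; apply: (addIr (- (ka *: tau))).
    rewrite !nE; congr (_ *m W); apply/rowP => h.
    suff : n l 0 h = n l0 0 h by [].
    have /mnmP/(_ h) := ml; rewrite !mnmE => /(congr1 Posz).
    case: (eqVneq h k0) => [->|_]; last by have := leB l h; have := leB l0 h; lia.
    by rewrite !addr0 !gez0_abs // nk0 ?subr_ge0 ?wtle // -kal0.
have uperp a : pairing a v = 0 -> monomial_unit kap chi W I v a.
  apply: (monomial_unit_basis chi_neq0 chiD I_prime (tau := tau)) => // h.
  rewrite -[v h 0]pairing_delta; case: (split_ordP h) => h' ->.
    by rewrite -eps_lift.
  by rewrite -(std_frame_l be).
have detU0 : (\det U)%:~R != 0 :> kk.
  rewrite -unitfE; apply: (rmorph_unit (intr : int -> kk)).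
  by rewrite -unitmxE.
have al0 := alpha_top c_le_be.
(* The three sums are the monomial factors between wedges of differentials and of logarithmic
   differentials. Along [v] the last one contributes $-1$, and the first two leave only
   [eps be - eps top]. *)
pose e := \sum_i row i (std_frame be) - \sum_i row i (std_frame top) - \sum_i row i W.
pose a := (alpha A (std_basis top) ord_max be * (\det U)%:~R)^-1.
have logE (D : 'I_(s + c) -> F -> F) : (forall i, derivation k (D i)) ->
    log_form D = kap a * chi e * wedge_d (fun i => chi (row i W)) D.
  move=> DD; rewrite wedge_dlog wedge_unimodular // /log_form.
  have := wedge_std be DD; rewrite [X in X = _]wedge_dlog.
  set d := \det (\matrix_(i, j) dlog _ (row j (std_frame be))).
  set w := wedge_d _ _ => E.
  have -> : w = (kap (alpha A (std_basis top) ord_max be))^-1 *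
      (chi (\sum_i row i (std_frame be)) * d) by rewrite E mulKf // fmorph_eq0.
  rewrite /e /a !(chiB chi_neq0 chiD) (chiN chi_neq0 chiD) fmorphV rmorphM rmorph_int.
  field; rewrite !chi_neq0 fmorph_eq0 al0 /=.
  by rewrite andbT -(rmorph_int kap) fmorph_eq0.
exists W, k0; split=> //; last first.
  exists a, e; split=> //; first by rewrite invr_eq0 mulf_neq0.
  have sW : pairing (\sum_i row i W) v = 1.
    rewrite pairing_sum (bigD1 k0) //= prow eqxx big1 ?addr0 // => i ik.
    by rewrite prow (negPf ik).
  rewrite /e pairingD pairingN sW /log_pole addrC; congr (_ + _).
  rewrite -sumrB (bigD1 last) //= big1 ?addr0 => [|i il]; last first.
    by rewrite std_frame_lt // subrr.
  rewrite !std_frame_last pairingD pairingN !eps_pairing -wt_pole.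
  by rewrite opprB addrA subrK.
have gen : forall f, exists a b, mmap kap (fun i => chi (row i W)) b != 0 /\
    f = mmap kap (fun i => chi (row i W)) a / mmap kap (fun i => chi (row i W)) b.
  apply: (monomial_generate chi_neq0 chiD I_prime tauP) => //.
  by exists 'X_k0; rewrite mmapX mmap1U.
(* The new coordinates are independent because the nonzero log form is a multiple of their wedge. *)
split=> // p; apply: (jacobian_criterion kE kk0).
have [D DD wD] := log_form_neq0; exists D => //.
by apply: contraNneq wD => wD; rewrite logE // wD mulr0.
Qed.

End Ray.

End RayCoordinates.

(** * Localizations of subrings of a field *)

Section Localization.
Variables (F : fieldType) (A p : set F).
Hypothesis AR : is_subring A.
Hypothesis p_prime : prime_ideal A p.

Let A1 : A 1. Proof. by case: AR. Qed.
Let AM a b : A a -> A b -> A (a * b). Proof. by case: AR => _ _; apply. Qed.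
Let pA a : p a -> A a. Proof. by case: p_prime => H _ _ _ _; apply: H. Qed.
Let p0 : p 0. Proof. by case: p_prime => _ []. Qed.
Let p1 : ~ p 1. Proof. by case: p_prime => _ []. Qed.
Let pD a b : p a -> p b -> p (a + b). Proof. by case: p_prime => _ _ H _ _; apply: H. Qed.
Let pM a b : A a -> p b -> p (a * b). Proof. by case: p_prime => _ _ _ H _; apply: H. Qed.
Let pP a b : A a -> A b -> p (a * b) -> p a \/ p b.
Proof. by case: p_prime => _ _ _ _ H; apply: H. Qed.
Let np_neq0 b : ~ p b -> b != 0.
Proof. by move=> nb; apply/eqP => b0; apply: nb; rewrite b0. Qed.
Let npM a b : A a -> A b -> ~ p a -> ~ p b -> ~ p (a * b).
Proof. by move=> Aa Ab na nb /(pP Aa Ab)[]. Qed.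

Definition localization_max : set F :=
  [set x | exists a b, [/\ p a, A b, ~ p b & x = a / b]].

Lemma localization_sub a : A a -> localization A p a.
Proof. by move=> Aa; exists a, 1; split=> //; rewrite divr1. Qed.

Lemma localization_subring : is_subring (localization A p).
Proof.
have [_ AB _] := AR.
split; first exact: localization_sub.
  move=> _ _ [a [b [Aa Ab nb ->]]] [a' [b' [Aa' Ab' nb' ->]]].
  exists (a * b' - a' * b), (b * b'); split; try by [apply: AB; apply: AM | apply: AM | apply: npM].
  by field; rewrite !np_neq0.
move=> _ _ [a [b [Aa Ab nb ->]]] [a' [b' [Aa' Ab' nb' ->]]].
by exists (a * a'), (b * b'); rewrite mulf_div; split; try by [apply: AM | apply: npM].
Qed.

Lemma localization_max_sub a : A a -> localization_max a <-> p a.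
Proof.
move=> Aa; split=> [[a' [b [pa' Ab nb E]]]|pa]; last first.
  by exists a, 1; split=> //; rewrite divr1.
have : p (a * b) by rewrite E divfK // np_neq0.
by case/pP.
Qed.

Lemma localization_maxD f g : localization_max f -> localization_max g ->
  localization_max (f + g).
Proof.
move=> [a [b [pa Ab nb ->]]] [a' [b' [pa' Ab' nb' ->]]].
exists (a * b' + a' * b), (b * b'); split; try by [apply: AM | apply: npM].
  by apply: pD; rewrite mulrC; apply: pM.
by field; rewrite !np_neq0.
Qed.

Lemma localization_maxM f g : localization A p f -> localization_max g ->
  localization_max (f * g).
Proof.
move=> [a [b [Aa Ab nb ->]]] [a' [b' [pa' Ab' nb' ->]]].
by exists (a * a'), (b * b'); rewrite mulf_div; split; try by [apply: pM | apply: AM | apply: npM].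
Qed.

Lemma localization_max1 : ~ localization_max 1.
Proof. by move/(localization_max_sub A1). Qed.

Lemma localization_max_prime f g : localization A p f -> localization A p g ->
  localization_max (f * g) -> localization_max f \/ localization_max g.
Proof.
move=> [a [b [Aa Ab nb ->]]] [a' [b' [Aa' Ab' nb' ->]]] m.
have : localization_max (a * a').
  have -> : a * a' = (b * b') * (a / b * (a' / b')) by field; rewrite !np_neq0.
  by apply: localization_maxM => //; apply: localization_sub; apply: AM.
move=> /(localization_max_sub (AM Aa Aa'))/(pP Aa Aa')[pa|pa]; [left|right].
  by exists a, b.
by exists a', b'.
Qed.

Lemma localization_unit f : localization A p f -> ~ localization_max f ->
  unit_of (localization A p) f.
Proof.
move=> [a [b [Aa Ab nb fE]]] nm.
have na : ~ p a by move=> pa; apply: nm; exists a, b.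
split; first by rewrite fE mulf_neq0 ?invr_eq0 ?np_neq0.
  by exists a, b.
by exists b, a; split=> //; rewrite fE invf_div.
Qed.

Lemma localization_unit_max f :
  unit_of (localization A p) f -> ~ localization_max f.
Proof.
move=> [f0 _ Ofi] m; apply: localization_max1; rewrite -(mulVf f0).
exact: localization_maxM.
Qed.

End Localization.

(** * Charts *)

Section Charts.
Variables (F : fieldType) (k : set F) (kk : fieldType).
Variable kap : {rmorphism kk -> F}.
Hypothesis kE : forall x, k x <-> exists a, x = kap a.
Hypothesis kk0 : [pchar kk] =i pred0.
Variables (N M q : nat) (P : 'M[int]_(N, M)).
Variable chi : 'rV[int]_N -> F.
Hypothesis chi_neq0 : forall u, chi u != 0.
Hypothesis chiD : forall u v, chi (u + v) = chi u * chi v.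
Implicit Types (H : set 'I_M) (j : 'I_M) (u w : 'rV[int]_N) (f g : F).

Local Notation pj u j := (pairing u (col j P)).

(* Exponents of the monomials regular on the chart with rays in [H]. *)
Definition dual_cone H : set 'rV[int]_N := [set u | forall j, H j -> 0 <= pj u j].
Definition chart H : set F := laurent kap chi (dual_cone H).
Definition ray_ideal H j : set F :=
  laurent kap chi [set u | dual_cone H u /\ 1 <= pj u j].

Lemma chart_subring H : is_subring (chart H).
Proof.
apply: laurent_subring => //; first by move=> j _; rewrite pairing0.
by move=> u w Hu Hw j Hj; rewrite pairingD addr_ge0 ?Hu ?Hw.
Qed.

Lemma chart_chi H u : (forall j, H j -> 0 <= pj u j) -> chart H (chi u).
Proof. by move=> Hu; apply: laurent_chi. Qed.

Lemma chart_eventually H w (S : set 'rV[int]_N) f :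
  (forall u j, S u -> H j -> 0 < pj w j \/ (pj w j = 0 /\ 0 <= pj u j)) ->
  laurent kap chi S f -> exists n : nat, forall n', (n <= n')%N ->
    chart H (chi (w *+ n') * f).
Proof.
move=> SH; elim=> [|c u g Su _ [n Hn]].
  by exists 0%N => n' _; rewrite mulr0; apply: subring0 (chart_subring H).
exists (n + \sum_j `|pj u j|)%N => n' le; rewrite mulrDr.
apply: (subringD (chart_subring H)); last by apply: Hn; lia.
rewrite mulrCA -chiD; apply: laurent_term => j Hj.
rewrite pairingD -scaler_nat pairingZ natz.
have lej : (`|pj u j| <= n')%N.
  by apply: leq_trans le; rewrite (bigD1 j) //= addnCA leq_addr.
have [wj|[-> uj]] := SH u j Su Hj; last by rewrite mulr0 add0r.
have : 1 * `|pj u j|%N%:Z <= n'%:Z * pj w j by nia.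
lia.
Qed.

(** * The local ring of a ray *)

Section RayRing.
Variables (j : 'I_M) (W : 'M[int]_(q, N)) (k0 : 'I_q).
Local Notation v := (col j P).
Local Notation x := (fun i => chi (row i W)).
Local Notation Th := (mmap kap x).
Local Notation I := (fun p : {mpoly kk[q]} => kill k0 p = 0).
Hypothesis xC : coordinates kap x.
Hypothesis rowP : forall i, pairing (row i W) v = (i == k0)%:R.
Hypothesis perpP : forall a, pairing a v = 0 ->
  monomial_unit kap chi W I v a.

Let tau := row k0 W.
Let I_prime : mprime I. Proof. exact: mprime_kill. Qed.
Let tau1 : pairing tau v = 1. Proof. by rewrite rowP eqxx. Qed.
Let tauP : v = 0 \/ pairing tau v = 1. Proof. by right. Qed.
Let ThX : Th 'X_k0 = chi tau. Proof. by rewrite mmapX mmap1U. Qed.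

Local Notation O := (local_ring kap x I).
Local Notation m := (local_max kap x I).

Let OR : is_subring O. Proof. exact: local_ring_subring. Qed.

Lemma ray_clearable f : laurent kap chi [set u | 0 <= pairing u v] f ->
  clearable kap chi W I v f.
Proof.
apply: (clearable_laurent chi_neq0 chiD I_prime tauP perpP).
by exists 'X_k0.
Qed.

Lemma ray_local f : laurent kap chi [set u | 0 <= pairing u v] f -> O f.
Proof.
move=> /ray_clearable[w [b [c [_ wb nb E]]]]; exists c, b; split=> //.
by rewrite -wb -E mulrC mulKf.
Qed.

Lemma ray_unit u : pairing u v = 0 -> unit_of O (chi u).
Proof.
move=> uv; split=> //.
  by apply: ray_local; apply: laurent_chi => //=; rewrite uv.
rewrite -(chiN chi_neq0 chiD); apply: ray_local; apply: laurent_chi => //=.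
by rewrite pairingN uv oppr0.
Qed.

Let I_free p : kill k0 p = p -> I p -> p = 0.
Proof. by move=> pK p0; rewrite -pK. Qed.

Lemma ray_uniformizer : uniformizer O (chi tau).
Proof. by rewrite -ThX; apply: (local_uniformizer xC I_prime I_free (min_size_var kk k0)). Qed.

Lemma ray_ord u : ord_at O (chi u) (pairing u v).
Proof.
exists (chi tau), (chi (u - pairing u v *: tau)); split.
- exact: ray_uniformizer.
- by apply: ray_unit; apply: pairing_tau.
- by rewrite -(chiZ chi_neq0 chiD) -chiD subrK.
Qed.

Lemma ray_mmap p : laurent kap chi [set u | 0 <= pairing u v] (Th p).
Proof.
have LR : is_subring (laurent kap chi [set u | 0 <= pairing u v]).
  apply: laurent_subring => // [|u w]; first by rewrite /= pairing0.
  by move=> /= Hu Hw; rewrite pairingD addr_ge0.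
elim/mpoly_ring_ind: p => [c|i|p p' Ep Ep'|p p' Ep Ep'].
- rewrite mmapC -[X in laurent _ _ _ X]mulr1 -(chi0 chi_neq0 chiD).
  by apply: laurent_term; rewrite /= pairing0.
- by rewrite mmapX mmap1U; apply: laurent_chi; rewrite /= rowP ler0n.
- by rewrite rmorphD; apply: subringD.
- by rewrite rmorphM; have [_ _ LM] := LR; apply: LM.
Qed.

(** Although exponents are not determined by [f], vanishing along the ray allows a choice of
    positive ones: a monomial of order zero clears [f] to a polynomial, which is then divisible by
    ['X_k0], that is, by [chi tau]. *)
Lemma ray_maxP f : laurent kap chi [set u | 0 <= pairing u v] f ->
  m f <-> laurent kap chi [set u | 1 <= pairing u v] f.
Proof.
move=> Lf; split=> [mf|L1].
  have [w [b [c [vw wb nb E]]]] := ray_clearable Lf.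
  have /(local_max_mmap xC I_prime)/kill_eq0[c' cE] : m (Th c).
    by rewrite -E wb; apply: (local_maxM I_prime) => //; apply: local_ring_mmap.
  have ct : Th c = chi tau * Th c' by rewrite cE rmorphM /= ThX.
  have -> : f = chi (tau - w) * Th c'.
    by rewrite (chiB chi_neq0 chiD) mulrAC -ct -E mulrC mulKf.
  apply: (laurentM chiD _ (laurent_chi kap chi (S := [set u | 1 <= pairing u v]) _) (ray_mmap c')).
    by move=> u u' /= Hu Hu'; rewrite pairingD ler_wpDr.
  by rewrite /= pairingD pairingN vw subr0 tau1.
apply/(local_maxP xC I_prime I_free (min_size_var kk k0)).
exists (chi (- tau) * f); last by rewrite ThX mulrA -chiD subrr chi0 // mul1r.
apply: ray_local.
apply: (laurentM chiD _ (laurent_chi kap chi (S := [set u | -1 <= pairing u v]) _) L1).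
  by move=> u u' /= Hu Hu'; rewrite pairingD; lia.
by rewrite /= pairingN tau1.
Qed.

Lemma ray_inv_tau : ~ O (chi (- tau)).
Proof.
rewrite (chiN chi_neq0 chiD) => Oi; have := ray_uniformizer => -[t0 Ot /(_ _ Ot)[_ H]].
by apply: H; [exists 1; rewrite ?mulr1 //; case: OR | split].
Qed.

Section Chart.
Variable H : set 'I_M.
Hypothesis Hj : H j.
Variable uj : 'rV[int]_N.
Hypothesis uj0 : pj uj j = 0.
Hypothesis uj_gt0 : forall i, H i -> i <> j -> 0 < pj uj i.

Definition ray_prime : set F := [set f | chart H f /\ m f].

Lemma chart_ray f : chart H f -> laurent kap chi [set u | 0 <= pairing u v] f.
Proof. by apply: laurentS => u Hu; apply: Hu. Qed.

Lemma ray_prime_prime : prime_ideal (chart H) ray_prime.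
Proof.
have [A1 _ AM] := chart_subring H.
split.
- by move=> f [].
- split; last by move=> [_ /(local_max1 xC I_prime)].
  split; first exact: subring0 (chart_subring H).
  by exists 0, 1; split; rewrite ?rmorph0 ?mul0r //; case: I_prime => [[]].
- move=> f g [Af mf] [Ag mg]; split; first exact: (subringD (chart_subring H)).
  exact: (local_maxD xC).
- move=> f g Af [Ag mg]; split; first exact: AM.
  by apply: (local_maxM I_prime) => //; apply: ray_local; apply: chart_ray.
- move=> f g Af Ag [_ mfg].
  have [mf|mg] := local_max_prime xC I_prime (ray_local (chart_ray Af))
    (ray_local (chart_ray Ag)) mfg; [left|right]; by split.
Qed.

(** A large multiple of [uj] makes numerator and denominator regular along all other rays of the
    chart, while [chi uj] is a unit along [j]. *)
Lemma ray_localization : localization (chart H) ray_prime = O.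
Proof.
have [_ _ OM] := OR.
apply/seteqP; split=> f.
  move=> [a [b [Aa Ab nb ->]]].
  have Oa := ray_local (chart_ray Aa); have Ob := ray_local (chart_ray Ab).
  have [|_ _ Obi] := (local_unitP xC I_prime b).2; last exact: OM.
  by split=> // mb; apply: nb.
move=> [a [b [nb ->]]].
have ev p : exists n : nat, forall n', (n <= n')%N -> chart H (chi (uj *+ n') * Th p).
  apply: (chart_eventually _ (ray_mmap p)) => u i /= uv Hi.
  have [->|ij] := pselect (i = j); first by right.
  by left; apply: uj_gt0.
have [n an] := ev a; have [n' bn] := ev b.
exists (chi (uj *+ (n + n')) * Th a), (chi (uj *+ (n + n')) * Th b); split.
- by apply: an; apply: leq_addr.
- by apply: bn; apply: leq_addl.
- have uu : pj (uj *+ (n + n')) j = 0 by rewrite -scaler_nat pairingZ uj0 mulr0.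
  have [u0 _ Oi] := ray_unit uu.
  move=> [_ mb]; apply: nb; apply/(local_max_mmap xC I_prime).
  by rewrite -(mulKf u0 (Th b)); apply: (local_maxM I_prime).
- by rewrite -mulf_div divff // mul1r.
Qed.

End Chart.

(** Up to factors outside the prime, a nonzero element of a smaller prime [Q] is a power of
    [chi tau]. So [Q] contains [chi tau], which generates the prime of the ray. *)
Lemma ray_height_one : height_one (chart [set j]) (ray_prime [set j]).
Proof.
have AE f : chart [set j] f <-> laurent kap chi [set u | 0 <= pairing u v] f.
  by split; apply: laurentS => u; [apply | move=> Hu _ ->].
have At : ray_prime [set j] (chi tau).
  split; first by apply: chart_chi => _ ->; rewrite tau1.
  by apply/ray_maxP; apply: laurent_chi; rewrite /= tau1.
split; first exact: ray_prime_prime.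
  by exists (chi tau).
move=> Q Qp QJ [f Qf f0]; apply/seteqP; split=> // g [Ag mg].
have [QA [Q0 Q1] QD QM QP] := Qp.
have Lf := (AE _).1 (QA _ Qf).
have [w [b [c [vw wb nb E]]]] := ray_clearable Lf.
have Aw : chart [set j] (chi w) by apply: chart_chi => _ ->; rewrite vw.
have c0 : c != 0.
  by rewrite -(coordinates_neq0 xC) -E mulf_neq0.
have [n [a' [b' [na' nb' E']]]] :=
  min_size_decomp I_prime I_free (min_size_var kk k0) c0.
have Qt : Q (chi tau).
  have Qc : Q (Th (b' * c)).
    rewrite rmorphM /= -E; apply: (QM); first by apply/AE; apply: ray_mmap.
    exact: QM.
  rewrite E' rmorphM rmorphXn /= ThX in Qc.
  have At' : chart [set j] (chi tau) by case: At.
  have [Qn|Qa] := QP _ _ (subringX (chart_subring [set j]) n At') ((AE _).2 (ray_mmap a')) Qc.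
    elim: n Qn {E' Qc} => [|n IH]; first by rewrite expr0 => /Q1.
    rewrite exprS => /QP[//||//|]; last exact: IH.
    by apply: subringX => //; apply: chart_subring.
  by case: na'; apply/(local_max_mmap xC I_prime); case: (QJ _ Qa).
have Lg := (ray_maxP ((AE _).1 Ag)).1 mg.
have -> : g = chi (- tau) * g * chi tau.
  by rewrite mulrAC -chiD addNr chi0 // mul1r.
apply: QM => //; apply/AE.
apply: (laurentM chiD _ (laurent_chi kap chi (S := [set u | -1 <= pairing u v]) _) Lg).
  by move=> u u' /= Hu Hu'; rewrite pairingD; lia.
by rewrite /= pairingN tau1.
Qed.

End RayRing.

(** * Prime divisors that meet the torus *)

Section Torus.
Variable W : 'M[int]_(q, N).
Local Notation x := (fun i => chi (row i W)).
Local Notation Th := (mmap kap x).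
Hypothesis xC : coordinates kap x.
Hypothesis all_unit : forall a,
  monomial_unit kap chi W (fun p : {mpoly kk[q]} => p = 0) 0 a.
Variables (H : set 'I_M) (p : set F) (up : 'rV[int]_N).
Hypothesis up_gt0 : forall i, H i -> 0 < pj up i.
Hypothesis pH1 : height_one (chart H) p.
Hypothesis nup : ~ p (chi up).

Let A := chart H.
Let O := localization A p.
Let m := localization_max A p.
Let AR : is_subring A. Proof. exact: chart_subring. Qed.
Let pP : prime_ideal A p. Proof. by case: pH1. Qed.
Let OR : is_subring O. Proof. exact: localization_subring. Qed.

Lemma torus_clear f : laurent kap chi setT f ->
  exists w b c, chi w = Th b /\ chi w * f = Th c.
Proof.
move=> Lf; have tauP : (0 : 'cV[int]_N) = 0 \/ pairing 0 (0 : 'cV[int]_N) = 1 by left.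
have p0 u : pairing u (0 : 'cV[int]_N) = 0 by rewrite /pairing mulmx0 mxE.
have tau1 : exists t, chi 0 = Th t by exists 1; rewrite chi0 // rmorph1.
have [|w [b [c [_ wb _ E]]]] :=
    clearable_laurent chi_neq0 chiD (mprime0 kk q) tauP (fun a _ => all_unit a) tau1 (f := f).
  by apply: laurentS Lf => u _; rewrite p0.
by exists w, b, c.
Qed.

Let A_up u : exists n : nat, A (chi (up *+ n) * chi u).
Proof.
have [|n Hn] := chart_eventually (H := H) (w := up) _ (laurent_chi kap chi (S := setT) (u := u) I).
  by move=> u' i _ Hi; left; apply: up_gt0.
by exists n; apply: Hn.
Qed.

Let Aup n : A (chi (up *+ n)).
Proof.
apply: chart_chi => i Hi.
by rewrite -scaler_nat pairingZ mulr_ge0 ?ler0n // ltW // up_gt0.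
Qed.

Let nupn n : ~ p (chi (up *+ n)).
Proof.
have [_ [_ p1] _ _ pM] := pP.
elim: n => [|n IH]; first by rewrite mulr0n chi0.
rewrite mulrS chiD => /pM[|||//]; [|exact: Aup|exact: nup].
by rewrite -[up]mulr1n; apply: Aup.
Qed.

Lemma torus_chi u : O (chi u).
Proof.
have [n Hn] := A_up u; exists (chi (up *+ n) * chi u), (chi (up *+ n)).
by split=> //; rewrite mulrC mulKf.
Qed.

Lemma torus_unit u : unit_of O (chi u).
Proof. by split; rewrite -?(chiN chi_neq0 chiD) //; apply: torus_chi. Qed.

Lemma torus_local f : laurent kap chi setT f -> O f.
Proof.
elim=> [|c u g _ _ IH]; first exact: subring0 OR.
apply: (subringD OR) => //; have [_ _ OM] := OR; apply: OM (torus_chi u).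
apply: localization_sub => //; rewrite -[kap c]mulr1 -(chi0 chi_neq0 chiD).
by apply: laurent_term => j _; rewrite pairing0.
Qed.

Lemma torus_mmap a : laurent kap chi setT (Th a).
Proof.
have [L1 LB LM] := laurent_subring kap chi_neq0 chiD (S := setT) I (fun u w _ _ => I).
elim/mpoly_ring_ind: a => [c|i|a a' Ea Ea'|a a' Ea Ea'].
- rewrite mmapC -[X in laurent _ _ _ X]mulr1 -(chi0 chi_neq0 chiD).
  exact: laurent_term.
- by rewrite mmapX mmap1U; apply: laurent_chi.
- by rewrite rmorphD; apply: laurentD.
- by rewrite rmorphM; apply: LM.
Qed.

Let Om a : O (Th a). Proof. exact/torus_local/torus_mmap. Qed.

Definition torus_prime : {mpoly kk[q]} -> Prop := fun a => m (Th a).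
Local Notation I := torus_prime.

Lemma torus_prime_prime : mprime I.
Proof.
split=> [|a b ma mb|a b mb|a b].
- split.
    by exists 0, 1; case: AR pP => A1 _ _ [_ [p0 p1] _ _ _]; rewrite rmorph0 mul0r.
  by rewrite /torus_prime rmorph1; apply: localization_max1 AR pP.
- by rewrite /torus_prime rmorphD; apply: (localization_maxD AR pP).
- by rewrite /torus_prime rmorphM; apply: (localization_maxM AR pP) (Om a) mb.
- by rewrite /torus_prime rmorphM; apply: (localization_max_prime AR pP) (Om a) (Om b).
Qed.

Let nI_chi w b : chi w = Th b -> ~ I b.
Proof.
by move=> E; rewrite /torus_prime -E; apply: localization_unit_max (torus_unit w).
Qed.

Let A_clear f : A f -> exists w b c, chi w = Th b /\ chi w * f = Th c.
Proof. by move=> Af; apply: torus_clear; apply: laurentS Af. Qed.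

Lemma torus_prime_neq0 : exists2 a, I a & a != 0.
Proof.
have [_ [f pf f0] _] := pH1.
have [pA _ _ _ _] := pP; have Af := pA _ pf.
have [w [b [c [wb E]]]] := A_clear Af.
exists c; last by rewrite -(coordinates_neq0 xC) -E mulf_neq0.
rewrite /torus_prime -E; apply: localization_maxM => //; first exact: torus_chi.
exact/localization_max_sub.
Qed.

(** The height of [p] is only known inside the chart. A prime [J] below the contraction of [p] is
    therefore brought back to the chart, as the set [Q] of functions that some monomial clears to an
    element of [J]; by minimality [Q = p]. *)
Lemma torus_prime_min J : mprime J -> (forall a, J a -> I a) ->
  (exists2 a, J a & a != 0) -> forall a, I a -> J a.
Proof.
move=> J_prime JI [a0 Ja0 a00] a Ia.
have [[J0 J1] JD JM JP] := J_prime.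
have [A1 AB AM] := AR.
have nJ w b : chi w = Th b -> ~ J b by move=> /nI_chi nIb /JI.
pose Q : set F := [set f | A f /\ exists w b c, [/\ chi w = Th b, chi w * f = Th c & J c]]%classic.
(* Membership in [Q] does not depend on the clearing monomial, since polynomials that represent
   monomials are never in [J]. *)
have Qany (f : F) w b c : Q f -> chi w = Th b -> chi w * f = Th c -> J c.
  move=> [_ [w' [b' [c' [wb' E' Jc']]]]] wb E.
  have : J (b' * c).
    have -> : b' * c = b * c'; last exact: JM.
    by apply: (coordinates_inj xC); rewrite !rmorphM /= -wb -wb' -E -E' mulrCA.
  by case/JP => // /(nJ _ _ wb').
have Qp (f : F) : Q f -> p f.
  move=> [Af [w [b [c [wb E /JI mc]]]]].
  apply/(localization_max_sub AR pP Af).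
  rewrite -(mulKf (chi_neq0 w) f) E.
  apply: localization_maxM => //.
  by case: (torus_unit w).
have Q_prime : prime_ideal A Q.
  split.
  - by move=> f [].
  - split.
      split; first exact: subring0 AR.
      by exists 0, 1, 0; rewrite chi0 // mulr0 rmorph0 rmorph1.
    by move=> /Qp; case: pP => _ [].
  - move=> f g [Af [w [b [c [wb E Jc]]]]] [Ag [w' [b' [c' [wb' E' Jc']]]]].
    split; first exact: (subringD AR).
    exists (w + w'), (b * b'), (b' * c + b * c'); split.
    + by rewrite chiD rmorphM /= wb wb'.
    + by rewrite rmorphD !rmorphM /= -wb -wb' -E -E' chiD; ring.
    + by apply: JD; apply: JM.
  - move=> f g Af [Ag [w [b [c [wb E Jc]]]]]; split; first exact: AM.
    have [w' [b' [c' [wb' E']]]] := A_clear Af.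
    exists (w' + w), (b' * b), (c' * c); split; last exact: JM.
    + by rewrite chiD rmorphM /= wb wb'.
    + by rewrite rmorphM /= -E -E' chiD; ring.
  - move=> f g Af Ag Qfg.
    have [w [b [c [wb E]]]] := A_clear Af; have [w' [b' [c' [wb' E']]]] := A_clear Ag.
    have : J (c * c').
      apply: (Qany (f * g) (w + w') (b * b')) => //.
        by rewrite chiD rmorphM /= wb wb'.
      by rewrite rmorphM /= -E -E' chiD; ring.
    by case/JP => Jc; [left|right]; split=> //; [exists w, b, c | exists w', b', c'].
have lift a' : exists n : nat, A (chi (up *+ n) * Th a').
  have [|n Hn] := chart_eventually (H := H) (w := up) _ (torus_mmap a').
    by move=> u' i _ Hi; left; apply: up_gt0.
  by exists n; apply: Hn.
have p_eq : Q = p.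
  have [_ _ pmin] := pH1; apply: pmin => //.
  have [n An] := lift a0; exists (chi (up *+ n) * Th a0); last first.
    by rewrite mulf_neq0 // coordinates_neq0.
  split=> //; have [w [b [c [wb E]]]] := A_clear (Aup n).
  exists w, b, (c * a0); split=> //; last exact: JM.
  by rewrite rmorphM /= -E mulrA.
have [n An] := lift a.
have : Q (chi (up *+ n) * Th a).
  rewrite p_eq; apply/(localization_max_sub AR pP An).
  apply: localization_maxM => //; exact: torus_chi.
have [w [b [c [wb E]]]] := A_clear (Aup n).
have [w' [b' [d [wb' E']]]] := torus_clear (laurent_chi kap chi (S := setT) (u := w + up *+ n) Logic.I).
move=> Qa; have : J (c * a).
  by apply: (Qany _ w b _ Qa wb); rewrite rmorphM /= -E mulrA.
(* Here [c] represents a monomial, so [b' * c] does as well and cannot lie in [J]; what remains is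
   [a] in [J]. *)
case/JP => // Jc; case: (nJ (w' + (w + up *+ n)) d); first by rewrite chiD E'.
have -> : d = b' * c; last exact: JM.
by apply: (coordinates_inj xC); rewrite rmorphM /= -E' -wb' -E chiD.
Qed.

Lemma torus_local_ring : O = local_ring kap x I.
Proof.
have [_ _ OM] := OR.
apply/seteqP; split=> f; last first.
  move=> [a [b [nb ->]]]; apply: OM => //.
  by have [_ _] := localization_unit pP (Om b) nb.
move=> [a [b [Aa Ab nb ->]]].
have [w [d [c [wd E]]]] := A_clear Aa; have [w' [d' [c' [wd' E']]]] := A_clear Ab.
have b0 : b != 0 by apply/eqP => b0; case: nb; rewrite b0; case: pP => _ [].
exists (c * d'), (d * c'); split; last first.
  rewrite !rmorphM /= -E -E' -wd -wd'; field.
  by rewrite b0 !chi_neq0.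
have [_ _ _ IP] := torus_prime_prime.
case/IP; first exact: nI_chi wd.
rewrite /torus_prime -E' => mb; apply: nb; apply/(localization_max_sub AR pP Ab).
rewrite -(mulKf (chi_neq0 w') b); apply: localization_maxM => //.
by case: (torus_unit w').
Qed.

(** The coefficient [kap a * chi e] is a unit and the coordinates are a frame. Since [ord_at] asks
    for a uniformizer even in order zero, one is taken from the contracted prime of height one. *)
Lemma torus_form_ord (w0 : ('I_q -> F -> F) -> F) a e : a != 0 ->
  (forall D : 'I_q -> F -> F, (forall i, derivation k (D i)) ->
    w0 D = kap a * chi e * wedge_d x D) -> form_ord_at k O w0 0.
Proof.
move=> a0 w0E; exists x, (kap a * chi e); split=> //.
  by rewrite torus_local_ring; apply: local_frame => //; apply: torus_prime_prime.
have [l I_free] := height_one_var kk0 torus_prime_prime torus_prime_neq0 torus_prime_min.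
have [pi pi_min] := min_size_exists l torus_prime_neq0.
exists (Th pi), (kap a * chi e); split; last by rewrite expr0z mulr1.
  by rewrite torus_local_ring; exact: (local_uniformizer xC torus_prime_prime I_free pi_min).
apply: unit_ofM => //; last exact: torus_unit.
have Okap b : O (kap b).
  by rewrite -(mmapC x kap b); apply: Om.
by split; rewrite ?fmorph_eq0 // -fmorphV.
Qed.

End Torus.

End Charts.

(** * Prime divisors and the canonical divisor *)

Section Classification.
Variables (F : fieldType) (k : set F) (kk : fieldType).
Variable kap : {rmorphism kk -> F}.
Hypothesis kE : forall x, k x <-> exists a, x = kap a.
Hypothesis kk0 : [pchar kk] =i pred0.
Variables (N M q : nat) (P : 'M[int]_(N, M)).
Variable chi : 'rV[int]_N -> F.
Hypothesis chi_neq0 : forall u, chi u != 0.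
Hypothesis chiD : forall u v, chi (u + v) = chi u * chi v.

Local Notation pj u j := (pairing u (col j P)).
Local Notation mono W := (fun i => chi (row i W)).
Local Notation proportional w0 W a e := (forall D : 'I_q -> F -> F,
  (forall i, derivation k (D i)) ->
  w0 D = kap a * chi e * wedge_d (mono W) D).

Variables (Hs : set (set 'I_M)) (ch : set (set F)).
Hypothesis chE : forall A, ch A <-> exists2 H, Hs H & A = chart kap P chi H.
Hypothesis Hs_ray : forall j, Hs [set j]%classic.
Hypothesis Hs_face : forall H j, Hs H -> H j ->
  exists u, pj u j = 0 /\ forall i, H i -> i <> j -> 0 < pj u i.
Hypothesis Hs_ideal : forall H j f, Hs H -> H j -> chart kap P chi H f ->
  laurent kap chi [set u | 1 <= pj u j] f -> ray_ideal kap P chi H j f.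
Hypothesis separated : forall i j, i != j -> exists u, 0 <= pj u i /\ pj u j < 0.

Variables (W : 'I_M -> 'M[int]_(q, N)) (k0 : 'I_M -> 'I_q).
Local Notation I j := (fun p : {mpoly kk[q]} => kill (k0 j) p = 0).
Hypothesis WC : forall j, coordinates kap (mono (W j)).
Hypothesis W_row : forall j i, pj (row i (W j)) j = (i == k0 j)%:R.
Hypothesis W_perp : forall j a, pj a j = 0 ->
  monomial_unit kap chi (W j) (I j) (col j P) a.

Variable Wt : 'M[int]_(q, N).
Hypothesis WtC : coordinates kap (mono Wt).
Hypothesis Wt_unit : forall a,
  monomial_unit kap chi Wt (fun p : {mpoly kk[q]} => p = 0) 0 a.

Variables (w0 : ('I_q -> F -> F) -> F) (pole : 'I_M -> int).
Hypothesis w0_form : rational_form k w0.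
Hypothesis w0_neq0 : form_neq0 k w0.
Hypothesis w0_ray : forall j, exists a e,
  [/\ a != 0, pj e j = pole j & proportional w0 (W j) a e].
Hypothesis w0_torus : exists a e, a != 0 /\ proportional w0 Wt a e.

Variables (cd van : 'I_M -> set F).
Hypothesis cdE : forall j, cd j = localization (chart kap P chi [set j]) (van j).
Hypothesis van_sub : forall j f, van j f -> chart kap P chi [set j] f /\
  exists e : nat, laurent kap chi [set u | 1 <= pj u j] (f ^+ e).
Hypothesis van_sup : forall j f,
  laurent kap chi [set u | 1 <= pj u j] f -> van j f.

Local Notation O j := (local_ring kap (mono (W j)) (I j)).
Local Notation J H j := (ray_prime kap P chi (W j) (k0 j) H).

Let tau j := row (k0 j) (W j).
Let tau1 j : pj (tau j) j = 1. Proof. by rewrite W_row eqxx. Qed.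

Let I_prime j : mprime (I j). Proof. exact: mprime_kill. Qed.

Let O_sub j : is_subring (O j).
Proof. exact: (local_ring_subring (WC j) (I_prime j)). Qed.

Let ray_localization1 j :
  localization (chart kap P chi [set j]) (J [set j]%classic j) = O j.
Proof.
have ug i : [set j]%classic i -> i <> j -> 0 < pj 0 i by move=> ->.
exact: (ray_localization chi_neq0 chiD (WC j) (W_row j) (W_perp (j := j))
  (erefl _ : [set j]%classic j) (pairing0 (col j P)) ug).
Qed.

(** [van j] only asks that a power of [f] vanish along the ray; then so does [f], as the maximal
    ideal of [O j] is prime. Conversely [ray_maxP] provides positive exponents for a function in
    that ideal. *)
Lemma coord_divisorE j : cd j = O j.
Proof.
rewrite cdE -ray_localization1; congr (localization _ _); apply/seteqP; split=> f.
  move=> /van_sub[Af [e Le]]; split=> //.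
  have Of : O j f.
    apply: (ray_local chi_neq0 chiD (W_row j) (W_perp (j := j))).
    by apply: laurentS Af => u; apply.
  have Lge : laurent kap chi [set u | 0 <= pj u j] (f ^+ e).
    by apply: laurentS Le => u /= ?; lia.
  have := (ray_maxP chi_neq0 chiD (WC j) (W_row j) (W_perp (j := j)) Lge).2 Le.
  elim: e {Le Lge} => [|e IH]; first by rewrite expr0 => /(local_max1 (WC j) (I_prime j)).
  have Ofe := subringX (O_sub j) e Of.
  by rewrite exprS => /(local_max_prime (WC j) (I_prime j) Of Ofe)[|/IH].
move=> [Af mf]; apply: van_sup.
apply/(ray_maxP chi_neq0 chiD (WC j) (W_row j) (W_perp (j := j))) => //.
by apply: laurentS Af => u; apply.
Qed.

Lemma coord_prime_divisor j : prime_divisor ch (cd j).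
Proof.
exists (chart kap P chi [set j]), (J [set j]%classic j); split.
- by apply/chE; exists [set j]%classic.
- exact: (ray_height_one chi_neq0 chiD (WC j) (W_row j) (W_perp (j := j))).
by rewrite coord_divisorE ray_localization1.
Qed.

Let ninv j : ~ cd j (chi (- tau j)).
Proof.
rewrite coord_divisorE => Oi.
exact: (ray_inv_tau chi_neq0 chiD (WC j) Oi).
Qed.

(** A monomial regular along [i] and of negative order along [j] would, if the local rings agreed,
    make the inverse of the uniformizer [chi (tau j)] regular along [j]. *)
Lemma coord_divisor_inj : injective cd.
Proof.
move=> i j ij; apply/eqP; apply: contraT => /separated[u [ui uj]].
have [] := ninv (j := j).
have Ou : cd j (chi u).
  rewrite -ij coord_divisorE.
  by apply: (ray_local chi_neq0 chiD (W_row i) (W_perp (j := i))); apply: laurent_chi.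
rewrite -[- tau j](subrK u) chiD; have [_ _ OM] := O_sub j.
move: Ou; rewrite coord_divisorE => Ou; apply: OM Ou.
apply: (ray_local chi_neq0 chiD (W_row j) (W_perp (j := j))); apply: laurent_chi => /=.
by rewrite pairingD !pairingN tau1; lia.
Qed.

Lemma coord_form_ord j : form_ord_at k (cd j) w0 (pole j).
Proof.
have [a [e [a0 ej w0E]]] := w0_ray j; rewrite coord_divisorE.
exists (mono (W j)), (kap a * chi e); split=> //; first exact: local_frame.
rewrite -ej; apply: ord_at_unitM (ray_ord chi_neq0 chiD (WC j) (W_row j) (W_perp (j := j)) e) => //.
have Okap b : O j (kap b).
  by rewrite -(mmapC (mono (W j)) kap b); apply: local_ring_mmap.
by split; rewrite ?fmorph_eq0 // -fmorphV.
Qed.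

Lemma positive_functional H : Hs H -> exists u, forall i, H i -> 0 < pj u i.
Proof.
move=> HH.
have /choice[uf ufP] : forall j, exists u, H j ->
    pj u j = 0 /\ forall i, H i -> i <> j -> 0 < pj u i.
  move=> j; have [Hj|nHj] := pselect (H j); last by exists 0.
  by have [u uP] := Hs_face HH Hj; exists u.
(* At the ray [i], the summand of [i] contributes $1$. In every other summand [uf j] is at least
   $1$, and [B] is large enough to outweigh [tau j]. *)
pose B := (1 + \sum_i \sum_j `|pj (tau j) i|)%N.
exists (\sum_(j | `[< H j >]) (uf j *+ B + tau j)) => i Hi.
rewrite pairing_sum (bigD1 i) /=; last exact/asboolP.
rewrite pairingD -scaler_nat pairingZ (ufP i Hi).1 mulr0 add0r tau1.
apply: ltr_pwDl => //; apply: sumr_ge0 => j /andP[/asboolP Hj ji].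
have uji : 0 < pj (uf j) i by apply: (ufP j Hj).2 => //; apply/eqP; rewrite eq_sym.
have : (`|pj (tau j) i| < B)%N.
  by rewrite /B add1n ltnS (bigD1 i) //= (bigD1 j) //= -addnA leq_addr.
by rewrite pairingD -scaler_nat pairingZ natz; nia.
Qed.

Lemma ray_ideal_prod H (f : 'I_M -> F) : (forall j, H j -> ray_ideal kap P chi H j (f j)) ->
  laurent kap chi [set u | forall j, H j -> 1 <= pj u j]
    (\prod_(j | `[< H j >]) f j).
Proof.
move=> fH; pose S (s : seq 'I_M) := [set u | dual_cone P H u /\ forall j, j \in s -> H j -> 1 <= pj u j]%classic.
suff : laurent kap chi (S (index_enum 'I_M)) (\prod_(j | `[< H j >]) f j).
  by apply: laurentS => u [_ Su] j Hj; apply: Su => //; rewrite mem_index_enum.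
elim: (index_enum _) => [|j s IH].
  rewrite big_nil -(chi0 chi_neq0 chiD); apply: laurent_chi.
  by split=> // j _; rewrite pairing0.
rewrite big_cons; case: asboolP => [Hj|nHj]; last first.
  apply: laurentS IH => u [du Su]; split=> // i.
  by rewrite inE => /orP[/eqP-> /nHj//|]; apply: Su.
apply: (laurentM chiD _ (fH j Hj) IH) => u u' [du uj] [du' Su']; split=> i.
  by move=> Hi; rewrite pairingD addr_ge0 ?du ?du'.
rewrite inE pairingD => /orP[/eqP-> _|si Hi].
  by rewrite ler_wpDr // du'.
by rewrite ler_wpDl ?Su' // du.
Qed.

(* Let [up] be positive on all rays of the chart.  If the prime avoids
   [chi up], then all monomials are invertible in its local ring.  Otherwise it
   contains a power of the product of the ray ideals, hence one of them. *)
Lemma prime_divisor_cases Od : prime_divisor ch Od ->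
  (exists j, Od = cd j) \/
  (form_ord_at k Od w0 0 /\ forall j, Od <> cd j).
Proof.
move=> [A [p [/chE[H HH ->] pH1 ->]]].
have [pP [f0 pf0 f00] pmin] := pH1.
have [pA [_ p1] _ pM pprime] := pP.
have AR := chart_subring kap P chi_neq0 chiD H.
have [A1 _ AM] := AR.
have [up up_gt0] := positive_functional HH.
have Aup : chart kap P chi H (chi up) by apply: chart_chi => i /up_gt0/ltW.
have [pup|nup] := pselect (p (chi up)); last first.
  right; split.
    have [a [e [a0 w0E]]] := w0_torus.
    exact: (torus_form_ord kE kk0 chi_neq0 chiD WtC Wt_unit up_gt0 pH1 nup a0 w0E).
  move=> j E; case: (ninv (j := j)); rewrite -E.
  exact: (torus_chi chi_neq0 chiD up_gt0 pH1 nup).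
left; have [j Hj Jp] : exists2 j, H j & forall f, ray_ideal kap P chi H j f -> p f.
  apply: contrapT => nex.
  have /choice[f fP] : forall j, exists f, H j -> ray_ideal kap P chi H j f /\ ~ p f.
    move=> j; have [Hj|nHj] := pselect (H j); last by exists 0.
    have [//|] := pselect (forall f, ray_ideal kap P chi H j f -> p f).
      by move=> h; case: nex; exists j.
    by move=> /existsNP[f /not_implyP[If npf]]; exists f.
  have Ax j : H j -> chart kap P chi H (f j).
    by move=> /fP[If _]; apply: laurentS If => u [].
  pose g := \prod_(j | `[< H j >]) f j.
  have Ag : chart kap P chi H g.
    apply: (big_ind (chart kap P chi H)) => //.
    by move=> j /asboolP/Ax.
  have npg : ~ p g.
    have : chart kap P chi H g /\ ~ p g; last by case.
    apply: (big_ind (fun y => chart kap P chi H y /\ ~ p y)) => //.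
      move=> x y [Hx nx] [Hy ny]; split; first exact: AM.
      by move=> /pprime[].
    by move=> j /asboolP Hj; split; [apply: Ax | case: (fP j Hj)].
  have Lg := ray_ideal_prod (fun j Hj => (fP j Hj).1).
  (* [n] bounds the orders of [chi up] along all rays, so [g ^+ n / chi up] is still regular on the
     chart and [g ^+ n] lies in [p]. *)
  pose n := (\sum_j `|pj up j|)%N.
  have Lgn : laurent kap chi [set u | forall j, H j -> n%:Z <= pj u j] (g ^+ n).
    elim: n => [|n IH].
      rewrite expr0 -(chi0 chi_neq0 chiD); apply: laurent_chi.
      by move=> j _; rewrite pairing0.
    rewrite exprS; apply: (laurentM chiD _ Lg IH) => u u' Hu Hu' j Hj.
    by rewrite pairingD intS lerD ?Hu ?Hu'.
  have pgn : p (g ^+ n).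
    have -> : g ^+ n = chi (- up) * g ^+ n * chi up.
      by rewrite mulrAC -chiD addNr (chi0 chi_neq0 chiD) mul1r.
    apply: pM => //.
    apply: (laurentM chiD _ (laurent_chi kap chi (S := [set - up]%classic) (erefl _)) Lgn).
    move=> _ u -> Hu j Hj; rewrite pairingD pairingN.
    have : (`|pj up j| <= n)%N by rewrite /n (bigD1 j) //= leq_addr.
    by have := Hu j Hj; lia.
  elim: n pgn {Lgn} => [|n IH]; first by rewrite expr0.
  by rewrite exprS => /pprime[//||//|//]; apply: subringX.
exists j; have [u [uj0 uj]] := Hs_face HH Hj.
have Jprime := ray_prime_prime chi_neq0 chiD (WC j) (W_row j) (W_perp (j := j)) Hj.
have <- : J H j = p.
  apply: pmin => //.
    move=> f [Af mf]; apply: Jp; apply: Hs_ideal => //.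
    apply/(ray_maxP chi_neq0 chiD (WC j) (W_row j) (W_perp (j := j))) => //.
    by apply: laurentS Af => w; apply.
  exists (chi up) => //; split=> //.
  apply/(ray_maxP chi_neq0 chiD (WC j) (W_row j) (W_perp (j := j))).
    by apply: laurent_chi; apply/ltW/up_gt0.
  by apply: laurent_chi => /=; have := up_gt0 j Hj; lia.
rewrite coord_divisorE.
exact: (ray_localization chi_neq0 chiD (WC j) (W_row j) (W_perp (j := j)) Hj uj0 uj).
Qed.

Definition pole_divisor (Od : set F) : int :=
  \sum_(j < M) (if `[< Od = cd j >] then pole j else 0).

Lemma pole_divisor_coord j : pole_divisor (cd j) = pole j.
Proof.
rewrite /pole_divisor (bigD1 j) //= asboolT // big1 ?addr0 // => i ij.
by rewrite asboolF // => /coord_divisor_inj ji; rewrite ji eqxx in ij.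
Qed.

Lemma pole_divisor_form_ord Od : prime_divisor ch Od ->
  form_ord_at k Od w0 (pole_divisor Od).
Proof.
move=> /prime_divisor_cases[[j ->]|[w0O nO]].
  by rewrite pole_divisor_coord; apply: coord_form_ord.
by rewrite /pole_divisor big1 // => j _; rewrite asboolF.
Qed.

Lemma pole_divisor_canonical : canonical_divisor k ch q pole_divisor.
Proof.
have supp Od : pole_divisor Od != 0 -> exists j, Od = cd j.
  move=> D0; apply: contrapT => nex; case/eqP: D0.
  by rewrite /pole_divisor big1 // => j _; rewrite asboolF // => e; apply: nex; exists j.
split; first split.
- apply: (@sub_finite_set _ _ (range cd)).
    by move=> Od /= /supp[j ->]; exists j.
  by apply: finite_image; exact: finite_finset.
- by move=> Od /supp[j ->]; apply: coord_prime_divisor.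
- by exists w0; split=> // Od; apply: pole_divisor_form_ord.
Qed.

(** The variable [j0] only supplies one prime divisor. Comparing the two forms there yields their
    quotient [h], whose order at any prime divisor is then the difference of the two orders. *)
Lemma canonical_lin_equiv (j0 : 'I_M) D : canonical_divisor k ch q D ->
  lin_equiv ch D pole_divisor.
Proof.
move=> [_ [w [wform w_neq0 wD]]].
have OR Od : prime_divisor ch Od -> is_subring Od.
  move=> [A [p [/chE[H _ ->] [pP _ _] ->]]].
  by apply: localization_subring => //; apply: chart_subring.
have pd0 := coord_prime_divisor j0.
have [h hE] := form_ord_proportional w0_neq0 (wD _ pd0) (pole_divisor_form_ord pd0).
exists h.
  have [T TD wT] := w_neq0.
  by apply: contraNneq wT => h0; rewrite hE // h0 mul0r.
move=> Od pd.
exact: (form_ord_ratio (OR _ pd) w_neq0 hE (wD _ pd) (pole_divisor_form_ord pd)).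
Qed.

End Classification.

(** * The grading by the divisor class group *)

Section Grading.
Variables (N M : nat) (P : 'M[int]_(N, M)).
Implicit Types (a b : 'rV[int]_M) (m e : 'X_{1..M}).

Definition mnm_row m : 'rV[int]_M := \row_i (m i)%:Z.

Lemma mnm_rowD m e : mnm_row (m + e)%MM = mnm_row m + mnm_row e.
Proof. by apply/rowP => i; rewrite !mxE mnmDE. Qed.

Lemma projQ_eq a b : projQ P a = projQ P b <-> exists u, a - b = u *m P.
Proof.
split=> [E|[u E]].
  have : a - b \in im_dual P by rewrite Quotient.idealrBE; apply/eqP.
  by move=> /asboolP.
apply/eqP; rewrite -Quotient.idealrBE; apply/asboolP; by exists u.
Qed.

Lemma projQD a b : projQ P (a + b) = projQ P a + projQ P b.
Proof. exact: Quotient.pi_add. Qed.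

Lemma projQ0 : projQ P 0 = 0.
Proof. by apply: (addrI (projQ P 0)); rewrite -projQD !addr0. Qed.

Lemma projQN a : projQ P (- a) = - projQ P a.
Proof. by apply: (addrI (projQ P a)); rewrite -projQD !subrr projQ0. Qed.

Lemma mdegQD m e : mdegQ P (m + e)%MM = mdegQ P m + mdegQ P e.
Proof. by rewrite /mdegQ -projQD; congr projQ; apply: mnm_rowD. Qed.

Lemma mdegQ_eq m e : mdegQ P m = mdegQ P e <->
  exists u, mnm_row m - mnm_row e = u *m P.
Proof. exact: projQ_eq. Qed.

Variable kk : fieldType.
Implicit Types (p g : {mpoly kk[M]}) (w v : grading_group P).

Definition component w p : {mpoly kk[M]} :=
  \sum_(e <- msupp p | mdegQ P e == w) p@_e *: 'X_[e].

Lemma mcoeff_component w p e :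
  (component w p)@_e = if mdegQ P e == w then p@_e else 0.
Proof.
rewrite /component raddf_sum /=.
have [ep|nep] := boolP (e \in msupp p); last first.
  rewrite (memN_msupp_eq0 nep) if_same big_seq_cond big1 // => e' /andP[e'p _].
  rewrite mcoeffZ mcoeffX; case: eqP => [ee'|_]; last by rewrite mulr0.
  by rewrite -ee' e'p in nep.
rewrite big_mkcond (bigD1_seq e) //= big1 ?addr0 => [|e' e'e].
  by case: ifP => // _; rewrite mcoeffZ mcoeffX eqxx mulr1.
by case: ifP => // _; rewrite mcoeffZ mcoeffX (negPf e'e) mulr0.
Qed.

Lemma component_homogeneous w p : homogeneous (component w p) w.
Proof.
move=> e; rewrite mcoeff_msupp mcoeff_component.
by case: (mdegQ P e =P w) => // _; rewrite eqxx.
Qed.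

Lemma component_id w p : homogeneous p w -> component w p = p.
Proof.
move=> hp; apply/mpolyP => e; rewrite mcoeff_component.
case: eqP => // ew; apply/esym/eqP; rewrite mcoeff_eq0.
by apply/negP => /hp.
Qed.

Lemma componentD w p g : component w (p + g) = component w p + component w g.
Proof.
apply/mpolyP => e; rewrite mcoeffD !mcoeff_component mcoeffD.
by case: ifP => // _; rewrite addr0.
Qed.

Lemma component0 w : component w 0 = 0.
Proof. by apply/mpolyP => e; rewrite mcoeff_component mcoeff0 if_same. Qed.

Lemma componentZ w c p : component w (c *: p) = c *: component w p.
Proof.
apply/mpolyP => e; rewrite mcoeffZ !mcoeff_component mcoeffZ.
by case: ifP => // _; rewrite mulr0.
Qed.

Lemma component_sum I (s : seq I) (Q : pred I) (f : I -> {mpoly kk[M]}) w :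
  component w (\sum_(i <- s | Q i) f i) = \sum_(i <- s | Q i) component w (f i).
Proof. exact: (big_morph _ (componentD w) (component0 w)). Qed.

Lemma componentMX w m p :
  component w ('X_[m] * p) = 'X_[m] * component (w - mdegQ P m) p.
Proof.
apply/mpolyP => e; rewrite mcoeff_component mulrC [X in _ = X@_e]mulrC.
have [me|nme] := boolP (m <= e)%MM.
  rewrite -(submK me) addmC; move: (e - m)%MM => e'.
  rewrite !mcoeffMX mcoeff_component mdegQD.
  by rewrite -[w in LHS](subrK (mdegQ P m)) [w - _ + _]addrC (inj_eq (addrI _)).
have nX g : (g * 'X_[m])@_e = 0.
  apply: memN_msupp_eq0; rewrite (perm_mem (msuppMX _ _)).
  by apply: contraNN nme => /mapP[e' _ ->]; apply: lem_addr.
by rewrite !nX if_same.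
Qed.

Lemma componentM v w g p : homogeneous g v ->
  component w (g * p) = g * component (w - v) p.
Proof.
move=> hg; rewrite {1}(mpolyE g) [in RHS](mpolyE g) !mulr_suml component_sum.
rewrite [LHS]big_seq [RHS]big_seq; apply: eq_bigr => e eg.
by rewrite -!scalerAl componentZ componentMX (hg e eg).
Qed.

Lemma homogeneousM v w g p : homogeneous g v -> homogeneous p w ->
  homogeneous (g * p) (v + w).
Proof.
move=> hg hp; have -> : g * p = component (v + w) (g * p).
  by rewrite (componentM _ _ hg) addrC addKr component_id.
exact: component_homogeneous.
Qed.

Lemma homogeneousX m : homogeneous ('X_[m] : {mpoly kk[M]}) (mdegQ P m).
Proof. by move=> e; rewrite msuppX inE => /eqP ->. Qed.

Lemma homogeneousC c : homogeneous (c%:MP : {mpoly kk[M]}) (0 : grading_group P).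
Proof.
move=> e; rewrite msuppC; case: ifP => // _; rewrite inE => /eqP ->.
apply: (addrI (mdegQ P 0)); rewrite -mdegQD addr0; congr mdegQ.
exact: addm0.
Qed.

Lemma homogeneousD w p g : homogeneous p w -> homogeneous g w ->
  homogeneous (p + g) w.
Proof.
by move=> hp hg e /msuppD_le; rewrite mem_cat => /orP[/hp|/hg].
Qed.

End Grading.

Arguments component {N M} P {kk} w p.
Arguments homogeneousX {N M} P {kk} m e _.

Lemma addf_common (K : fieldType) (c b a e p m : K) : e != 0 -> m != 0 ->
  c * (b * a / e) + b * p / m = b * (c * (a * m) + p * e) / (e * m).
Proof. by move=> e0 m0; field; rewrite e0 m0. Qed.

Lemma div_common (K : fieldType) (a b c : K) : b != 0 -> c != 0 ->
  a / c = a / b / (c / b).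
Proof. by move=> b0 c0; field; rewrite b0 c0. Qed.

(** * Charts of the quotient *)

Section Cox.
Variables (N M : nat) (P : 'M[int]_(N, M)).
Variables (kk : fieldType) (R : idomainType).
Variable pr : {rmorphism {mpoly kk[M]} -> R}.
Variables (F : fieldType) (io : {rmorphism F -> {fraction R}}).
Hypothesis F_funs : is_function_field P pr io.
Hypothesis var_neq0 : forall h, pr 'X_h != 0.
Hypothesis pr_component : forall w p, pr p = 0 -> pr (component P w p) = 0.
(** Each variable is a nonzero divisor modulo any other one; this takes the place of the primality
    of the variables in the Cox ring. *)
Hypothesis var_regular : forall j h p p', h != j ->
  pr ('X_h * p) = pr ('X_j * p') -> exists p'', pr p = pr ('X_j * p'').

Definition cls (p : {mpoly kk[M]}) : {fraction R} := FracField.tofrac (pr p).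

Lemma clsD p p' : cls (p + p') = cls p + cls p'.
Proof. by rewrite /cls !rmorphD. Qed.

Lemma clsM p p' : cls (p * p') = cls p * cls p'.
Proof. by rewrite /cls !rmorphM. Qed.

Lemma cls0 : cls 0 = 0.
Proof. by rewrite /cls !rmorph0. Qed.

Lemma cls1 : cls 1 = 1.
Proof. by rewrite /cls !rmorph1. Qed.

Lemma cls_eq p p' : cls p = cls p' <-> pr p = pr p'.
Proof.
split=> [E|E]; last by rewrite /cls E.
by apply/eqP; rewrite -tofrac_eq; apply/eqP.
Qed.

Lemma cls_neq0 p : (cls p != 0) = (pr p != 0).
Proof. by rewrite /cls tofrac_eq0. Qed.

Lemma clsX_neq0 m : cls 'X_[m] != 0.
Proof.
rewrite cls_neq0 mpolyXE_id rmorph_prod /=; apply/prodf_neq0 => h _.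
by rewrite rmorphXn expf_neq0.
Qed.

Lemma io_inj f g : io f = io g -> f = g.
Proof. exact: fmorph_inj. Qed.

Lemma scalars_exist : exists kap : {rmorphism kk -> F},
  forall a, io (kap a) = cls a%:MP.
Proof.
have /choice[kap kapE] : forall a, exists f, io f = cls a%:MP.
  move=> a; apply/F_funs; exists a%:MP, 1, 0; split.
  - exact: homogeneousC.
  - by rewrite -mpolyC1; apply: homogeneousC.
  - by rewrite rmorph1 oner_neq0.
  - by rewrite -/(cls _) -/(cls _) cls1 divr1.
have kB : zmod_morphism kap.
  by move=> a b; apply: io_inj; rewrite rmorphB !kapE /cls !rmorphB.
have kM : monoid_morphism kap.
  split=> [|a b]; apply: io_inj; first by rewrite kapE mpolyC1 cls1 rmorph1.
  by rewrite rmorphM !kapE mpolyCM clsM.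
pose kapB := GRing.isZmodMorphism.Build kk F kap kB.
pose kapM := GRing.isMonoidMorphism.Build kk F kap kM.
pose K : {rmorphism kk -> F} := HB.pack kap kapB kapM.
by exists K.
Qed.

Definition laurent_cls (a : 'rV[int]_M) : {fraction R} :=
  \prod_h cls 'X_h ^ a 0 h.

Lemma laurent_cls_neq0 a : laurent_cls a != 0.
Proof. by apply/prodf_neq0 => h _; rewrite expfz_neq0 // clsX_neq0. Qed.

Lemma laurent_clsD a b : laurent_cls (a + b) = laurent_cls a * laurent_cls b.
Proof.
rewrite /laurent_cls -big_split; apply: eq_bigr => h _.
by rewrite mxE expfzDr // clsX_neq0.
Qed.

Lemma cls_mnm m : cls 'X_[m] = laurent_cls (mnm_row m).
Proof.
rewrite /cls mpolyXE_id !rmorph_prod; apply: eq_bigr => h _.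
by rewrite mxE !rmorphXn.
Qed.

Lemma laurent_cls_frac m e a : mnm_row m - mnm_row e = a ->
  laurent_cls a = cls 'X_[m] / cls 'X_[e].
Proof.
move=> <-; apply: (mulIf (clsX_neq0 e)); rewrite divfK ?clsX_neq0 //.
by rewrite !cls_mnm -laurent_clsD subrK.
Qed.

(** On [C] the denominator [e] is trivial; elsewhere it is chosen so large that the numerator keeps
    nonnegative exponents even after the factor [b0] is split off. *)
Lemma mnm_row_parts (a : 'rV[int]_M) (b0 : 'X_{1..M}) (C : pred 'I_M) :
  (forall h, C h -> (b0 h)%:Z <= a 0 h) ->
  exists m e, [/\ mnm_row (b0 + m)%MM - mnm_row e = a & forall h, C h -> e h = 0%N].
Proof.
move=> Ca; pose e := [multinom (if C h then 0%N else `|a 0%R h| + b0 h)%N | h < M].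
exists [multinom `|(a 0 h + (e h)%:Z - (b0 h)%:Z)%R|%N | h < M], e.
split=> [|h Ch]; last by rewrite mnmE Ch.
apply/rowP => h; rewrite !mxE mnmDE /e !mnmE.
by case: ifP => [/Ca|_]; move: (a 0 h) => ah; lia.
Qed.

Lemma monomials_exist : exists chi : 'rV[int]_N -> F,
  forall u, io (chi u) = laurent_cls (u *m P).
Proof.
suff /choice[chi chiE] : forall u : 'rV[int]_N, exists f, io f = laurent_cls (u *m P).
  by exists chi.
move=> u; have [|m [e [E _]]] := @mnm_row_parts (u *m P) 0%MM pred0; first by [].
rewrite add0m in E; rewrite (laurent_cls_frac E); apply/F_funs.
exists 'X_[m], 'X_[e], (mdegQ P e); split=> //.
- have <- : mdegQ P m = mdegQ P e by apply/mdegQ_eq; exists u.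
  exact: homogeneousX.
- exact: homogeneousX.
- by rewrite -cls_neq0 clsX_neq0.
Qed.

Section Coordinates.
Variable kap : {rmorphism kk -> F}.
Hypothesis kapE : forall a, io (kap a) = cls a%:MP.
Variable chi : 'rV[int]_N -> F.
Hypothesis chiE : forall u, io (chi u) = laurent_cls (u *m P).

Lemma constantsE f : constants pr io f <-> exists a, f = kap a.
Proof.
split=> [[a fa]|[a ->]]; exists a; last exact: kapE.
by apply: io_inj; rewrite kapE.
Qed.

Lemma cox_chi_neq0 u : chi u != 0.
Proof. by rewrite -(fmorph_eq0 io) chiE laurent_cls_neq0. Qed.

Lemma cox_chiD u v : chi (u + v) = chi u * chi v.
Proof. by apply: io_inj; rewrite rmorphM !chiE mulmxDl laurent_clsD. Qed.

(** Every monomial of [p] has the degree of [m], so the difference of their exponents is in the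
    image of the transpose of [P] and the quotient is a [chi u]. *)
Lemma homogeneous_laurent p m : homogeneous p (mdegQ P m) -> exists2 f,
  laurent kap chi [set u | exists2 e, e \in msupp p &
    forall h, (u *m P) 0 h = (e h)%:Z - (m h)%:Z] f &
  io f = cls p / cls 'X_[m].
Proof.
set S := [set u | _]%classic => hp; rewrite [X in cls X]mpolyE.
have : {subset msupp p <= msupp p} by [].
(* Only the range of the sum and its inclusion in the support are generalized; [S] still refers to
   the whole support. *)
move: {1 3}(msupp p) => s.
elim: s => [|e s IH] sp.
  by exists 0; [exact: laurent0 | rewrite big_nil cls0 mul0r rmorph0].
have [|f Lf ioE] := IH; first by move=> e' e's; apply: sp; rewrite inE e's orbT.
have ep : e \in msupp p by apply: sp; rewrite mem_head.
have [u uE] := (mdegQ_eq P e m).1 (hp e ep).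
exists (kap p@_e * chi u + f).
  apply: laurent_cons => //; exists e => // h.
  by rewrite -uE !mxE.
rewrite rmorphD rmorphM kapE chiE ioE big_cons clsD mulrDl -mul_mpolyC clsM.
by rewrite (laurent_cls_frac uE) mulrA.
Qed.

(** The factor [b0] records vanishing: with [b0] zero this describes functions on a chart, with
    [U_(j)] it shows a numerator divisible by the [j]-th variable. *)
Lemma laurent_fraction (b0 : 'X_{1..M}) (C : pred 'I_M) f :
  laurent kap chi [set u | forall h, C h -> (b0 h)%:Z <= (u *m P) 0 h] f ->
  exists p m, [/\ homogeneous ('X_[b0] * p) (mdegQ P m),
    forall h, C h -> m h = 0%N & io f = cls ('X_[b0] * p) / cls 'X_[m]].
Proof.
elim=> [|c u g Su _ [p [m [hp mC ioE]]]].
  exists 0, 0%MM; rewrite mulr0 cls0 mul0r rmorph0; split=> //.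
    by move=> e; rewrite -mpolyC0 msuppC eqxx.
  by move=> h _; rewrite mnm0E.
have [m' [e [E eC]]] := mnm_row_parts Su.
exists (c%:MP * 'X_[m' + m] + p * 'X_[e]), (e + m)%MM; split.
- rewrite mulrDr mulrA [_ * c%:MP]mulrC -!mulrA -mpolyXD; apply: homogeneousD.
    rewrite -[mdegQ _ _]add0r; apply: homogeneousM; first exact: homogeneousC.
    have -> : mdegQ P (e + m) = mdegQ P (b0 + (m' + m))%MM; last exact: homogeneousX.
    apply/esym/mdegQ_eq; exists u; rewrite -E addmA !mnm_rowD.
    by apply/rowP => h; rewrite !mxE; lia.
  by rewrite mulrA mdegQD addrC; apply: homogeneousM => //; apply: homogeneousX.
- by move=> h Ch; rewrite mnmDE eC // mC.
rewrite rmorphD rmorphM kapE chiE ioE (laurent_cls_frac E).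
have -> : cls ('X_[b0] * (c%:MP * 'X_[m' + m] + p * 'X_[e])) =
    cls 'X_[b0] * (cls c%:MP * (cls 'X_[m'] * cls 'X_[m]) + cls p * cls 'X_[e]).
  by rewrite clsM clsD clsM mpolyXD [cls (_ * 'X_[m])]clsM [cls (p * _)]clsM.
rewrite [cls ('X_[b0] * p)]clsM !mpolyXD [cls ('X_[b0] * _)]clsM [cls ('X_[e] * _)]clsM.
by apply: addf_common; apply: clsX_neq0.
Qed.

Lemma chart_ringE C :
  chart_ring P pr io C = chart kap P chi [set j | C (ratcol P j)].
Proof.
apply/seteqP; split=> f.
  move=> [p [m [hp mC ioE]]].
  have [g Lg ioE'] := homogeneous_laurent hp.
  have -> : f = g by apply: io_inj; rewrite ioE ioE'.
  apply: laurentS Lg => u [e _ uE] j Cj.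
  by rewrite pairing_col uE mC // subr0.
move=> Lf; have [|p [m [hp mC ioE]]] :=
    laurent_fraction (b0 := 0%MM) (C := fun j => `[< C (ratcol P j) >]) (f := f).
  by apply: laurentS Lf => u Hu h /asboolP/Hu; rewrite pairing_col mnm0E.
rewrite mpolyX0 mul1r in hp ioE.
by exists p, m; split=> // h /asboolP/mC.
Qed.

Lemma cox_generate f : exists a b,
  [/\ laurent kap chi setT a, laurent kap chi setT b, b != 0 & f = a / b].
Proof.
have [p [p' [w [hp hp' p'0 ioE]]]] := (F_funs (io f)).1 (ex_intro _ f (erefl _)).
have p'n0 : p' != 0 by apply: contraNneq p'0 => ->; rewrite rmorph0.
have wE := hp' _ (mlead_supp p'n0); set e := mlead p' in wE.
rewrite -wE in hp hp'.
have [a La aE] := homogeneous_laurent hp; have [b Lb bE] := homogeneous_laurent hp'.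
have b0 : b != 0.
  by rewrite -(fmorph_eq0 io) bE mulf_neq0 ?invr_eq0 ?clsX_neq0 // cls_neq0.
exists a, b; split=> //; try by [apply: laurentS La | apply: laurentS Lb].
apply: io_inj; rewrite ioE fmorph_div /= aE bE -/(cls _) -/(cls _).
by apply: div_common; rewrite ?clsX_neq0 // cls_neq0.
Qed.

Lemma homogeneous_quotient j (w : grading_group P) p p' : homogeneous p w ->
  pr p = pr ('X_j * p') -> exists2 p'', homogeneous ('X_j * p'') w &
    pr p = pr ('X_j * p'').
Proof.
move=> hp E; exists (component P (w - mdegQ P U_(j)) p').
  rewrite -[X in homogeneous _ X](subrK (mdegQ P U_(j))) [X in homogeneous _ X]addrC.
  by apply: homogeneousM; [apply: homogeneousX | apply: component_homogeneous].
have := pr_component w (p := p - 'X_j * p'); rewrite rmorphB E subrr => /(_ erefl).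
rewrite -scaleN1r componentD componentZ component_id //.
rewrite (componentM _ _ (homogeneousX P U_(j)%MM)) rmorphD scaleN1r rmorphN.
by rewrite -E => /eqP; rewrite subr_eq0 => /eqP.
Qed.

(** The fraction given for [f ^+ e] need not be homogeneous. Comparing it with a homogeneous one in
    [R] shows that the homogeneous numerator becomes a multiple of ['X_j], and the homogeneous
    component of the quotient gives exponents positive on [j]. *)
Lemma vanishing_sub j f : vanishing_ideal P pr io (ray (ratcol P j)) j f ->
  chart_ring P pr io (ray (ratcol P j)) f /\
  exists e : nat, laurent kap chi [set u | 1 <= pairing u (col j P)] (f ^+ e).
Proof.
set C := ray _ => -[Cf [e [p [m [mC E]]]]]; split=> //; exists e.
have Cj : C (ratcol P j) by exists 1; rewrite ?ler01 ?scale1r.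
have : chart_ring P pr io C (f ^+ e).
  rewrite chart_ringE in Cf *; apply: subringX => //.
  exact: (chart_subring kap P cox_chi_neq0 cox_chiD).
move=> [p' [m' [hp' m'C E']]].
have : cls (p' * 'X_[m]) = cls ('X_j * (p * 'X_[m'])).
  rewrite mulrA !clsM; apply/eqP; rewrite -eqr_div ?clsX_neq0 // -clsM.
  by rewrite -E' rmorphXn; apply/eqP.
move=> /cls_eq/(homogeneous_quotient (homogeneousM hp' (homogeneousX P m)))[p''].
rewrite -mdegQD => hp'' Epr; have [g Lg gE] := homogeneous_laurent hp''.
have -> : f ^+ e = g.
  apply: io_inj; rewrite gE -((cls_eq _ _).2 Epr) E' mpolyXD !clsM.
  by rewrite -mulf_div divff ?clsX_neq0 // mulr1.
apply: laurentS Lg => u [a ap uE] /=; rewrite pairing_col uE mnmDE m'C // mC // subr0.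
move: ap; rewrite mulrC (perm_mem (msuppMX _ _)) => /mapP[b _ ->].
by rewrite mnmDE mnm1E eqxx.
Qed.

Lemma vanishing_sup j f : (forall h, ray (ratcol P j) (ratcol P h) -> h = j) ->
  laurent kap chi [set u | 1 <= pairing u (col j P)] f ->
  vanishing_ideal P pr io (ray (ratcol P j)) j f.
Proof.
move=> ray_j Lf; split.
  rewrite chart_ringE; apply: laurentS Lf => u Hu h /= /ray_j ->.
  exact: le_trans Hu.
have [|p [m [_ mC E]]] := laurent_fraction (b0 := U_(j)%MM) (C := pred1 j) (f := f).
  by apply: laurentS Lf => u Hu h /eqP ->; rewrite mnm1E eqxx -pairing_col.
exists 1%N, p, m; split; last by rewrite expr1 E.
by move=> h /ray_j hj; apply: mC; rewrite /= hj.
Qed.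

Lemma monomial_regular j (m : 'X_{1..M}) p p' : m j = 0%N ->
  pr ('X_[m] * p) = pr ('X_j * p') -> exists p'', pr p = pr ('X_j * p'').
Proof.
move=> mj; rewrite mpolyXE_id.
elim: (index_enum _) p' => [|h s IH] p'; first by rewrite big_nil mul1r; exists p'.
rewrite big_cons -mulrA; have [->|hj] := eqVneq h j.
  by rewrite mj expr0 mul1r; apply: IH.
set g := \prod_(_ <- _) _ in IH *.
have Xn k p1 : pr ('X_h ^+ k * (g * p)) = pr ('X_j * p1) ->
    exists p2, pr (g * p) = pr ('X_j * p2).
  elim: k p1 => [|k IHk] p1; first by rewrite expr0 mul1r; exists p1.
  by rewrite exprS -mulrA => /(var_regular hj)[p2 /IHk].
by move=> /Xn[p2 /IH].
Qed.

(** One expression of [f] has exponents fit for the chart, another has exponents positive on [j];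
    one with both properties is wanted. Equating the two fractions in [R] and cancelling the
    monomial [m1], which is free of ['X_j], shows that the chart numerator is a multiple of
    ['X_j]. *)
Lemma chart_ray_ideal C j f : C (ratcol P j) ->
  chart kap P chi [set h | C (ratcol P h)] f ->
  laurent kap chi [set u | 1 <= pairing u (col j P)] f ->
  ray_ideal kap P chi [set h | C (ratcol P h)] j f.
Proof.
rewrite -chart_ringE => Cj [p [m [hp mC E]]] Lf.
have [|p1 [m1 [_ m1C E1]]] := laurent_fraction (b0 := U_(j)%MM) (C := pred1 j) (f := f).
  by apply: laurentS Lf => u Hu h /eqP ->; rewrite mnm1E eqxx -pairing_col.
have : cls ('X_[m1] * p) = cls ('X_j * (p1 * 'X_[m])).
  rewrite mulrA mulrC !clsM; apply/eqP; rewrite -eqr_div ?clsX_neq0 // -clsM.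
  by rewrite -E -E1.
move=> /cls_eq/(monomial_regular (m1C j (eqxx j)))[p2].
move=> /(homogeneous_quotient hp)[p3 hp3 Epr].
have [g Lg gE] := homogeneous_laurent hp3.
have -> : f = g by apply: io_inj; rewrite gE -((cls_eq _ _).2 Epr).
apply: laurentS Lg => u [a ap uE]; split=> [h Ch|]; rewrite pairing_col uE mC ?subr0 //.
move: ap; rewrite mulrC (perm_mem (msuppMX _ _)) => /mapP[b _ ->].
by rewrite mnmDE mnm1E eqxx.
Qed.

End Coordinates.
End Cox.

(** * Nonvanishing values, denominators and changes of basis *)

(** Variables are specialized one at a time to integers, which are distinct in characteristic zero;
    one more candidate than the degree is enough. *)
Lemma mpoly_nonvanishing (kk : fieldType) q (p : {mpoly kk[q]}) :
  [pchar kk] =i pred0 -> p != 0 -> exists w, p.@[w] != 0.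
Proof.
move=> kk0 p0.
pose sub (w : 'I_q -> kk) n : {mpoly kk[q]} :=
  mmap (@mpolyC q kk) (fun i => if (i < n)%N then (w i)%:MP else 'X_i) p.
suff [w wq] : exists w, sub w q != 0.
  exists w; apply: contraNneq wq => pw0.
  rewrite /sub (_ : (fun i : 'I_q => _) = (fun i => (w i)%:MP)); last first.
    by apply/funext => i; rewrite ltn_ord.
  have -> : mmap (@mpolyC q kk) (fun i => (w i)%:MP) p = (p.@[w])%:MP.
    elim/mpoly_ring_ind: (p) => [c|i|p1 p2 E1 E2|p1 p2 E1 E2].
    - by rewrite mmapC mevalC.
    - by rewrite mmapX mmap1U mevalXU.
    - by rewrite rmorphD /= E1 E2 mevalD mpolyCD.
    - by rewrite rmorphM /= E1 E2 mevalM mpolyCM.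
  by rewrite pw0 mpolyC0.
suff : forall n, (n <= q)%N -> exists w, sub w n != 0 by move/(_ q (leqnn q)).
elim=> [_|n IH nq].
  exists (fun=> 0); rewrite /sub; congr (_ != _): p0.
  elim/mpoly_ring_ind: (p) => [c|i|p1 p2 E1 E2|p1 p2 E1 E2].
  - by rewrite mmapC.
  - by rewrite mmapX mmap1U.
  - by rewrite rmorphD /= -E1 -E2.
  - by rewrite rmorphM /= -E1 -E2.
have [w w0] := IH (ltnW nq); pose k := Ordinal nq.
have u0 : univ k (sub w n) != 0 by apply: contraNneq w0 => /univ_inj->.
pose rs := [seq (i%:R : kk)%:MP : {mpoly kk[q]} | i <- iota 0 (size (univ k (sub w n)))].
have urs : uniq rs.
  rewrite map_inj_uniq ?iota_uniq // => i j /(congr1 (mcoeff 0%MM)).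
  rewrite !mpolyCK => /eqP; rewrite -subr_eq0.
  wlog ij : i j / (i <= j)%N => [H|].
    have [/H//|/ltnW/H E] := leqP i j.
    by rewrite -oppr_eq0 opprB => /E.
  rewrite -oppr_eq0 opprB -natrB // ((pcharf0P kk).1 kk0) subn_eq0 => ji.
  by apply/eqP; rewrite eqn_leq ij.
have : ~~ all (root (univ k (sub w n))) rs.
  apply/negP => /(max_poly_roots u0)/(_ urs).
  by rewrite size_map size_iota ltnn.
move=> /allPn[_ /mapP[a _ ->] ra]; exists (fun i => if i == k then a%:R else w i).
congr (_ != _): ra; rewrite /sub.
set g := mmap _ _ p; have -> : (univ k g).[a%:R%:MP] =
    (horner_eval a%:R%:MP \o univ k) g by [].
rewrite /g; elim/mpoly_ring_ind: (p) => [c|i|p1 p2 E1 E2|p1 p2 E1 E2].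
- by rewrite !mmapC /= univC /horner_eval hornerC.
- rewrite !mmapX !mmap1U ltnS /= /horner_eval -(inj_eq val_inj) /=.
  case: (ltngtP i n) => [lt|gt|eq].
  + by rewrite univC hornerC.
  + rewrite univX -(inj_eq val_inj) /=.
    by case: eqP gt => [->|_ _]; rewrite ?ltnn // hornerC.
  + rewrite univX -(inj_eq val_inj) /= eq eqxx; exact: hornerX.
- by move: E1 E2 => /= E1 E2; rewrite !rmorphD /= E1 E2.
- by move: E1 E2 => /= E1 E2; rewrite !rmorphM /= E1 E2.
Qed.

Lemma rat_clear m n (B : 'M[rat]_(m, n)) : exists k : nat, exists C : 'M[int]_(m, n),
  (0 < k)%N /\ k%:R *: B = map_mx intr C.
Proof.
pose k := \prod_(ij : 'I_m * 'I_n) `|denq (B ij.1 ij.2)|%N.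
have kij i j : exists z : int, k%:R * B i j = z%:~R.
  have : (`|denq (B i j)| %| k)%N by rewrite /k (bigD1 (i, j)) //= dvdn_mulr.
  move=> /dvdnP[e ->]; exists (e%:Z * numq (B i j)).
  rewrite natrM -mulrA rmorphM /= -pmulrn; congr (_ * _).
  by rewrite pmulrn absz_denq mulrC -numqE.
have /choice[c cE] : forall ij : 'I_m * 'I_n, exists z : int, k%:R * B ij.1 ij.2 = z%:~R.
  by move=> ij.
exists k, (\matrix_(i, j) c (i, j)); split.
  by rewrite prodn_gt0 // => ij; rewrite absz_gt0 denq_neq0.
by apply/matrixP => i j; rewrite !mxE (cE (i, j)).
Qed.

(** The relations for the basis [b] make [tau] the image of the columns of [A] under a linear form
    [lam], a condition that no longer mentions a basis. *)
Lemma alpha_change (kk : fieldType) (r c : nat) (A : 'M[kk]_(c.+1, r.+1))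
    (b b' : 'I_c.+1 -> 'I_r.+1) (S : comNzRingType) (phi : {rmorphism kk -> S})
    (tau : 'I_r.+1 -> S) : general_position A -> injective b' ->
  (forall i, tau i = \sum_l phi (alpha A b l i) * tau (b l)) ->
  forall i, tau i = \sum_l phi (alpha A b' l i) * tau (b' l).
Proof.
move=> A_gen b'I tauE.
pose lam t := \sum_l phi (invmx (colsub b A) l t) * tau (b l).
have tauL i : tau i = \sum_t lam t * phi (A t i).
  rewrite tauE; under [RHS]eq_bigr => t _ do rewrite mulr_suml.
  rewrite exchange_big /=; apply: eq_bigr => l _.
  rewrite mxE rmorph_sum mulr_suml; apply: eq_bigr => t _.
  by rewrite rmorphM /= mulrAC.
move=> i; under eq_bigr => l _ do rewrite tauL mulr_sumr.
rewrite exchange_big /= tauL; apply: eq_bigr => t _.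
rewrite (alphaP A_gen i t b'I) rmorph_sum mulr_sumr; apply: eq_bigr => l _.
by rewrite rmorphM /= [RHS]mulrC mulrA.
Qed.

(** * The relations of the Cox ring *)

Section Relations.
Variables (kk : closedFieldType) (r c m s : nat) (n : 'I_r.+1 -> nat).
Variable l : forall i : 'I_r.+1, 'I_(n i) -> nat.
Variables (A : 'M[kk]_(c.+1, r.+1)) (d : 'M[int]_(s, #|vars m n|)).
Hypotheses (c_gt0 : (0 < c)%N) (c_le_r : (c <= r)%N).
Hypothesis A_gen : general_position A.

Local Notation M := #|vars m n|.
Local Notation P := (stackP l d).
Local Notation MP := {mpoly kk[M]}.

Definition wt (i : 'I_r.+1) (h : 'I_M) : nat :=
  match enum_val h with
  | inl (existT i' j) => if i' == i then l j else 0%N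
  | inr _ => 0%N
  end.

Definition blk (h : 'I_M) : option 'I_r.+1 :=
  match enum_val h with inl (existT i _) => Some i | inr _ => None end.

Lemma enum_val_Tidx i (j : 'I_(n i)) :
  enum_val (Tidx m j) = inl (Tagged (fun i => 'I_(n i)) j).
Proof. exact: enum_rankK. Qed.

Lemma enum_val_Sidx t : enum_val (Sidx n t : 'I_M) = inr t.
Proof. exact: enum_rankK. Qed.

Lemma wt_Tidx i i' (j : 'I_(n i)) : wt i' (Tidx m j) = if i == i' then l j else 0%N.
Proof. by rewrite /wt enum_val_Tidx. Qed.

Lemma wt_Sidx i t : wt i (Sidx n t) = 0%N.
Proof. by rewrite /wt enum_val_Sidx. Qed.

Variant idx_spec (h : 'I_M) : Prop :=
| IdxT i (j : 'I_(n i)) of h = Tidx m j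
| IdxS t of h = Sidx n t.

Lemma idxP h : idx_spec h.
Proof.
case E: (enum_val h) => [[i j]|t].
  by apply: (@IdxT _ i j); apply: enum_val_inj; rewrite E enum_val_Tidx.
by apply: (@IdxS _ t); apply: enum_val_inj; rewrite E enum_val_Sidx.
Qed.

Lemma Tidx_inj i (j j' : 'I_(n i)) : Tidx m j = Tidx m j' -> j = j'.
Proof.
move=> /(congr1 enum_val); rewrite !enum_val_Tidx => -[] /eqP.
by rewrite eq_Tagged /= => /eqP.
Qed.

Lemma wt_blk i h : blk h != Some i -> wt i h = 0%N.
Proof.
rewrite /blk /wt; case: (enum_val h) => [[i' j]|//] ne.
by case: eqP => // ii'; case/eqP: ne; rewrite ii'.
Qed.

Definition mexp i : 'X_{1..M} := [multinom wt i h | h < M].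

Lemma TmonE i : Tmon m l kk i = 'X_[mexp i].
Proof.
rewrite /Tmon; under eq_bigr => j _ do rewrite mpolyXn.
rewrite mprodXE; congr 'X_[_]; apply/mnmP => h.
rewrite mnm_sumE mnmE; under eq_bigr => j _ do rewrite mulmnE mnm1E.
case: (idxP h) => [i' j' ->|t ->]; last first.
  rewrite wt_Sidx big1 // => j _; case: eqP => // /(congr1 enum_val).
  by rewrite enum_val_Tidx enum_val_Sidx.
rewrite wt_Tidx; case: (eqVneq i' i) => [E|ne].
  subst i'; rewrite (bigD1 j') //= eqxx mul1n big1 ?addn0 // => j jj'.
  by case: eqP => // /Tidx_inj jE; rewrite jE eqxx in jj'.
rewrite big1 // => j _; case: eqP => // /(congr1 enum_val).
rewrite !enum_val_Tidx => /(congr1 (fun x => if x is inl y then tag y else i)) /= E.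
by rewrite E eqxx in ne.
Qed.

Local Notation std := (std_basis (inord c : 'I_r.+1) : 'I_c.+1 -> 'I_r.+1).

Lemma std_inord (b : 'I_c.+1) : std b = inord b.
Proof.
rewrite /std_basis; case: ltnP => // cb; congr inord; have := ltn_ord b; lia.
Qed.

Lemma std_inj : injective std.
Proof. by apply: std_basis_inj => //; rewrite inordK // ltnS. Qed.

Lemma relationE t : relation m l A t = (\det (colsub std A))%:MP *
  (Tmon m l kk (inord (c + t.+1)) -
   \sum_b (alpha A std b (inord (c + t.+1)))%:MP * Tmon m l kk (std b)).
Proof.
rewrite /relation; set e := inord (c + t.+1).
have -> : (fun b : 'I_c.+1 => inord b : 'I_r.+1) = std.
  by apply/funext => b; rewrite std_inord.
set A0 := map_mx _ _; set a := map_mx _ _; set T0 := \row_b _.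
pose Ai := map_mx (@mpolyC M kk) (invmx (colsub std A)).
have A0i : Ai *m A0 = 1%:M.
  by rewrite -map_mxM mulVmx ?map_mx1 // colsub_unit //; apply: std_inj.
pose S := (Tmon m l kk e)%:M - T0 *m (Ai *m a).
have -> : block_mx A0 a T0 (Tmon m l kk e)%:M =
    block_mx 1%:M 0 (T0 *m Ai) 1%:M *m block_mx A0 a 0 S.
  rewrite mulmx_block !mul1mx !mul0mx !addr0 -(mulmxA T0 Ai A0) A0i mulmx1.
  by rewrite /S mulmxA addrC subrK.
rewrite det_mulmx det_lblock !det1 mul1r mul1r det_ublock det_map_mx.
congr (_ * _); rewrite (mx11_scalar S) det_scalar1 [S 0 0]mxE.
rewrite [X in X + _]mxE eqxx mulr1n [X in _ + X]mxE [X in - X]mxE.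
congr (_ - _); apply: eq_bigr => b _.
rewrite mxE mulrC -std_inord; congr (_ * _).
rewrite !mxE rmorph_sum; apply: eq_bigr => h _.
by rewrite !mxE rmorphM.
Qed.

Lemma row_P_eps i h : (eps s i *m P) 0 h = (wt i h)%:Z - (wt ord0 h)%:Z.
Proof.
rewrite /stackP /eps mul_row_col mul0mx addr0 mxE.
case: (unliftP ord0 i) => [a ->|->]; last first.
  by rewrite big1 ?subrr // => a _; rewrite mxE mul0r.
rewrite (bigD1 a) //= big1 ?addr0 => [|a' a'a]; last first.
  by rewrite mxE (inj_eq lift_inj) eq_sym (negPf a'a) mul0r.
rewrite !mxE eqxx mul1r /wt; case: (enum_val h) => [[i' j]|t]; last by rewrite subrr.
case: (i' =P ord0) => [i'0|_]; last by case: eqP => _; rewrite subr0.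
have -> : (i' == lift ord0 a) = false by rewrite i'0 eq_liftF.
by rewrite sub0r.
Qed.

Lemma eps_pairing i j :
  pairing (eps s i) (col j P) = (wt i j)%:Z - (wt ord0 j)%:Z.
Proof. by rewrite pairing_col row_P_eps. Qed.

End Relations.

(** * Points of the total coordinate space *)

Lemma prod_exprz (K : fieldType) (I : finType) (f : I -> K) (a : int) :
  (\prod_i f i) ^ a = \prod_i f i ^ a.
Proof. exact: (big_morph (fun x => x ^ a) (fun x y => expfzMl x y a) (exp1rz _ a)). Qed.

Lemma exprz_sum (K : fieldType) (I : finType) (x : K) (f : I -> int) :
  x != 0 -> x ^ (\sum_i f i) = \prod_i x ^ f i.
Proof.
by move=> x0; apply: (big_morph (fun a : int => x ^ a) (fun a b => expfzDr a b x0)).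
Qed.

Lemma integral_section N M (P : 'M[int]_(N, M)) :
  row_full (map_mx (intr : int -> rat) P)^T ->
  exists k : nat, exists B : 'M[int]_(M, N), (0 < k)%N /\ P *m B = k%:Z%:M.
Proof.
move=> /row_fullP[B BP]; have [k [C [k0 CE]]] := rat_clear B.
exists k, C^T; split=> //.
have E : map_mx (intr : int -> rat) (P *m C^T) = map_mx intr (k%:Z%:M : 'M[int]_N).
  rewrite map_mxM -map_trmx -CE linearZ /= -scalemxAr -[map_mx _ P]trmxK -trmx_mul BP.
  by rewrite trmx1 scalemx1 map_scalar_mx pmulrn.
apply/matrixP => i j; apply: (@intr_inj rat).
by have := congr1 (fun X : 'M_N => X i j) E; rewrite /= mxE => ->; rewrite mxE.
Qed.

(* A multiple of [P] has an integral section, and [kk] contains all roots. *)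
Lemma torus_point (kk : closedFieldType) N M (P : 'M[int]_(N, M)) (sg : 'I_N -> kk) :
  row_full (map_mx (intr : int -> rat) P)^T -> (forall b, sg b != 0) ->
  exists xi : 'I_M -> kk, (forall h, xi h != 0) /\
    forall u : 'rV[int]_N, \prod_h xi h ^ (u *m P) 0 h = \prod_b sg b ^ u 0 b.
Proof.
move=> Pfull sg0; have [k [B [k0 PB]]] := integral_section Pfull.
have /choice[rho rhoE] : forall b, exists x, x ^+ k = sg b.
  move=> b; have /closed_rootP[x] : size ('X^k - (sg b)%:P) != 1%N.
    by rewrite size_XnsubC // eqSS -lt0n.
  by rewrite rootE !hornerE subr_eq0 => /eqP xk; exists x.
have rho0 b : rho b != 0.
  by have := sg0 b; rewrite -rhoE expf_eq0 k0.
exists (fun h => \prod_b rho b ^ B h b); split=> [h|u].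
  by apply/prodf_neq0 => b _; rewrite expfz_neq0.
under eq_bigr => h _ do rewrite prod_exprz.
rewrite exchange_big /=; apply: eq_bigr => b _.
under eq_bigr => h _ do rewrite exprz_exp mulrC.
rewrite -exprz_sum //.
have -> : \sum_h (u *m P) 0 h * B h b = k%:Z * u 0 b.
  have := congr1 (fun X : 'rV_N => X 0 b) (mulmxA u P B).
  rewrite [X in _ = X]mxE => <-; rewrite PB mul_mx_scalar mxE.
  by [].
by rewrite -exprz_exp -exprnP rhoE.
Qed.

Section CoxRing.
Variables (kk : closedFieldType) (r c m s : nat) (n : 'I_r.+1 -> nat).
Hypothesis kk0 : [pchar kk] =i pred0.
Variable l : forall i : 'I_r.+1, 'I_(n i) -> nat.
Variables (A : 'M[kk]_(c.+1, r.+1)) (d : 'M[int]_(s, #|vars m n|)).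
Hypotheses (c_gt0 : (0 < c)%N) (c_le_r : (c <= r)%N).
Hypothesis A_gen : general_position A.
Hypothesis P_gen : generator_matrix (stackP l d).
Variables (R : idomainType) (pr : {rmorphism {mpoly kk[#|vars m n|]} -> R}).
Hypothesis R_pres : presents_RAP l A pr.

Local Notation M := #|vars m n|.
Local Notation P := (stackP l d).
Local Notation MP := {mpoly kk[M]}.
Local Notation top := (inord c : 'I_r.+1).
Local Notation std := (std_basis top : 'I_c.+1 -> 'I_r.+1).

Let stdI : injective std. Proof. exact: std_inj. Qed.

Lemma pr_relation t : pr (relation m l A t) = 0.
Proof.
apply/R_pres.2; exists (fun t' => (t' == t)%:R).
by rewrite (bigD1 t) //= eqxx mul1r big1 ?addr0 // => t' /negPf ->; rewrite mul0r.
Qed.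

Lemma std_or (i : 'I_r.+1) : (exists b, i = std b) \/
  (exists t : 'I_(r - c), i = inord (c + t.+1)).
Proof.
have [ic|ci] := leqP i c; [left|right].
  exists (Ordinal (ic : (i < c.+1)%N)); rewrite std_inord //.
  exact: (esym (inord_val i)).
have lt : (i - c.+1 < r - c)%N by have := ltn_ord i; lia.
exists (Ordinal lt); apply: ord_inj => /=.
by rewrite inordK; have := ltn_ord i; lia.
Qed.

Lemma pr_Tmon b : injective b -> forall i, pr (Tmon m l kk i) =
  \sum_h pr (alpha A b h i)%:MP * pr (Tmon m l kk (b h)).
Proof.
move=> bI; apply: (alpha_change (b := std) (phi := pr \o @mpolyC M kk)
  (tau := fun i => pr (Tmon m l kk i)) A_gen bI) => i /=.
case: (std_or i) => [[b0 ->]|[t ->]].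
  rewrite (bigD1 b0) //= big1 ?addr0 => [|h hb].
    by rewrite (alpha_basis A_gen) // eqxx mpolyC1 rmorph1 mul1r.
  by rewrite (alpha_basis A_gen) // (negPf hb) mpolyC0 rmorph0 mul0r.
have := pr_relation t; rewrite relationE // rmorphM => /eqP; rewrite mulf_eq0 => /orP[].
  move=> /eqP d0; have := colsub_unit A_gen stdI; rewrite unitmxE unitfE => dn0.
  have := congr1 (fun x => x * pr (\det (colsub std A))^-1%:MP) d0.
  rewrite -rmorphM -mpolyCM mulfV // mpolyC1 rmorph1 mul0r => /eqP.
  by rewrite oner_eq0.
rewrite rmorphB subr_eq0 => /eqP ->; rewrite rmorph_sum.
by apply: eq_bigr => h _; rewrite rmorphM.
Qed.

Lemma eval_ideal (xi : 'I_M -> kk) :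
  (forall i, (Tmon m l kk i).@[xi] =
     \sum_b alpha A std b i * (Tmon m l kk (std b)).@[xi]) ->
  forall p, pr p = 0 -> p.@[xi] = 0.
Proof.
move=> TE p /R_pres.2[a ->]; rewrite rmorph_sum big1 // => t _ /=.
rewrite mevalM relationE // mevalM mevalB [X in X - _]TE; move: (\det _) => D; rewrite rmorph_sum /=.
under [X in _ - X]eq_bigr => b _ do rewrite mevalM mevalC.
by rewrite subrr !mulr0.
Qed.

Lemma Tmon_eval i (xi : 'I_M -> kk) : (forall h, xi h != 0) ->
  (Tmon m l kk i).@[xi] =
  (Tmon m l kk ord0).@[xi] * \prod_h xi h ^ (eps s i *m P) 0 h.
Proof.
move=> xi0; rewrite !TmonE !mevalX -big_split; apply: eq_bigr => h _ /=.
rewrite row_P_eps !mnmE [xi h ^+ wt l ord0 h]exprnP -expfzDr //.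
by rewrite addrC subrK.
Qed.

Lemma cox_point (sg : 'I_(r + s) -> kk) : (forall b, sg b != 0) ->
  (forall i, \prod_b sg b ^ eps s i 0 b =
     \sum_h alpha A std h i * \prod_b sg b ^ eps s (std h) 0 b) ->
  exists xi : 'I_M -> kk, [/\ forall h, xi h != 0,
    forall p, pr p = 0 -> p.@[xi] = 0 &
    forall u : 'rV[int]_(r + s), \prod_h xi h ^ (u *m P) 0 h = \prod_b sg b ^ u 0 b].
Proof.
move=> sg0 sgE; case: P_gen => _ _ Pfull.
have [xi [xi0 xiE]] := torus_point Pfull sg0; exists xi; split=> //.
apply: eval_ideal => i; rewrite Tmon_eval // xiE sgE mulr_sumr.
by apply: eq_bigr => h _; rewrite [in RHS]Tmon_eval // xiE mulrCA.
Qed.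

(** The values [w] can be prescribed as long as they and all the linear forms $y_i$ in them are
    nonzero, since then they define a point [sg] of the torus that satisfies the linear relations.
    Hence [w] is picked off the zeros of [p], of the coordinates and of the $y_i$. *)
Lemma generic_point (p : {mpoly kk[s + c]}) : p != 0 ->
  exists (w : 'I_(s + c) -> kk) (xi : 'I_M -> kk), [/\ p.@[w] != 0,
    forall h, xi h != 0, forall p, pr p = 0 -> p.@[xi] = 0 &
    forall i, \prod_h xi h ^ (row i (std_frame c s top) *m P) 0 h = w i].
Proof.
move=> p0.
pose lin (h : 'I_c.+1) : 'X_{1..s + c} :=
  if unlift ord0 h is Some a then U_(rshift s a)%MM else 0%MM.
pose y i : {mpoly kk[s + c]} := \sum_h alpha A std h i *: 'X_[lin h].
have linI : injective lin.
  move=> h h'; rewrite /lin; case: unliftP => [a ->|->]; case: unliftP => [a' ->|->] //.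
  - by move/eqP; rewrite eq_mnm1 => /eqP/rshift_inj->.
  - by move/eqP; rewrite mnm1_eq0.
  - by move/esym/eqP; rewrite mnm1_eq0.
have y0 i : y i != 0.
  have [h ah] : exists h, alpha A std h i != 0.
    have [i0 ii0] : exists i0 : 'I_r.+1, i != i0.
      case: (eqVneq i ord0) => [->|]; last by exists ord0.
      by exists (inord c); apply/eqP => /(congr1 val) /=; rewrite inordK //; lia.
    have [h ah _] := alpha_neq0 c_gt0 c_le_r A_gen stdI ii0.
    by exists h.
  apply: contraNneq ah => yi0; have := congr1 (mcoeff (lin h)) yi0.
  rewrite mcoeff0 /y raddf_sum (bigD1 h) //= big1 ?addr0 => [|h' hh'].
    by rewrite mcoeffZ mcoeffX eqxx mulr1 => ->.
  by rewrite mcoeffZ mcoeffX (inj_eq linI) (negPf hh') mulr0.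
have XX0 (i : 'I_(s + c)) : 'X_i != 0 :> {mpoly kk[s + c]}.
  apply/eqP => /(congr1 (mcoeff U_(i))); rewrite mcoeffX eqxx mcoeff0.
  by apply/eqP/oner_neq0.
have [|w] := mpoly_nonvanishing (p := p * \prod_i 'X_i * \prod_i y i) kk0.
  by rewrite !mulf_neq0 //; apply/prodf_neq0.
rewrite !mevalM !rmorph_prod /= !mulf_eq0 !negb_or => /andP[/andP[pw /prodf_neq0 w0] /prodf_neq0 yw].
pose Y i := (y i).@[w].
have Ystd h : Y (std h) = ('X_[lin h]).@[w].
  rewrite /Y /y rmorph_sum (bigD1 h) //= big1 ?addr0 => [|h' hh'].
    by rewrite mevalZ (alpha_basis A_gen) // eqxx mul1r.
  by rewrite mevalZ (alpha_basis A_gen) // (negPf hh') mul0r.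
have Y0 : Y ord0 = 1.
  by rewrite -(std_basis0 c_gt0 c_le_r top) Ystd /lin unlift_none mpolyX0 meval1.
pose sg (b : 'I_(r + s)) := match split b with inl a => Y (lift ord0 a) | inr b => w (lshift c b) end.
have sgl a : sg (lshift s a) = Y (lift ord0 a) by rewrite /sg (unsplitK (inl a)).
have sgr b : sg (rshift r b) = w (lshift c b) by rewrite /sg (unsplitK (inr b)).
have sgdelta h : \prod_b sg b ^ (delta_mx 0 h : 'rV[int]_(r + s)) 0 b = sg h.
  rewrite (bigD1 h) //= big1 ?mulr1 => [|h' hh'].
    by rewrite mxE !eqxx.
  by rewrite mxE eqxx (negPf hh').
have sgeps i : \prod_b sg b ^ eps s i 0 b = Y i.
  case: (unliftP ord0 i) => [a ->|->]; first by rewrite eps_lift sgdelta sgl.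
  by rewrite Y0 eps0 big1 // => b _; rewrite mxE.
have [||xi [xi0 xiI xiE]] := cox_point (sg := sg).
- move=> b; case: (split_ordP b) => a ->; last by rewrite sgr -mevalXU w0.
  by rewrite sgl yw.
- move=> i; rewrite sgeps; under eq_bigr => h _ do rewrite sgeps Ystd.
  by rewrite {1}/Y /y rmorph_sum; apply: eq_bigr => h _; rewrite /= mevalZ.
exists w, xi; split=> // i; rewrite xiE.
case: (split_ordP i) => a ->; first by rewrite std_frame_l sgdelta sgr.
by rewrite std_frame_r sgeps Ystd /lin liftK mevalXU.
Qed.

Lemma cox_var_neq0 h : pr 'X_h != 0.
Proof.
have [|w [xi [_ xi0 xiI _]]] := @generic_point 1; first exact: oner_neq0.
by apply: contraNneq (xi0 h) => /xiI; rewrite mevalXU => ->.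
Qed.

End CoxRing.

(** * Homogeneity of the relations and independence of the torus coordinates *)

Section CoxRingFacts.
Variables (kk : closedFieldType) (r c m s : nat) (n : 'I_r.+1 -> nat).
Hypothesis kk0 : [pchar kk] =i pred0.
Variable l : forall i : 'I_r.+1, 'I_(n i) -> nat.
Variables (A : 'M[kk]_(c.+1, r.+1)) (d : 'M[int]_(s, #|vars m n|)).
Hypotheses (c_gt0 : (0 < c)%N) (c_le_r : (c <= r)%N).
Hypothesis A_gen : general_position A.
Hypothesis P_gen : generator_matrix (stackP l d).
Variables (R : idomainType) (pr : {rmorphism {mpoly kk[#|vars m n|]} -> R}).
Hypothesis R_pres : presents_RAP l A pr.

Local Notation M := #|vars m n|.
Local Notation P := (stackP l d).
Local Notation MP := {mpoly kk[M]}.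
Local Notation top := (inord c : 'I_r.+1).
Local Notation std := (std_basis top : 'I_c.+1 -> 'I_r.+1).

Lemma mexp_eps i : mnm_row (mexp m l i) - mnm_row (mexp m l ord0) =
  eps s i *m P :> 'rV[int]_M.
Proof. by apply/rowP => h; rewrite row_P_eps !mxE !mnmE. Qed.

Lemma component_Tmon i :
  component P (mdegQ P (mexp m l ord0)) (Tmon m l kk i) = Tmon m l kk i.
Proof.
rewrite TmonE component_id //; have <- : mdegQ P (mexp m l i) = mdegQ P (mexp m l ord0).
  by apply/mdegQ_eq; exists (eps s i); apply: mexp_eps.
exact: homogeneousX.
Qed.

Lemma relation_homogeneous t :
  homogeneous (relation m l A t) (mdegQ P (mexp m l ord0)).
Proof.
have CM (a : kk) (p : MP) w : component P w (a%:MP * p) = a%:MP * component P w p.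
  by rewrite (componentM _ _ (@homogeneousC _ _ P kk a)) subr0.
rewrite relationE // -[X in homogeneous _ X]add0r.
apply: homogeneousM; first exact: homogeneousC.
set q := _ - _; have <- : component P (mdegQ P (mexp m l ord0)) q = q.
  rewrite /q -scaleN1r componentD componentZ component_Tmon component_sum.
  congr (_ + _ *: _); apply: eq_bigr => b _.
  by rewrite CM component_Tmon.
exact: component_homogeneous.
Qed.

Lemma cox_component w p : pr p = 0 -> pr (component P w p) = 0.
Proof.
move=> /R_pres.2[a ->]; rewrite component_sum rmorph_sum big1 // => t _.
by rewrite /= mulrC (componentM _ _ (relation_homogeneous (t := t))) rmorphM pr_relation // mul0r.
Qed.

Section FunctionField.
Variables (F : fieldType) (io : {rmorphism F -> {fraction R}}).
Variable kap : {rmorphism kk -> F}.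
Hypothesis kapE : forall a, io (kap a) = cls pr a%:MP.
Variable chi : 'rV[int]_(r + s) -> F.
Hypothesis chiE : forall u, io (chi u) = laurent_cls pr (u *m P).

Let var_neq0 := cox_var_neq0 kk0 c_gt0 c_le_r A_gen P_gen R_pres.

Lemma cox_chi_rel b : injective b -> forall i,
  chi (eps s i) = \sum_h kap (alpha A b h i) * chi (eps s (b h)).
Proof.
move=> bI i; have chi_eps i' : io (chi (eps s i')) =
    cls pr (Tmon m l kk i') / cls pr (Tmon m l kk ord0).
  by rewrite chiE (laurent_cls_frac var_neq0 (mexp_eps i')) !TmonE.
apply: (io_inj (io := io)); rewrite chi_eps /cls (pr_Tmon c_gt0 c_le_r A_gen R_pres bI i).
rewrite !rmorph_sum mulr_suml; apply: eq_bigr => h _.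
by rewrite !rmorphM /= kapE chi_eps mulrA.
Qed.

(** At a generic point [xi] of $\bar X$ the coordinates take values [w] with [p.@[w]] nonzero. The
    function obtained from [p] is a fraction whose value at [xi] is [p.@[w]], so it is not zero. *)
Lemma cox_std_free p :
  mmap kap (fun i => chi (row i (std_frame c s top))) p = 0 -> p = 0.
Proof.
move=> p0; apply: contrapT => /eqP/(generic_point kk0 c_gt0 c_le_r A_gen P_gen R_pres).
move=> [w [xi [pw xi0 xiI xiE]]].
have cls_xi a : a.@[xi] != 0 -> cls pr a != 0.
  by rewrite cls_neq0; apply: contraNneq => /xiI ->.
suff [a [b [E b0 V]]] : exists a b, [/\ io (mmap kap (fun i => chi (row i (std_frame c s top))) p)
    = cls pr a / cls pr b, b.@[xi] != 0 & a.@[xi] = p.@[w] * b.@[xi]].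
  move: E; rewrite p0 rmorph0 => /esym/eqP.
  rewrite mulf_eq0 invr_eq0 (negPf (cls_xi _ b0)) orbF => /eqP a0.
  have : pr a = 0 by apply/eqP; rewrite -[_ == _]negbK -cls_neq0 a0 eqxx.
  by move=> /xiI/eqP; rewrite V mulf_eq0 (negPf pw) (negPf b0).
elim/mpoly_ring_ind: {p0 pw} p => [a|i|p q [a [b [E b0 V]]] [a' [b' [E' b'0 V']]]
    |p q [a [b [E b0 V]]] [a' [b' [E' b'0 V']]]].
- exists a%:MP, 1; rewrite mmapC kapE cls1 divr1 meval1 oner_neq0 !mevalC mulr1.
  by [].
- have [|m1 [e [aE _]]] := @mnm_row_parts _ (row i (std_frame c s top) *m P) 0%MM pred0.
    by [].
  rewrite add0m in aE; exists 'X_[m1], 'X_[e]; split.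
  + by rewrite mmapX mmap1U chiE (laurent_cls_frac var_neq0 aE).
  + by rewrite mevalX; apply/prodf_neq0 => h _; rewrite expf_neq0.
  + rewrite mevalXU -xiE !mevalX -big_split; apply: eq_bigr => h _ /=.
    by rewrite -aE !mxE [xi h ^+ e h]exprnP -expfzDr // subrK.
- exists (a * b' + a' * b), (b * b'); rewrite rmorphD /= rmorphD E E' clsD !clsM.
  rewrite !mevalD !mevalM mulf_neq0 // V V' addf_div ?cls_xi //; split=> //.
  by rewrite mulrDl; congr (_ + _); rewrite -!mulrA; congr (_ * _); rewrite mulrC.
- exists (a * a'), (b * b'); rewrite rmorphM /= rmorphM E E' !clsM.
  by rewrite !mevalM mulf_neq0 // V V' mulf_div; split=> //; rewrite mulrACA.
Qed.

End FunctionField.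
End CoxRingFacts.

(** * Normal forms modulo the relations *)

Section LinearExtension.
Variables (kk : fieldType) (M : nat) (N : 'X_{1..M} -> {mpoly kk[M]}).
Implicit Types p : {mpoly kk[M]}.

Definition mlinear p : {mpoly kk[M]} := \sum_(e <- msupp p) p@_e *: N e.

Lemma mlinear_superset p (s : seq 'X_{1..M}) : uniq s -> {subset msupp p <= s} ->
  mlinear p = \sum_(e <- s) p@_e *: N e.
Proof.
move=> us ps; rewrite [RHS](bigID (mem (msupp p))) /= [X in _ + X]big1 ?addr0.
  rewrite -big_filter; apply: perm_big; apply: uniq_perm.
  - exact: msupp_uniq.
  - exact: filter_uniq.
  - by move=> e; rewrite mem_filter; case: (boolP (e \in msupp p)) => // /ps ->.
by move=> e ep; rewrite (memN_msupp_eq0 ep) scale0r.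
Qed.

Lemma mlinearP a p p' : mlinear (a *: p + p') = a *: mlinear p + mlinear p'.
Proof.
pose s := undup (msupp p ++ msupp p' ++ msupp (a *: p + p')).
have us : uniq s by exact: undup_uniq.
rewrite !(@mlinear_superset _ s) //; try by move=> e; rewrite mem_undup !mem_cat => ->; rewrite ?orbT.
rewrite scaler_sumr -big_split; apply: eq_bigr => e _ /=.
by rewrite mcoeffD mcoeffZ scalerDl scalerA.
Qed.

Lemma mlinearX e : mlinear 'X_[e] = N e.
Proof. by rewrite /mlinear msuppX big_seq1 mcoeffX eqxx scale1r. Qed.

Lemma mlinear0 : mlinear 0 = 0.
Proof. by rewrite /mlinear msupp0 big_nil. Qed.

Lemma mlinearM e g : (forall e', N (e + e')%MM = g * N e') ->
  forall p, mlinear ('X_[e] * p) = g * mlinear p.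
Proof.
move=> Ne p; elim/mpolyind: p => [|a e' p _ _ IH]; first by rewrite mulr0 mlinear0 mulr0.
by rewrite mulrDr -scalerAr !mlinearP -mpolyXD !mlinearX Ne IH mulrDr scalerAr.
Qed.

Lemma mlinearB p p' : mlinear (p - p') = mlinear p - mlinear p'.
Proof. by rewrite addrC -scaleN1r mlinearP scaleN1r addrC. Qed.

Lemma mlinearZ a p : mlinear (a *: p) = a *: mlinear p.
Proof. by rewrite -[a *: p]addr0 mlinearP mlinear0 addr0. Qed.

Lemma mlinear_sum I (s : seq I) (f : I -> {mpoly kk[M]}) :
  mlinear (\sum_(i <- s) f i) = \sum_(i <- s) mlinear (f i).
Proof.
apply: (big_morph mlinear _ mlinear0) => p p'.
by have := mlinearP 1 p p'; rewrite !scale1r.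
Qed.

End LinearExtension.

Section NormalForm.
Variables (kk : closedFieldType) (r c m : nat) (n : 'I_r.+1 -> nat).
Variable l : forall i : 'I_r.+1, 'I_(n i) -> nat.
Variables (A : 'M[kk]_(c.+1, r.+1)).
Hypotheses (c_gt0 : (0 < c)%N) (c_le_r : (c <= r)%N).
Hypothesis n_gt0 : forall i, (0 < n i)%N.
Hypothesis l_gt0 : forall i (j : 'I_(n i)), (0 < l j)%N.
Hypothesis A_gen : general_position A.
Variables (R : idomainType) (pr : {rmorphism {mpoly kk[#|vars m n|]} -> R}).
Hypothesis R_pres : presents_RAP l A pr.

Local Notation M := #|vars m n|.
Local Notation MP := {mpoly kk[M]}.
Local Notation top := (inord c : 'I_r.+1).
Local Notation std := (std_basis top : 'I_c.+1 -> 'I_r.+1).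
Local Notation mexp := (mexp m l).

(** The largest [k] for which $T_i^{k l_i}$ divides the monomial [e]. The minimum starts from the
    first variable of the block, which is there by [n_gt0]. *)
Definition exponent (i : 'I_r.+1) (e : 'X_{1..M}) : nat :=
  let h := [arg min_(h < Tidx m (Ordinal (n_gt0 i)) | (0 < wt l i h)%N) (e h %/ wt l i h)%N]
  in (e h %/ wt l i h)%N.

Lemma exponentP i (e : 'X_{1..M}) k :
  (k <= exponent i e)%N <-> forall h, (k * wt l i h <= e h)%N.
Proof.
rewrite /exponent; case: arg_minnP => [|h h0 hmin]; first by rewrite wt_Tidx eqxx.
split=> [kh h'|kh]; last by rewrite leq_divRL.
have [->|wt0] := posnP (wt l i h'); first by rewrite muln0.
by rewrite -leq_divRL //; apply: leq_trans kh (hmin _ wt0).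
Qed.

Lemma leq_ext (x y : nat) : (forall k, (k <= x)%N <-> (k <= y)%N) -> x = y.
Proof.
move=> H; apply/eqP; rewrite eqn_leq.
by apply/andP; split; [apply/H | apply/(H y)].
Qed.

Lemma exponent_mexp i e : exponent i (mexp i + e)%MM = (exponent i e).+1.
Proof.
apply: leq_ext => -[|k]; first by [].
rewrite ltnS; split=> /exponentP H; apply/exponentP => h; have := H h.
  by rewrite mnmDE mnmE mulSn leq_add2l.
by rewrite mnmDE mnmE mulSn leq_add2l.
Qed.

Lemma exponent_ext i (e e' : 'X_{1..M}) : (forall h, (0 < wt l i h)%N -> e h = e' h) ->
  exponent i e = exponent i e'.
Proof.
move=> ee'; apply: leq_ext => k.
by split=> /exponentP H; apply/exponentP => h; have := H h;
  have [->|/ee' ->//] := posnP (wt l i h); rewrite muln0.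
Qed.

Lemma wt_unique (i i' : 'I_r.+1) (h : 'I_M) : (0 < wt l i h)%N -> i != i' -> wt l i' h = 0%N.
Proof.
move=> wi ii'; apply: wt_blk; apply: contraTneq wi => bh.
by rewrite (@wt_blk _ _ _ l i) // bh; apply: contra_neq ii' => -[].
Qed.

Variable b : 'I_c.+1 -> 'I_r.+1.
Hypothesis bI : injective b.

Local Notation dep i := (i \notin codom b).

Definition basis_form i : MP := \sum_k (alpha A b k i)%:MP * 'X_[mexp (b k)].

(* The subtraction of the multiples of [l_i] is exact, see [exponentP]. *)
Definition reduced (e : 'X_{1..M}) : 'X_{1..M} :=
  [multinom (e h - \sum_(i | dep i) exponent i e * wt l i h)%N | h < M].

(* Rewrites [T_i^l_i] for [i] outside the basis [b] as a combination of the
   [T_(b k)^l_(b k)]. *)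
Definition normal_monomial (e : 'X_{1..M}) : MP :=
  (\prod_(i | dep i) basis_form i ^+ exponent i e) * 'X_[reduced e].

Definition normal_form : MP -> MP := mlinear normal_monomial.

Lemma basis_form_basis k : basis_form (b k) = 'X_[mexp (b k)].
Proof.
rewrite /basis_form (bigD1 k) //= big1 ?addr0 => [|k' kk'].
  by rewrite (alpha_basis A_gen) // eqxx mpolyC1 mul1r.
by rewrite (alpha_basis A_gen) // (negPf kk') mpolyC0 mul0r.
Qed.

Lemma normal_monomial_dep i e : dep i ->
  normal_monomial (mexp i + e)%MM = basis_form i * normal_monomial e.
Proof.
move=> di; have Ei i' : i' != i -> exponent i' (mexp i + e)%MM = exponent i' e.
  move=> i'i; apply: exponent_ext => h wt0.
  by rewrite mnmDE mnmE (wt_unique wt0 i'i) add0n.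
have red : reduced (mexp i + e)%MM = reduced e.
  apply/mnmP => h; rewrite !mnmE (bigD1 i) //= [in RHS](bigD1 i) //= exponent_mexp.
  rewrite mulSn -addnA subnDl; congr (_ - (_ + _))%N.
  by apply: eq_bigr => i' /andP[_ i'i]; rewrite Ei.
rewrite /normal_monomial red; move: basis_form => phi; rewrite mulrA; congr (_ * _).
rewrite (bigD1 i di) [in RHS](bigD1 i di) /= exponent_mexp exprS -mulrA.
by congr (_ * (_ * _)); apply: eq_bigr => i' /andP[_ /Ei ->].
Qed.

Lemma normal_monomial_indep (g e : 'X_{1..M}) :
  (forall i (h : 'I_M), dep i -> (0 < g h)%N -> wt l i h = 0%N) ->
  normal_monomial (g + e)%MM = 'X_[g] * normal_monomial e.
Proof.
move=> gP; have Ei i : dep i -> exponent i (g + e)%MM = exponent i e.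
  move=> di; apply: exponent_ext => h; rewrite mnmDE.
  by have [->//|/(gP i h di) ->] := posnP (g h).
rewrite /normal_monomial mulrCA -mpolyXD; congr (_ * 'X_[_]).
  by apply: eq_bigr => i /Ei ->.
apply/mnmP => h; rewrite mnmDE !mnmE.
under eq_bigr => i di do rewrite Ei //.
have [->|g0] := posnP (g h); first by rewrite !add0n.
by rewrite big1 ?subn0 // => i di; rewrite gP ?muln0.
Qed.

Lemma normal_form_mexp i p : normal_form ('X_[mexp i] * p) = basis_form i * normal_form p.
Proof.
apply: mlinearM => e; have [/codomP[k ->]|di] := boolP (i \in codom b).
  rewrite basis_form_basis; apply: normal_monomial_indep => i' h di'.
  rewrite mnmE => wt0; apply: wt_unique wt0 _.
  by apply: contraNneq di' => <-; apply: codom_f.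
exact: normal_monomial_dep.
Qed.

Lemma normal_form_var (h : 'I_M) p : (forall i, dep i -> wt l i h = 0%N) ->
  normal_form ('X_h * p) = 'X_h * normal_form p.
Proof.
move=> wt0; apply: mlinearM => e; apply: normal_monomial_indep => i h' di.
by rewrite mnm1E; case: eqP => // <- _; apply: wt0.
Qed.

Lemma basis_form_std i : basis_form i =
  \sum_k (alpha A std k i)%:MP * basis_form (std k).
Proof.
apply: (alpha_change (phi := @mpolyC M kk) (tau := basis_form) (b := b)) => //.
  exact: std_inj.
by move=> i'; apply: eq_bigr => k _; rewrite basis_form_basis.
Qed.

(** On normal forms $T_i^{l_i}$ acts as multiplication by [basis_form i], and the basis forms
    satisfy the linear relations between the columns of [A]. *)
Lemma normal_form_relation a t : normal_form (a * relation m l A t) = 0.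
Proof.
have E i : normal_form (a * Tmon m l kk i) = basis_form i * normal_form a.
  by rewrite mulrC TmonE normal_form_mexp.
rewrite relationE // mulrCA mul_mpolyC /normal_form mlinearZ mulrBr mlinearB.
rewrite -!/(normal_form _) E basis_form_std mulr_suml mulr_sumr.
rewrite [X in _ - X](mlinear_sum normal_monomial) -sumrB big1 ?scaler0 // => k _.
by rewrite [a * _]mulrCA [in X in _ - X]mul_mpolyC [X in _ - X]mlinearZ -/(normal_form _) E -mul_mpolyC mulrA subrr.
Qed.

Lemma normal_form_ker p : pr p = 0 -> normal_form p = 0.
Proof.
move=> /R_pres.2[a ->]; rewrite /normal_form mlinear_sum big1 // => t _.
exact: normal_form_relation.
Qed.

Lemma pr_basis_form i : pr (basis_form i) = pr 'X_[mexp i].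
Proof.
rewrite -TmonE (pr_Tmon c_gt0 c_le_r A_gen R_pres bI) rmorph_sum.
by apply: eq_bigr => k _; rewrite rmorphM TmonE.
Qed.

Lemma pr_normal_monomial e : pr (normal_monomial e) = pr 'X_[e].
Proof.
have le_e h : (\sum_(i | dep i) exponent i e * wt l i h <= e h)%N.
  have [[i /andP[di wi]]|no] := pselect (exists i, dep i && (0 < wt l i h)%N).
    rewrite (bigD1 i) //= big1 ?addn0 => [|i' /andP[_ i'i]].
      by apply: (exponentP i e _).1.
    by rewrite (wt_unique wi) ?muln0 // eq_sym.
  rewrite big1 // => i di; have [->|wi] := posnP (wt l i h); first by rewrite muln0.
  by case: no; exists i; rewrite di.
rewrite /normal_monomial rmorphM rmorph_prod /=.
under eq_bigr => i _ do rewrite rmorphXn pr_basis_form -rmorphXn mpolyXn.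
rewrite -rmorph_prod -rmorphM mprodXE -mpolyXD; congr (pr 'X_[_]); apply/mnmP => h.
rewrite mnmDE mnm_sumE mnmE; under eq_bigr => i _ do rewrite mulmnE mnmE mulnC.
by rewrite subnKC.
Qed.

Lemma pr_normal_form p : pr (normal_form p) = pr p.
Proof.
rewrite /normal_form [in RHS](mpolyE p) !rmorph_sum; apply: eq_bigr => e _.
by rewrite /= -!mul_mpolyC [LHS]rmorphM [RHS]rmorphM /= pr_normal_monomial.
Qed.

(** The normal form commutes with variables outside the dependent blocks. It turns the equation in
    [R] into one between polynomials, where ['X_j] is prime and does not divide ['X_h]. *)
Lemma basis_var_regular (j h : 'I_M) p p' : h != j ->
  (forall i, dep i -> wt l i h = 0%N) -> (forall i, dep i -> wt l i j = 0%N) ->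
  pr ('X_h * p) = pr ('X_j * p') -> exists p'', pr p = pr ('X_j * p'').
Proof.
move=> hj hB jB /eqP; rewrite -subr_eq0 -rmorphB => /eqP/normal_form_ker/eqP.
rewrite /normal_form mlinearB subr_eq0 -!/(normal_form _) !normal_form_var // => /eqP E.
have := congr1 (kill j) E; rewrite !rmorphM /= !killX eqxx (negPf hj) mul0r => /eqP.
rewrite mulf_eq0 => /orP[/eqP X0|/eqP/kill_eq0[p'' Ep]].
  have /eqP := congr1 (mcoeff U_(h)) X0.
  by rewrite mcoeffX eqxx mcoeff0 oner_eq0.
by exists p''; rewrite -pr_normal_form Ep.
Qed.

End NormalForm.

Lemma cox_var_regular (kk : closedFieldType) (r c m : nat) (n : 'I_r.+1 -> nat)
    (l : forall i : 'I_r.+1, 'I_(n i) -> nat) (A : 'M[kk]_(c.+1, r.+1))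
    (R : idomainType) (pr : {rmorphism {mpoly kk[#|vars m n|]} -> R}) :
  (0 < c)%N -> (c <= r)%N -> (forall i, 0 < n i)%N ->
  (forall i (j : 'I_(n i)), 0 < l i j)%N -> general_position A ->
  presents_RAP l A pr ->
  forall j h p p', h != j -> pr ('X_h * p) = pr ('X_j * p') ->
    exists p'', pr p = pr ('X_j * p'').
Proof.
move=> c_gt0 c_le_r n_gt0 l_gt0 A_gen R_pres j h p p' hj.
(* The basis is chosen to contain the blocks of both variables. A variable outside all blocks
   imposes no condition, so block 0 stands in for it. *)
have [b [bI [k [k' [bk bk']]]]] :=
  basis_containing c_gt0 c_le_r (odflt ord0 (blk j)) (odflt ord0 (blk h)).
apply: (basis_var_regular c_gt0 c_le_r n_gt0 l_gt0 A_gen R_pres bI) => // i di;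
  apply: wt_blk; apply: contraNneq di => bl.
  by rewrite bl /= in bk'; rewrite -bk'; apply: codom_f.
by rewrite bl /= in bk; rewrite -bk; apply: codom_f.
Qed.

(** * Rays of the fan *)

Lemma biggcd_scale (I : finType) (f : I -> int) (x : int) : 0 <= x ->
  \big[gcdz/0]_i (x * f i) = x * \big[gcdz/0]_i f i.
Proof.
move=> x0; apply/esym/(big_morph (fun y => x * y)); last by rewrite mulr0.
by move=> y z; rewrite -mulz_gcdr gez0_abs.
Qed.

Section PrimitiveVectors.
Variable N : nat.
Implicit Types a b : 'cV[int]_N.

Lemma primitive_neq0 a : primitive a -> a != 0.
Proof.
move=> pa; apply/eqP => a0; have : (0 %| \big[gcdz/0]_i a i ord0)%Z.
  by apply: dvdz_biggcd => i; rewrite a0 mxE.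
by rewrite (pa : \big[gcdz/0]_i a i 0 = 1).
Qed.

Lemma primitive_proportional a b (x y : int) : primitive a -> primitive b ->
  0 < x -> 0 <= y -> x *: b = y *: a -> a = b.
Proof.
move=> pa pb x0 y0 E; suff xy : x = y.
  apply/colP => i; have /colP/(_ i) := E; rewrite !mxE xy => /mulfI-> //.
  by rewrite -xy gt_eqF.
rewrite -[x]mulr1 -[y]mulr1 -{1}pb -pa -!biggcd_scale //; last exact: ltW.
by apply: eq_bigr => i _; have /colP/(_ i) := E; rewrite !mxE.
Qed.

Lemma pairing_tr a b : pairing a^T b = pairing b^T a.
Proof. by rewrite /pairing !mxE; apply: eq_bigr => i _; rewrite !mxE mulrC. Qed.

Lemma dot_gt0 a : a != 0 -> 0 < pairing a^T a.
Proof.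
move=> a0; rewrite /pairing mxE lt0r; apply/andP; split; last first.
  by apply: sumr_ge0 => i _; rewrite mxE -expr2 sqr_ge0.
apply: contra_neq a0 => /eqP; rewrite psumr_eq0 => [/allP H|i _]; last first.
  by rewrite mxE -expr2 sqr_ge0.
apply/colP => i; have := H i (mem_index_enum _).
by rewrite !mxE mulf_eq0 orbb => /eqP.
Qed.

(* If the scalar product $a b$ is nonnegative, then $(a b) a - (a a) b$ is
   orthogonal to [a] and, by Cauchy-Schwarz, negative on [b]. *)
Lemma primitive_separated a b : primitive a -> primitive b -> a <> b ->
  exists u, 0 <= pairing u a /\ pairing u b < 0.
Proof.
move=> pa pb ab; have a0 := dot_gt0 (primitive_neq0 pa).
have [ab0|ab0] := ltP (pairing a^T b) 0; first by exists a^T; rewrite ltW.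
pose w := pairing a^T b *: a - pairing a^T a *: b.
have wE v : pairing w^T v = pairing a^T b * pairing a^T v - pairing a^T a * pairing b^T v.
  by rewrite /w linearB !linearZ /= pairingD !pairingZ pairingN mulrN.
exists w^T; rewrite !wE pairing_tr [pairing b^T a]pairing_tr mulrC subrr; split=> //.
have w0 : w != 0.
  apply/eqP => /eqP; rewrite subr_eq0 => /eqP/esym/(primitive_proportional pa pb a0 ab0).
  exact: ab.
have := dot_gt0 w0; rewrite wE.
have -> : pairing a^T w = 0.
  by rewrite pairing_tr wE [pairing b^T a]pairing_tr mulrC subrr.
by rewrite mulr0 sub0r oppr_gt0 pmulr_rlt0 // pairing_tr wE.
Qed.

End PrimitiveVectors.

Section Rays.
Variables (N M : nat) (P : 'M[int]_(N, M)) (Sigma : set (set 'cV[rat]_N)).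
Hypothesis P_gen : generator_matrix P.
Hypothesis Sigma_fan : fan Sigma.
Hypothesis Sigma_rays : has_rays P Sigma.

Lemma col_separated i j : i != j ->
  exists u, 0 <= pairing u (col i P) /\ pairing u (col j P) < 0.
Proof.
case: P_gen => P_inj P_prim _ ij; apply: primitive_separated => //.
by move=> /P_inj ji; rewrite ji eqxx in ij.
Qed.

Lemma ratcol_neq0 j : ratcol P j != 0.
Proof.
case: P_gen => _ P_prim _; apply: contra_neq (primitive_neq0 (P_prim j)) => /colP v0.
by apply/colP => i; apply: (@intr_inj rat); have := v0 i; rewrite !mxE.
Qed.

Lemma ray_ratcol j h : ray (ratcol P j) (ratcol P h) <-> h = j.
Proof.
split=> [[a a0 E]|->]; last by exists 1; rewrite ?scale1r.
case: P_gen => P_inj P_prim _; apply/esym/P_inj.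
apply: (primitive_proportional (x := denq a) (y := numq a)) => //.
  by rewrite numq_ge0.
apply/colP => i; apply: (@intr_inj rat); have /colP/(_ i) := E.
rewrite !mxE !rmorphM /= => ->.
by rewrite numqE mulrA [a * _]mulrC.
Qed.

Lemma ray_fan j : Sigma (ray (ratcol P j)).
Proof. by apply/(Sigma_rays (ratcol_neq0 j)); exists j. Qed.

(** Cones of a fan meet in faces, so some functional nonnegative on [C] vanishes there exactly on
    the ray of [j]. Clearing denominators makes it integral, and [j] is the only column of [P] on
    this ray. *)
Lemma face_functional C j : Sigma C -> C (ratcol P j) ->
  exists u, pairing u (col j P) = 0 /\
    forall i, C (ratcol P i) -> i <> j -> 0 < pairing u (col i P).
Proof.
move=> SC Cj; case: Sigma_fan => _ _ _ Sface.
have [[u [uC uE]] _] := Sface _ _ SC (ray_fan j).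
have {uE} uE x : C x -> (u *m x) 0 0 = 0 <-> ray (ratcol P j) x.
  move=> Cx; have : (C `&` ray (ratcol P j))%classic x <-> C x /\ (u *m x) 0 0 = 0.
    by rewrite uE.
  by case=> H1 H2; split=> [ux|rx]; [case: H2 | case: H1].
have [k [w [k0 wE]]] := rat_clear u.
have wu i : (pairing w (col i P))%:~R = k%:R * (u *m ratcol P i) 0 0.
  have <- : ((k%:R *: u) *m ratcol P i) 0 0 = k%:R * (u *m ratcol P i) 0 0.
    by rewrite -scalemxAl mxE.
  by rewrite wE /ratcol -map_mxM mxE.
exists w; split=> [|i Ci ij].
  by apply: (@intr_inj rat); rewrite wu ((uE _ Cj).2 _) ?mulr0 //; apply/ray_ratcol.
rewrite -(ltr0z rat) wu mulr_gt0 ?ltr0n // lt0r uC // andbT.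
by apply/eqP => /(uE _ Ci)/ray_ratcol.
Qed.

End Rays.

(** * The canonical class *)

Lemma wedge_rational_form (F : fieldType) (k : set F) q (g : F) (f : 'I_q -> F) :
  rational_form k (fun D => g * wedge_d f D).
Proof.
split=> [D i E E' a _ _ _|D i j _ ij Dij].
  rewrite /wedge_d (determinant_multilinear (i0 := i) (b := a) (c := 1)
    (B := \matrix_(i', j) update D i E i' (f j))
    (C := \matrix_(i', j) update D i E' i' (f j))).
  - by rewrite mul1r mulrDr mulrCA.
  - by apply/rowP => j; rewrite !mxE /update eqxx mul1r.
  - by apply/matrixP => i' j; rewrite !mxE /update eq_sym (negPf (neq_lift _ _)).
  - by apply/matrixP => i' j; rewrite !mxE /update eq_sym (negPf (neq_lift _ _)).
rewrite /wedge_d (determinant_alternate ij) ?mulr0 // => h.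
by rewrite !mxE Dij.
Qed.

(** * Degrees in the grading group *)

Section Degrees.
Variables (r c m s : nat) (n : 'I_r.+1 -> nat).
Variable l : forall i : 'I_r.+1, 'I_(n i) -> nat.
Variable d : 'M[int]_(s, #|vars m n|).
Hypothesis c_le_r : (c <= r)%N.

Local Notation M := #|vars m n|.
Local Notation P := (stackP l d).

Lemma sum_vars (V : nmodType) (f : 'I_M -> V) : \sum_h f h =
  \sum_i \sum_(j < n i) f (Tidx m j) + \sum_(t < m) f (Sidx n t).
Proof.
rewrite (reindex (@enum_rank (vars m n))) /=; last exact/onW_bij/enum_rank_bij.
rewrite big_sumType /=; congr (_ + _).
by rewrite sig_big_dep /=; apply: eq_bigr => -[i j].
Qed.

Lemma projQ_sum I (t : seq I) (Q : pred I) (f : I -> 'rV[int]_M) :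
  projQ P (\sum_(i <- t | Q i) f i) = \sum_(i <- t | Q i) projQ P (f i).
Proof. exact: (big_morph _ (projQD P) (projQ0 P)). Qed.

Lemma projQ_sum_vars (f : 'I_M -> nat) : projQ P (\row_h (f h)%:Z) =
  \sum_i \sum_(j < n i) deg_var P (Tidx m j) *+ f (Tidx m j) +
  \sum_(t < m) deg_var P (Sidx n t) *+ f (Sidx n t).
Proof.
rewrite -(sum_vars (fun h => deg_var P h *+ f h)) [\row__ _]row_sum_delta projQ_sum.
apply: eq_bigr => h _; rewrite mxE /deg_var.
elim: (f h) => [|k IH]; first by rewrite scale0r projQ0 mulr0n.
by rewrite intS scalerDl scale1r projQD IH mulrS.
Qed.

Lemma projQ_mexp i : projQ P (mnm_row (mexp m l i)) =
  \sum_(j < n ord0) deg_var P (Tidx m j) *+ l j.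
Proof.
have -> : projQ P (mnm_row (mexp m l i)) = projQ P (mnm_row (mexp m l ord0)).
  by apply/projQ_eq; exists (eps s i); apply: mexp_eps.
have -> : mnm_row (mexp m l ord0) = \row_h (wt l ord0 h)%:Z.
  by apply/rowP => h; rewrite !mxE mnmE.
rewrite projQ_sum_vars [X in _ + X]big1 ?addr0 => [|t _]; last by rewrite wt_Sidx.
rewrite (bigD1 ord0) //= [X in _ + X]big1 ?addr0 => [|i' i'0].
  by apply: eq_bigr => j _; rewrite wt_Tidx eqxx.
by rewrite big1 // => j _; rewrite wt_Tidx (negPf i'0).
Qed.

Lemma projQ_log_pole : projQ P (\row_j log_pole c (wt l) j) =
  - \sum_(i < r.+1) \sum_(j < n i) deg_var P (Tidx m j)
  - \sum_(t < m) deg_var P (Sidx n t)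
  + (\sum_(j < n ord0) deg_var P (Tidx m j) *+ l j) *+ (r - c).
Proof.
have -> : \row_j log_pole c (wt l) j =
    - (\row_(h < M) 1%:Z) + \sum_(i < r.+1 | (c < i)%N) mnm_row (mexp m l i).
  apply/rowP => h; rewrite !mxE /log_pole summxE; congr (_ + _).
  by rewrite -natz natr_sum; apply: eq_bigr => i _; rewrite mxE mnmE natz.
rewrite projQD projQN projQ_sum (projQ_sum_vars (fun=> 1%N)) -opprD; congr (- (_ + _) + _).
under eq_bigr => i _ do rewrite projQ_mexp.
rewrite big_const iter_addr_0; congr (_ *+ _).
have -> : #|[pred i : 'I_r.+1 | (c < i)%N]| = (\sum_(i < r.+1 | (c < i)%N) 1)%N by rewrite sum1_card.
rewrite -(big_mkord (fun i => (c < i)%N) (fun=> 1%N)) big_mkcond (@big_cat_nat _ _ _ c.+1) //=.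
rewrite big_nat big1 ?add0n => [|i /andP[_ ic]]; last by rewrite ltnNge -ltnS ic.
rewrite big_nat (eq_bigr (fun=> 1%N)) => [|i /andP[ci _]]; last by rewrite ci.
by rewrite -big_nat sum_nat_const_nat muln1 subSS.
Qed.

End Degrees.

Theorem proposition7p4
  (kk : closedFieldType) (char0 : [pchar kk] =i pred0)
  (r c m s : nat) (n : 'I_r.+1 -> nat)
  (l : forall i : 'I_r.+1, 'I_(n i) -> nat)
  (A : 'M[kk]_(c.+1, r.+1)) (d : 'M[int]_(s, #|vars m n|))
  (c_gt0 : (0 < c)%N) (c_le_r : (c <= r)%N)
  (n_gt0 : forall i, (0 < n i)%N)
  (l_gt0 : forall i (j : 'I_(n i)), (0 < l i j)%N)
  (A_gen : general_position A)
  (s_gt0 : (0 < s)%N) (s_le : (s <= \sum_i n i + m - r)%N)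
  (P := stackP l d)
  (P_gen : generator_matrix P)
  (Sigma : set (set 'cV[rat]_(r + s)))
  (Sigma_fan : fan Sigma) (Sigma_rays : has_rays P Sigma)
  (R : idomainType) (pr : {rmorphism {mpoly kk[#|vars m n|]} -> R})
  (R_pres : presents_RAP l A pr)
  (F : fieldType) (io : {rmorphism F -> {fraction R}})
  (F_funs : is_function_field P pr io) :
  let wT i (j : 'I_(n i)) := deg_var P (Tidx m j) in
  let wS (k : 'I_m) := deg_var P (Sidx n k) in
  canonical_class pr io Sigma (s + c)
    (- \sum_(i < r.+1) \sum_(j < n i) wT i j
     - \sum_(k < m) wS k
     + (\sum_(j < n ord0) wT ord0 j *+ l ord0 j) *+ (r - c)).
Proof.
move=> wT wS; have var_neq0 := cox_var_neq0 char0 c_gt0 c_le_r A_gen P_gen R_pres.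
have pr_component := cox_component (d := d) c_gt0 c_le_r A_gen R_pres.
have var_regular := cox_var_regular c_gt0 c_le_r n_gt0 l_gt0 A_gen R_pres.
have [kap kapE] := scalars_exist F_funs.
have [chi chiE] := monomials_exist F_funs var_neq0.
have chi_neq0 := cox_chi_neq0 var_neq0 chiE.
have chiD := cox_chiD var_neq0 chiE.
have kE := constantsE kapE.
have chi_gen := cox_generate F_funs var_neq0 kapE chiE.
have chi_rel := cox_chi_rel char0 c_gt0 c_le_r A_gen P_gen R_pres kapE chiE.
have std_free := cox_std_free char0 c_gt0 c_le_r A_gen P_gen R_pres kapE chiE.
have [_ P_prim _] := P_gen.
have /choice[W /choice[k0 WP]] := ray_coordinates kE char0 c_gt0 c_le_r A_gen chi_neq0 chiD
  (chi_rel) chi_gen std_free (@wt_blk _ m n l) (eps_pairing (s := s) l d) P_prim.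
have chart_ringE := chart_ringE var_neq0 kapE chiE.
(* From here on a cone matters only through the set of columns of [P] that it contains. *)
pose Hs : set (set 'I_#|vars m n|) :=
  [set H | exists2 C, Sigma C & H = [set j | C (ratcol P j)]]%classic.
have ray_set j : [set h | ray (ratcol P j) (ratcol P h)]%classic = [set j]%classic.
  by apply/seteqP; split=> h /(ray_ratcol P_gen).
have chE B : charts P pr io Sigma B <-> exists2 H, Hs H & B = chart kap P chi H.
  split=> [[C SC ->]|[_ [C SC ->] ->]].
    by exists [set j | C (ratcol P j)]%classic; [exists C | rewrite chart_ringE].
  by exists C => //; rewrite chart_ringE.
have Hs_ray j : Hs [set j]%classic.
  by exists (ray (ratcol P j)); [apply: ray_fan | rewrite ray_set].
have Hs_face H j : Hs H -> H j -> exists u, pairing u (col j P) = 0 /\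
    forall i, H i -> i <> j -> 0 < pairing u (col i P).
  by move=> [C SC ->]; apply: (face_functional P_gen Sigma_fan Sigma_rays SC).
have Hs_ideal H j f : Hs H -> H j -> chart kap P chi H f ->
    laurent kap chi [set u | 1 <= pairing u (col j P)]%classic f ->
    ray_ideal kap P chi H j f.
  move=> [C SC ->] Cj.
  exact: (chart_ray_ideal var_neq0 pr_component var_regular kapE chiE Cj).
have separated := col_separated P_gen.
have cdE j : coord_divisor P pr io j =
    localization (chart kap P chi [set j]) (vanishing_ideal P pr io (ray (ratcol P j)) j).
  by rewrite /coord_divisor chart_ringE ray_set.
have van_sub j f : vanishing_ideal P pr io (ray (ratcol P j)) j f ->
    chart kap P chi [set j] f /\ exists e : nat,
      laurent kap chi [set u | 1 <= pairing u (col j P)]%classic (f ^+ e).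
  by move=> /(vanishing_sub var_neq0 pr_component kapE chiE); rewrite chart_ringE ray_set.
have van_sup j f : laurent kap chi [set u | 1 <= pairing u (col j P)]%classic f ->
    vanishing_ideal P pr io (ray (ratcol P j)) j f.
  by apply: (vanishing_sup var_neq0 kapE chiE) => h /(ray_ratcol P_gen).
have WC j : coordinates kap (fun i => chi (row i (W j))) by case: (WP j).
have W_row j i : pairing (row i (W j)) (col j P) = (i == k0 j)%:R by case: (WP j).
have W_perp j a : pairing a (col j P) = 0 ->
    monomial_unit kap chi (W j) (fun p => kill (k0 j) p = 0) (col j P) a.
  by case: (WP j) => _ _ H _; apply: H.
have WtC := std_coordinates c_gt0 c_le_r chi_neq0 chiD chi_rel chi_gen std_free.
have Wt_unit := std_monomial_unit c_gt0 c_le_r chi_neq0 chiD chi_rel.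
have w0_neq0 := log_form_neq0 kE c_gt0 c_le_r chi_neq0 chiD chi_rel chi_gen std_free.
have w0_form : rational_form (constants pr io) (log_form (r:=r) (c:=c) (s:=s) chi).
  exact: wedge_rational_form.
have w0_ray j := let: And4 _ _ _ H := WP j in H.
have w0_torus : exists a e, a != 0 /\ forall D : 'I_(s + c) -> F -> F,
    (forall i, derivation (constants pr io) (D i)) ->
    log_form chi D = kap a * chi e *
      wedge_d (fun i => chi (row i (std_frame c s (inord c : 'I_r.+1)))) D.
  exists 1, (- \sum_i row i (std_frame c s (inord c : 'I_r.+1))).
  by split=> [|D _]; [exact: oner_neq0 | rewrite rmorph1 mul1r].
have combE : coord_comb P pr io (\row_j log_pole c (wt l) j) =
    pole_divisor (log_pole c (wt l)) (coord_divisor P pr io).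
  by apply/funext => O; apply: eq_bigr => j _; rewrite mxE.
split.
  exists (coord_comb P pr io (\row_j log_pole c (wt l) j)); rewrite combE.
  exact: (pole_divisor_canonical kE char0 chi_neq0 chiD chE Hs_ray Hs_face Hs_ideal
    separated WC W_row W_perp WtC Wt_unit w0_form w0_neq0 w0_ray w0_torus cdE van_sub van_sup).
move=> D DK; exists (\row_j log_pole c (wt l) j); split; first exact: projQ_log_pole.
rewrite combE.
exact: (canonical_lin_equiv kE char0 chi_neq0 chiD chE Hs_ray Hs_face Hs_ideal separated
  WC W_row W_perp WtC Wt_unit w0_neq0 w0_ray w0_torus cdE van_sub van_sup
  (Tidx m (Ordinal (n_gt0 ord0))) DK).
Qed.
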